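(* Let $n\ge 2$. Every non-selfinjective monomial algebra $A$ with $n$ simple modules (up to isomorphism) satisfies $$\operatorname{domdim}(A)\le 2n-2.$$ Moreover this bound is optimal and attained at a Nakayama algebra: there exists a non-selfinjective Nakayama algebra (which is in particular a monomial algebra) with $n$ simple modules and dominant dimension equal to $2n-2$.
   Context: Standing assumptions: $K$ is an arbitrary field; algebras are finite-dimensional connected $K$-algebras given by quiver and relations, i.e. of the form $KQ/I$ with $Q$ a finite quiver and $I$ an admissible ideal. Modules are finitely generated right modules. $A$ is selfinjective if the right regular module $A$ is injective. A monomial algebra is a quiver algebra $KQ/I$ with admissible ideal $I$ generated by zero relations (i.e. by paths). A Nakayama algebra is an algebra such that every indecomposable projective left or right module is uniserial. Dominant dimension: let $0\to A\to I_0\to I_1\to I_2\to\cdots$ be a minimal injective coresolution of the right regular module $A$. If $I_0$ is not projective, $\operatorname{domdim}(A):=0$; otherwise $\operatorname{domdim}(A):=\sup\{m\mid I_i \text{ is projective for } i=0,1,\dots,m\}+1$ (possibly $\infty$). *)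

(* Defs.v *)
From HB Require Import structures.
From mathcomp Require Import all_boot all_order all_algebra all_field.
From mathcomp Require Import finmap.
From mathcomp Require Import boolp classical_sets.
From mathcomp.multinomials Require Import monalg.

Set Implicit Arguments.
Unset Strict Implicit.
Unset Printing Implicit Defensive.

Import GRing.Theory.

Local Open Scope classical_set_scope.
Local Open Scope ring_scope.

(* Paths in a finite quiver.  A path is a start vertex together with a        *)
(* composable sequence of arrows; the trivial path at [v] is [(v, [::])].     *)

Record quiver := Quiver {
  vertex : finType;
  arrow : finType;
  src : arrow -> vertex;
  tgt : arrow -> vertex }.

Section Paths.
Variable Q : quiver.

Fixpoint is_walk (v : vertex Q) (s : seq (arrow Q)) : bool :=
  if s is a :: s' then (src a == v) && is_walk (tgt a) s' else true.

Record qpath := QPath {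
  qpath_val : vertex Q * seq (arrow Q);
  _ : is_walk qpath_val.1 qpath_val.2 }.
HB.instance Definition _ := [isSub for qpath_val].
HB.instance Definition _ := [Choice of qpath by <:].

Definition start (p : qpath) : vertex Q := (val p).1.
Definition arrows (p : qpath) : seq (arrow Q) := (val p).2.
Definition finish (p : qpath) : vertex Q := last (start p) (map (@tgt Q) (arrows p)).

Definition trivial_path (v : vertex Q) : qpath := @QPath (v, [::]) isT.

(* First [p], then [q]; [None] when the two are not composable.  Under the    *)
(* test [finish p == start q], [insub] always succeeds (see [path_catE]).     *)
Definition path_cat (p q : qpath) : option qpath :=
  if finish p == start q then insub (start p, arrows p ++ arrows q) else None.

Lemma is_walk_cat v s1 s2 :
  is_walk v (s1 ++ s2) = is_walk v s1 && is_walk (last v (map (@tgt Q) s1)) s2.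
Proof. by elim: s1 v => //= a s1 IH v; rewrite IH andbA. Qed.

Lemma path_catE p q : finish p = start q ->
  exists r, [/\ path_cat p q = Some r, start r = start p,
                finish r = finish q & arrows r = arrows p ++ arrows q].
Proof.
move=> epq; rewrite /path_cat epq eqxx.
have w : is_walk (start p) (arrows p ++ arrows q).
  by rewrite is_walk_cat (valP p) /= -/(finish p) epq (valP q).
rewrite (insubT (fun u => is_walk u.1 u.2) (x := (start p, arrows p ++ arrows q)) w); eexists; split; first by [].
- by rewrite /start SubK.
- by rewrite /finish /start /arrows !SubK /= map_cat last_cat -/(finish p) epq.
- by rewrite /arrows SubK.
Qed.

Lemma qpath_inj p q : start p = start q -> arrows p = arrows q -> p = q.
Proof.
rewrite /start /arrows => e1 e2; apply: val_inj.
by case: (val p) (val q) e1 e2 => [a b] [c d] /= -> ->.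
Qed.

Lemma path_cat_none p q : finish p != start q -> path_cat p q = None.
Proof. by rewrite /path_cat => /negbTE->. Qed.

Lemma path_catA p q r :
  obind (path_cat p) (path_cat q r) = obind (path_cat^~ r) (path_cat p q).
Proof.
have [epq|npq] := eqVneq (finish p) (start q); last first.
  rewrite (path_cat_none npq) /=.
  have [/path_catE[u [-> su _ _]]|/path_cat_none->] // :=
    eqVneq (finish q) (start r).
  by rewrite /= path_cat_none // su.
have [u [-> su fu au]] := path_catE epq.
have [eqr|nqr] := eqVneq (finish q) (start r); last first.
  by rewrite (path_cat_none nqr) /= path_cat_none // fu.
have [w [-> sw fw aw]] := path_catE eqr.
rewrite /=.
have [|x [-> sx fx ax]] := @path_catE p w; first by rewrite sw.
have [|y [-> sy fy ay]] := @path_catE u r; first by rewrite fu.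
congr Some; apply: qpath_inj; first by rewrite sx sy su.
by rewrite ax ay aw au catA.
Qed.

Lemma path_cat1p v p :
  path_cat (trivial_path v) p = if v == start p then Some p else None.
Proof.
have [e|n] := eqVneq v (start p); last by rewrite path_cat_none.
have [r [-> sr _ ar]] := @path_catE (trivial_path v) p e.
by congr Some; apply: qpath_inj; rewrite ?sr ?ar.
Qed.

Lemma path_catp1 v p :
  path_cat p (trivial_path v) = if v == finish p then Some p else None.
Proof.
have [e|n] := eqVneq v (finish p); last by rewrite path_cat_none // eq_sym.
have [r [-> sr _ ar]] := @path_catE p (trivial_path v) (esym e).
by congr Some; apply: qpath_inj; rewrite ?sr // ar cats0.
Qed.

End Paths.

(* The path algebra KQ: the vector space with basis the paths, with           *)
(* concatenation (or 0) as product and the sum of the trivial paths as unit.  *)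
(* For an empty quiver it is the zero ring, hence only a [pzRingType].        *)

Record path_algebra (K : fieldType) (Q : quiver) :=
  PathAlgebra { coeffs : {malg K[qpath Q]} }.
HB.instance Definition _ K Q := [isNew for @coeffs K Q].
HB.instance Definition _ K Q := [Choice of path_algebra K Q by <:].

(* The operations are locked: without this, unification unfolds them down to  *)
(* the finite map encoding of their results.                                  *)
HB.lock Definition path_zero (K : fieldType) (Q : quiver) : path_algebra K Q :=
  PathAlgebra 0.
HB.lock Definition path_add (K : fieldType) (Q : quiver) (x y : path_algebra K Q) :=
  PathAlgebra (coeffs x + coeffs y).
HB.lock Definition path_opp (K : fieldType) (Q : quiver) (x : path_algebra K Q) :=
  PathAlgebra (- coeffs x).
HB.lock Definition path_scale (K : fieldType) (Q : quiver) (a : K)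
    (x : path_algebra K Q) := PathAlgebra (a *: coeffs x).
HB.lock Definition of_path (K : fieldType) (Q : quiver) (p : qpath Q) :
  path_algebra K Q := PathAlgebra << p >>.

Section PathModule.
Variables (K : fieldType) (Q : quiver).
Local Notation path_algebra := (path_algebra K Q).

Let addE (x y : path_algebra) : path_add x y = PathAlgebra (coeffs x + coeffs y).
Proof. by rewrite path_add.unlock. Qed.
Let zeroE : path_zero K Q = PathAlgebra 0.
Proof. by rewrite path_zero.unlock. Qed.
Let oppE (x : path_algebra) : path_opp x = PathAlgebra (- coeffs x).
Proof. by rewrite path_opp.unlock. Qed.
Let scaleE a (x : path_algebra) : path_scale a x = PathAlgebra (a *: coeffs x).
Proof. by rewrite path_scale.unlock. Qed.

Fact path_addA : associative (@path_add K Q).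
Proof. by move=> x y z; rewrite !addE addrA. Qed.
Fact path_addC : commutative (@path_add K Q).
Proof. by move=> x y; rewrite !addE addrC. Qed.
Fact path_add0 : left_id (path_zero K Q) (@path_add K Q).
Proof. by case=> x; rewrite addE zeroE add0r. Qed.
Fact path_addN : left_inverse (path_zero K Q) (@path_opp K Q) (@path_add K Q).
Proof. by case=> x; rewrite addE zeroE oppE addNr. Qed.

HB.instance Definition _ := GRing.isZmodule.Build path_algebra
  path_addA path_addC path_add0 path_addN.

Lemma coeffsD (x y : path_algebra) : coeffs (x + y) = coeffs x + coeffs y.
Proof. by rewrite [x + y]addE. Qed.
Lemma coeffs0 : coeffs (0 : path_algebra) = 0. Proof. by rewrite [0 in LHS]zeroE. Qed.

Fact path_scaleA a b (x : path_algebra) : path_scale a (path_scale b x) = path_scale (a * b) x.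
Proof. by rewrite !scaleE scalerA. Qed.
Fact path_scale1 : left_id 1 (@path_scale K Q).
Proof. by case=> x; rewrite scaleE scale1r. Qed.
Fact path_scaleDr : right_distributive (@path_scale K Q) +%R.
Proof. by move=> a x y; rewrite !scaleE [RHS]addE coeffsD scalerDr. Qed.
Fact path_scaleDl (x : path_algebra) : {morph (@path_scale K Q)^~ x : a b / a + b}.
Proof. by move=> a b; rewrite !scaleE [RHS]addE scalerDl. Qed.

HB.instance Definition _ := GRing.Zmodule_isLmodule.Build K path_algebra
  path_scaleA path_scale1 path_scaleDr path_scaleDl.

Lemma coeffsZ a (x : path_algebra) : coeffs (a *: x) = a *: coeffs x.
Proof. by rewrite [a *: x]scaleE. Qed.

Lemma coeffs_of_path (p : qpath Q) : coeffs (of_path K p) = << p >>.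
Proof. by rewrite of_path.unlock. Qed.

Lemma coeffs_inj : injective (@coeffs K Q). Proof. exact: val_inj. Qed.

End PathModule.

Definition opath (K : fieldType) (Q : quiver) (o : option (qpath Q)) :
  path_algebra K Q := oapp (@of_path K Q) 0 o.

HB.lock Definition path_mul (K : fieldType) (Q : quiver) (x y : path_algebra K Q) :
  path_algebra K Q :=
  \sum_(p <- msupp (coeffs x)) \sum_(q <- msupp (coeffs y))
    ((coeffs x)@_p * (coeffs y)@_q) *: opath K (path_cat p q).

HB.lock Definition path_one (K : fieldType) (Q : quiver) : path_algebra K Q :=
  \sum_(v : vertex Q) of_path K (trivial_path v).

Section PathAlgebra.
Variables (K : fieldType) (Q : quiver).
Local Notation path_algebra := (path_algebra K Q).
Local Notation path_mul := (@path_mul K Q).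
Local Notation path_one := (path_one K Q).
Local Notation of_path := (@of_path K Q).
Local Notation opath := (@opath K Q).

Local Open Scope fset_scope.
Local Open Scope ring_scope.

Lemma path_mulw (d1 d2 : {fset qpath Q}) x y :
  msupp (coeffs x) `<=` d1 -> msupp (coeffs y) `<=` d2 ->
  path_mul x y = \sum_(p <- d1) \sum_(q <- d2)
    ((coeffs x)@_p * (coeffs y)@_q) *: opath (path_cat p q).
Proof.
move=> l1 l2; rewrite path_mul.unlock (big_fset_incl _ l1) /=.
  apply/eq_bigr => p _; apply/big_fset_incl => // q _ /mcoeff_outdom->.
  by rewrite mulr0 scale0r.
move=> p _ /mcoeff_outdom xp; rewrite big1 // => q _.
by rewrite xp mul0r scale0r.
Qed.

Lemma path_mulE x y : path_mul x y =
  \sum_(p <- msupp (coeffs x)) \sum_(q <- msupp (coeffs y))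
    ((coeffs x)@_p * (coeffs y)@_q) *: opath (path_cat p q).
Proof. exact: path_mulw. Qed.

Lemma path_mulDl : left_distributive path_mul +%R.
Proof.
move=> x y z; pose d := msupp (coeffs x) `|` msupp (coeffs y).
rewrite (@path_mulw d (msupp (coeffs z)) (x + y)) ?coeffsD ?msuppD_le //.
rewrite (@path_mulw d (msupp (coeffs z)) x) ?fsubsetUl //.
rewrite (@path_mulw d (msupp (coeffs z)) y) ?fsubsetUr //.
rewrite -big_split; apply: eq_bigr => p _ /=.
rewrite -big_split; apply: eq_bigr => q _ /=.
by rewrite mcoeffD mulrDl scalerDl.
Qed.

Lemma path_mulDr : right_distributive path_mul +%R.
Proof.
move=> z x y; pose d := msupp (coeffs x) `|` msupp (coeffs y).
rewrite (@path_mulw (msupp (coeffs z)) d z (x + y)) ?coeffsD ?msuppD_le //.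
rewrite (@path_mulw (msupp (coeffs z)) d z x) ?fsubsetUl //.
rewrite (@path_mulw (msupp (coeffs z)) d z y) ?fsubsetUr //.
rewrite -big_split; apply: eq_bigr => p _ /=.
rewrite -big_split; apply: eq_bigr => q _ /=.
by rewrite mcoeffD mulrDr scalerDl.
Qed.

Lemma path_mul0l x : path_mul 0 x = 0.
Proof. by apply: (addIr (path_mul 0 x)); rewrite -path_mulDl !add0r. Qed.

Lemma path_mul0r x : path_mul x 0 = 0.
Proof. by apply: (addIr (path_mul x 0)); rewrite -path_mulDr !add0r. Qed.

Lemma path_mulZl a x y : path_mul (a *: x) y = a *: path_mul x y.
Proof.
rewrite (@path_mulw (msupp (coeffs x)) (msupp (coeffs y)) (a *: x)) ?coeffsZ ?msuppZ_le //.
rewrite path_mulE scaler_sumr; apply: eq_bigr => p _.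
rewrite scaler_sumr; apply: eq_bigr => q _.
by rewrite mcoeffZ scalerA mulrA.
Qed.

Lemma path_mulZr a x y : path_mul x (a *: y) = a *: path_mul x y.
Proof.
rewrite (@path_mulw (msupp (coeffs x)) (msupp (coeffs y)) x (a *: y)) ?coeffsZ ?msuppZ_le //.
rewrite path_mulE scaler_sumr; apply: eq_bigr => p _.
rewrite scaler_sumr; apply: eq_bigr => q _.
by rewrite mcoeffZ scalerA mulrCA.
Qed.

Lemma path_mulUU p q : path_mul (of_path p) (of_path q) = opath (path_cat p q).
Proof.
rewrite (@path_mulw [fset p] [fset q]) ?coeffs_of_path ?msuppU_le //.
by rewrite !big_seq_fset1 !mcoeffUU mulr1 scale1r.
Qed.

Lemma path_algebraE (x : path_algebra) :
  x = \sum_(p <- msupp (coeffs x)) (coeffs x)@_p *: of_path p.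
Proof.
apply: coeffs_inj; rewrite (big_morph _ (@coeffsD K Q) (@coeffs0 K Q)) [LHS]monalgE.
apply: eq_bigr => p _; rewrite coeffsZ coeffs_of_path; apply/malgP => q.
by rewrite [LHS]mcoeffU mcoeffZ [X in _ * X]mcoeffU mulr_natr.
Qed.

Lemma path_algebra_ind (P : path_algebra -> Prop) :
  P 0 -> (forall a p x, P x -> P (a *: of_path p + x)) -> forall x, P x.
Proof.
move=> P0 PD x; rewrite [x]path_algebraE.
elim: (enum_fset _) => [|p s IH]; rewrite ?big_nil ?big_cons //; exact: PD.
Qed.

Lemma path_mulA : associative path_mul.
Proof.
elim/path_algebra_ind => [|a p x IHx] y z; first by rewrite !path_mul0l.
rewrite !path_mulDl -{}IHx !path_mulZl; congr (_ *: _ + _).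
elim/path_algebra_ind: y => [|b q y IHy]; first by rewrite path_mul0r !path_mul0l path_mul0r.
rewrite path_mulDl !path_mulDr path_mulDl -{}IHy !(path_mulZl, path_mulZr).
congr (_ *: _ + _).
elim/path_algebra_ind: z => [|c r z IHz]; first by rewrite !path_mul0r.
rewrite !path_mulDr -{}IHz !path_mulZr; congr (_ *: _ + _).
rewrite !path_mulUU.
have hl o : path_mul (of_path p) (opath o) = opath (obind (path_cat p) o).
  by case: o => [u|] /=; rewrite ?path_mul0r ?path_mulUU.
have hr o : path_mul (opath o) (of_path r) = opath (obind ((@path_cat Q)^~ r) o).
  by case: o => [u|] /=; rewrite ?path_mul0l ?path_mulUU.
by rewrite hl hr path_catA.
Qed.

Lemma path_mul1 : left_id path_one path_mul.
Proof.
elim/path_algebra_ind => [|a p x IHx]; first by rewrite path_mul0r.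
rewrite path_mulDr IHx path_mulZr; congr (_ *: _ + _).
rewrite path_one.unlock (big_morph (path_mul^~ (of_path p)) (fun u v => path_mulDl u v _) (path_mul0l _)).
rewrite (bigD1 (start p)) //= path_mulUU path_cat1p eqxx big1 ?addr0 // => v /negbTE nv.
by rewrite path_mulUU path_cat1p nv.
Qed.

Lemma path_mulr1 : right_id path_one path_mul.
Proof.
elim/path_algebra_ind => [|a p x IHx]; first by rewrite path_mul0l.
rewrite path_mulDl IHx path_mulZl; congr (_ *: _ + _).
rewrite path_one.unlock (big_morph (path_mul (of_path p)) (path_mulDr _) (path_mul0r _)).
rewrite (bigD1 (finish p)) //= path_mulUU path_catp1 eqxx big1 ?addr0 // => v /negbTE nv.
by rewrite path_mulUU path_catp1 nv.
Qed.

HB.instance Definition _ := GRing.Zmodule_isPzRing.Build path_algebra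
  path_mulA path_mul1 path_mulr1 path_mulDl path_mulDr.

End PathAlgebra.

Section Ideals.
Variable R : pzRingType.

Definition two_sided_ideal (I : set R) : Prop :=
  [/\ I 0, forall x y, I x -> I y -> I (x + y),
      forall a x, I x -> I (a * x) & forall a x, I x -> I (x * a)].

Definition ideal_gen (S : set R) : set R := smallest two_sided_ideal S.

Definition ideal_power (I : set R) (m : nat) : set R :=
  ideal_gen [set x | exists2 f : 'I_m -> R, (forall i, I (f i)) & x = \prod_i f i].

End Ideals.

Section QuiverAlgebras.
Variable K : fieldType.

Definition arrow_ideal (Q : quiver) : set (path_algebra K Q) :=
  ideal_gen [set of_path K p | p in [set p : qpath Q | size (arrows p) = 1%N]].

Definition admissible (Q : quiver) (I : set (path_algebra K Q)) : Prop :=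
  [/\ two_sided_ideal I, I `<=` ideal_power (@arrow_ideal Q) 2 &
      exists2 m, (2 <= m)%N & ideal_power (@arrow_ideal Q) m `<=` I].

(* A is isomorphic to KQ/I, by way of a surjective morphism of K-algebras     *)
(* KQ -> A with kernel I.                                                     *)
Definition iso_quotient (A : falgType K) (Q : quiver)
    (I : set (path_algebra K Q)) : Prop :=
  exists phi : {rmorphism path_algebra K Q -> A},
    [/\ scalable phi, forall a, exists x, phi x = a & I = [set x | phi x = 0]].

Definition connected_algebra (A : falgType K) : Prop :=
  forall e : A, e * e = e -> (forall x, e * x = x * e) -> e = 0 \/ e = 1.

(* All algebras are connected by convention.                                  *)
Definition quiver_algebra (A : falgType K) : Prop :=
  connected_algebra A /\
  exists Q (I : set (path_algebra K Q)), admissible I /\ iso_quotient A I.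

Definition monomial_algebra (A : falgType K) : Prop :=
  connected_algebra A /\
  exists Q (Z : set (qpath Q)),
    admissible (ideal_gen [set of_path K p | p in Z]) /\
    iso_quotient A (ideal_gen [set of_path K p | p in Z]).

End QuiverAlgebras.

(* Left modules over R.  Right modules over A are left modules over the       *)
(* converse ring A^c, and (A^c)^o is the right regular module.                *)

Section Modules.
Variable R : nzRingType.
Implicit Types M N X Y : lmodType R.

Definition finitely_generated M : Prop :=
  exists k (g : 'I_k -> M),
    forall x, exists c : 'I_k -> R, x = \sum_i c i *: g i.

Definition isomorphic M N : Prop := exists f : {linear M -> N}, bijective f.

Definition submodule M (S : set M) : Prop :=
  [/\ S 0, forall x y, S x -> S y -> S (x + y) & forall a x, S x -> S (a *: x)].

(* Projectivity and injectivity are taken in the category of finitely         *)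
(* generated modules.                                                         *)
Definition projective_module M : Prop :=
  forall X Y (g : {linear X -> Y}) (f : {linear M -> Y}),
    finitely_generated X -> finitely_generated Y ->
    (forall y, exists x, g x = y) ->
    exists h : {linear M -> X}, forall m, g (h m) = f m.

Definition injective_module M : Prop :=
  forall X Y (g : {linear X -> Y}) (f : {linear X -> M}),
    finitely_generated X -> finitely_generated Y ->
    injective g ->
    exists h : {linear Y -> M}, forall x, h (g x) = f x.

Definition simple_module M : Prop :=
  (exists x : M, x != 0) /\
  forall S : set M, submodule S -> S = [set 0] \/ S = setT.

Definition indecomposable_module M : Prop :=
  (exists x : M, x != 0) /\
  forall S T : set M, submodule S -> submodule T ->
    S `&` T = [set 0] -> (forall x, exists2 s, S s & exists2 t, T t & x = s + t) ->
    S = [set 0] \/ T = [set 0].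

Definition uniserial_module M : Prop :=
  forall S T : set M, submodule S -> submodule T -> S `<=` T \/ T `<=` S.

Definition essential M (S : set M) : Prop :=
  forall T : set M, submodule T -> S `&` T = [set 0] -> T = [set 0].

(* 0 -> M -> I_0 -> I_1 -> ... is exact, with injective finitely generated    *)
(* terms, and each I_i is an injective envelope of the image of the map       *)
(* arriving in it.                                                            *)
Definition minimal_injective_coresolution M (I : nat -> lmodType R)
    (eps : {linear M -> I 0%N}) (d : forall i, {linear I i -> I i.+1}) : Prop :=
  [/\ forall i, finitely_generated (I i) /\ injective_module (I i),
      injective eps,
      range eps = [set x | d 0%N x = 0],
      forall i, range (d i) = [set x | d i.+1 x = 0] &
      essential (range eps) /\ forall i, essential (range (d i))].

End Modules.

(* Suprema of nonempty sets of natural numbers, and dominant dimensions, live *)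
(* in N + {oo}, encoded as [option nat] with [None] for oo.                   *)
Definition is_sup (D : set nat) (s : option nat) : Prop :=
  if s is Some m then D m /\ forall k, D k -> (k <= m)%N
  else forall m, exists2 k, D k & (m < k)%N.

Section Algebras.
Variable A : nzRingType.

Definition is_domdim (t : option nat) : Prop :=
  exists (I : nat -> lmodType A^c) (eps : {linear (A^c)^o -> I 0%N})
         (d : forall i, {linear I i -> I i.+1}),
  [/\ minimal_injective_coresolution eps d,
      ~ projective_module (I 0%N) -> t = Some 0%N &
      projective_module (I 0%N) ->
        exists2 s : option nat,
          is_sup [set m | forall i, (i <= m)%N -> projective_module (I i)] s
          & t = omap succn s].

(* Minimal injective coresolutions of a finite-dimensional algebra exist and  *)
(* are unique up to isomorphism, so exactly one value satisfies [is_domdim];  *)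
(* the default value oo is never used.                                        *)
Definition domdim : option nat := xget None is_domdim.

Definition selfinjective : Prop := injective_module (A^c)^o.

Definition has_n_simples (n : nat) : Prop :=
  exists S : 'I_n -> lmodType A^c,
  [/\ forall i, simple_module (S i),
      forall i j, isomorphic (S i) (S j) -> i = j &
      forall M : lmodType A^c, simple_module M -> exists i, isomorphic M (S i)].

End Algebras.

Definition nakayama_algebra (K : fieldType) (A : falgType K) : Prop :=
  [/\ quiver_algebra A,
      forall P : lmodType A^c, finitely_generated P -> projective_module P ->
        indecomposable_module P -> uniserial_module P &
      forall P : lmodType A, finitely_generated P -> projective_module P ->
        indecomposable_module P -> uniserial_module P].

(* Main.v *)
Require Import Defs.
From HB Require Import structures.
From mathcomp Require Import all_boot all_order all_algebra all_field.
From mathcomp Require Import finmap boolp classical_sets.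
From mathcomp Require Import zify.
From mathcomp.multinomials Require Import monalg.

Set Implicit Arguments.
Unset Strict Implicit.
Unset Printing Implicit Defensive.

Import GRing.Theory.

Local Open Scope classical_set_scope.
Local Open Scope ring_scope.

(** Let [A] be given by a quiver with [n] vertices and monomial relations. The
    nonzero paths form a basis of [A] ([presented]), and the proof works with
    paths and with elements of modules. An injective module enters through
    equations: [z * b = y] has a solution [z] whenever [y] satisfies the relations
    of [b] ([baer_cyclic]). The dominant dimension is the value computed by some
    minimal injective coresolution, since such coresolutions exist over every
    finite-dimensional algebra ([injective_hull_ex]).

    Upper bound. Let [I_0, I_1, ...] be a minimal injective coresolution of [A]
    and suppose that [I_0, ..., I_{2n-2}] are projective. If the simple module
    [S_v] occurs in the socle of a projective-injective module, then [v] is good: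
    all paths ending at [v] are tails of one path [w], and all paths from the
    source of [w] are initial segments of [w] ([socle_good]). If all vertices are
    good then [A] is selfinjective ([all_good_baer]). So let [v] not be good.
    Since [I_0] is projective, maximal paths end at good vertices; since [I_1] is
    projective, no two arrows leave the same vertex ([fork_good], [no_fork]), and
    then no two arrows enter the same vertex ([no_join]). Hence the minimal
    projective resolution of [S_v] consists of modules [e_t A] for vertices
    [t_0 = v, t_1, t_2, ...], its differentials are multiplications by paths from
    [t_k] to [t_{k+1}], and two consecutive paths compose to a minimal vanishing
    path from [t_k] to [t_{k+2}] ([res_minrel]). If no minimal vanishing path
    starts at [t_k], then [Ext^{k+1}(S_v, A)] is nonzero, and dimension shifting
    places [S_v] in the socle of [I_{k+1}] ([ext_socle], [minrel_res]). So minimal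
    vanishing paths start at [t_0, ..., t_{2n-3}]. The map from the source to the
    end of a minimal vanishing path is injective, and it misses [t_1] because [v]
    is not good. Therefore [t_1, t_3, ..., t_{2n-1}] are distinct and exhaust the
    vertices. As [v] is one of them, following the map from [v] shows that it is
    defined at every vertex; but an injective map of the finite set of vertices
    into itself cannot miss [t_1] ([bad_bound]).

    Sharpness. Take the cyclic quiver with [n] vertices in which all paths with
    [n+1] arrows vanish and also the path with [n] arrows from the vertex [0] to
    itself. All vertices except [0] are good ([cycle_good]), and
    [Ext^i(S_0, A) = 0] for [i <= 2n-3] ([cyc_ext0]). Hence only good vertices
    occur in the socles of [I_0, ..., I_{2n-3}], and an injective module with such
    a socle is projective ([good_socle_projective]). So the dominant dimension is
    at least [2n-2], and it is not larger by the upper bound. *)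

(** * Submodules, linear maps and the Baer criterion *)

Section Submodules.
Variables (R : nzRingType) (M : lmodType R) (S : set M).

Definition sub_pred (hS : submodule S) : {pred M} := fun x => `[< S x >].

Variable hS : submodule S.

Fact sub_pred_closed : GRing.submod_closed (sub_pred hS).
Proof.
case: hS => S0 SD SZ; split; first by apply/asboolP.
by move=> a x y /asboolP Sx /asboolP Sy; apply/asboolP/SD => //; exact: SZ.
Qed.

HB.instance Definition _ :=
  GRing.isSubmodClosed.Build R M (sub_pred hS)
    (GRing.submod_closed_semi sub_pred_closed).

Record submod := Submod { submod_val : M; submod_valP : submod_val \in sub_pred hS }.
HB.instance Definition _ := [isSub for submod_val].
HB.instance Definition _ := [Choice of submod by <:].
HB.instance Definition _ := [SubChoice_isSubLmodule of submod by <:].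

Lemma submod_mem (x : submod) : S (val x).
Proof. exact/asboolP/(submod_valP x). Qed.

Lemma submod_lift x : S x -> exists y : submod, val y = x.
Proof. by move=> /asboolP Sx; exists (Submod Sx). Qed.

Lemma submod_incl : exists f : {linear submod -> M}, forall x, f x = val x.
Proof. by exists (\val : {linear submod -> M}). Qed.

End Submodules.

Lemma linear_pack (R : nzRingType) (M N : lmodType R) (f : M -> N) :
  (forall x y, f (x + y) = f x + f y) -> (forall a x, f (a *: x) = a *: f x) ->
  exists g : {linear M -> N}, forall x, g x = f x.
Proof.
move=> fD fZ; have fl : linear f by move=> a x y; rewrite fD fZ.
pose g : {linear M -> N} := HB.pack f (GRing.isLinear.Build _ _ _ _ _ fl).
by exists g.
Qed.

Lemma linear_comp_ex (R : nzRingType) (M N P : lmodType R)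
    (f : {linear M -> N}) (g : {linear N -> P}) :
  exists h : {linear M -> P}, forall x, h x = g (f x).
Proof. by apply: linear_pack => [x y|a x]; rewrite ?linearD ?linearZ. Qed.

Section Baer.
Variable R : nzRingType.
Implicit Types M N X Y : lmodType R.

Definition linear_on M N (S : set M) (f : M -> N) : Prop :=
  (forall x y, S x -> S y -> f (x + y) = f x + f y) /\
  (forall a x, S x -> f (a *: x) = a *: f x).

Definition sub_fg M (S : set M) : Prop :=
  exists k (g : 'I_k -> M), (forall i, S (g i)) /\
    forall x, S x -> exists c : 'I_k -> R, x = \sum_i c i *: g i.

(** The element form of injectivity on left ideals; all later uses of
    injectivity go through it. *)
Definition baer M : Prop :=
  forall (S : set R^o) (f : R^o -> M), submodule S -> linear_on S f ->
  exists z, forall s : R, S s -> f s = s *: z.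

Lemma submod_fg M (S : set M) (hS : submodule S) :
  sub_fg S -> finitely_generated (submod hS).
Proof.
move=> [k [g [Sg gS]]]; have gl i := submod_lift hS (Sg i).
exists k, (fun i => sval (cid (gl i))) => x.
have [c xE] := gS _ (submod_mem x); exists c; apply: val_inj.
have [v vE] := submod_incl hS; rewrite xE -vE linear_sum; apply: eq_bigr => i _.
by rewrite linearZ vE; case: cid => y /= ->.
Qed.

Lemma fg_regular : finitely_generated R^o.
Proof.
by exists 1%N, (fun=> 1) => x; exists (fun=> x); rewrite big_ord1 [RHS]mulr1.
Qed.

(** The hypothesis makes every left ideal an admissible test module. *)
Lemma injective_baer M :
  (forall S : set R^o, submodule S -> sub_fg S) -> injective_module M -> baer M.
Proof.
move=> noeth injM S f hS [fD fZ].
have [g gE] := submod_incl hS.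
have Sg x : S (g x) by rewrite gE; exact: submod_mem.
have [f' f'E] : exists f' : {linear submod hS -> M}, forall x, f' x = f (g x).
  apply: linear_pack => [x y|a x]; first by rewrite raddfD (fD _ _ (Sg x) (Sg y)).
  by rewrite linearZ (fZ _ _ (Sg x)).
have [||x y|h hE] := injM _ _ g f'.
- exact/submod_fg/noeth.
- exact: fg_regular.
- by rewrite !gE => /val_inj.
exists (h 1) => s Ss; have [y yE] := submod_lift hS Ss.
by rewrite -yE -gE -f'E -hE gE yE -[RHS]linearZ /= [_ *: _]mulr1.
Qed.

Lemma linear_on0 M N (S : set M) (f : M -> N) : submodule S -> linear_on S f -> f 0 = 0.
Proof.
by move=> [S0 _ _] [fD _]; apply: (addIr (f 0)); rewrite -fD // !add0r.
Qed.

Lemma submoduleN M (S : set M) x : submodule S -> S x -> S (- x).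
Proof. by move=> [_ _ SZ] Sx; rewrite -scaleN1r; exact: SZ. Qed.

Lemma submoduleB M (S : set M) x y : submodule S -> S x -> S y -> S (x - y).
Proof. by move=> hS Sx Sy; case: (hS) => _ SD _; apply: SD => //; exact: submoduleN. Qed.

Lemma submodule_sum M (S : set M) I (r : seq I) (P : pred I) (F : I -> M) :
  submodule S -> (forall i, P i -> S (F i)) -> S (\sum_(i <- r | P i) F i).
Proof. by move=> [S0 SD _] SF; elim/big_ind: _. Qed.

Lemma linear_onB M N (S : set M) (f : M -> N) x y : submodule S -> linear_on S f ->
  S x -> S y -> f (x - y) = f x - f y.
Proof.
move=> hS [fD fZ] Sx Sy; rewrite fD //; last exact: submoduleN.
by rewrite -scaleN1r fZ // scaleN1r.
Qed.

Lemma linear_on_sum M N (S : set M) (f : M -> N) I (r : seq I) (F : I -> M) :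
  submodule S -> linear_on S f -> (forall i, S (F i)) ->
  f (\sum_(i <- r) F i) = \sum_(i <- r) f (F i).
Proof.
move=> hS hf SF; elim: r => [|i r IH]; first by rewrite !big_nil (linear_on0 hS).
rewrite !big_cons -IH; case: hf => fD _; apply: fD => //.
exact: submodule_sum.
Qed.

Lemma submodule0 M : submodule ([set 0] : set M).
Proof. by split=> // [x y -> ->|a x ->]; rewrite ?addr0 ?scaler0. Qed.

Lemma submoduleT M : submodule (setT : set M).
Proof. by []. Qed.

Lemma submodule_range M N (f : {linear M -> N}) : submodule (range f).
Proof.
split; first by exists 0; rewrite ?raddf0.
- by move=> _ _ [x _ <-] [y _ <-]; exists (x + y); rewrite ?raddfD.
- by move=> a _ [x _ <-]; exists (a *: x); rewrite ?linearZ.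
Qed.

Lemma submodule_add M (S T : set M) : submodule S -> submodule T ->
  submodule [set x | exists2 s, S s & exists2 t, T t & x = s + t].
Proof.
move=> [S0 SD SZ] [T0 TD TZ]; split.
- by exists 0 => //; exists 0 => //; rewrite addr0.
- move=> _ _ [s Ss [t Tt ->]] [s' Ss' [t' Tt' ->]].
  by exists (s + s'); [exact: SD|exists (t + t'); [exact: TD|rewrite addrACA]].
- move=> a _ [s Ss [t Tt ->]].
  by exists (a *: s); [exact: SZ|exists (a *: t); [exact: TZ|rewrite scalerDr]].
Qed.

Lemma submodule_cyclic M (y : M) : submodule [set x | exists a : R, x = a *: y].
Proof.
split; first by exists 0; rewrite scale0r.
- by move=> _ _ [a ->] [b ->]; exists (a + b); rewrite scalerDl.
- by move=> c _ [a ->]; exists (c * a); rewrite scalerA.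
Qed.

(** The multiples of [y] that lie in [T] define a left ideal, on which Baer's
    criterion supplies the image of [y]. *)
Lemma baer_extend1 M N (T : set N) (h : N -> M) (y : N) :
  baer M -> submodule T -> linear_on T h ->
  exists h', linear_on [set x | exists2 s, T s & exists2 t, (exists a : R, t = a *: y) & x = s + t] h'
    /\ forall x, T x -> h' x = h x.
Proof.
move=> bM hT hl; pose S : set R^o := [set a : R | T (a *: y)].
have [T0 TD TZ] := hT; have [hD hZ] := hl.
have hS : submodule S.
  split; rewrite /S /=; first by rewrite scale0r.
    by move=> a b; rewrite scalerDl; exact: TD.
  by move=> a b Sb; rewrite -scalerA; exact: TZ.
have [||z zE] := bM S (fun a : R => h (a *: y)) => //.
  split=> [a b Sa Sb|a b Sb]; first by rewrite scalerDl hD.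
  by rewrite -hZ // scalerA.
have wd s a t b : T s -> T t -> s + a *: y = t + b *: y -> h s + a *: z = h t + b *: z.
  move=> Ts Tt e.
  have e1 : (b - a) *: y = s - t.
    by rewrite scalerBl; apply/eqP; rewrite subr_eq addrAC eq_sym subr_eq e addrC.
  have Sba : S (b - a) by rewrite /S /= e1; exact: submoduleB.
  move/zE: Sba; rewrite e1 (linear_onB hT hl) // scalerBl => /eqP.
  by rewrite subr_eq => /eqP->; rewrite addrAC subrK addrC.
pose h' x := if pselect (exists p : N * R, T p.1 /\ x = p.1 + p.2 *: y) is left e
  then h (sval (cid e)).1 + (sval (cid e)).2 *: z else 0.
have h'E s a : T s -> h' (s + a *: y) = h s + a *: z.
  move=> Ts; rewrite /h'; case: pselect => [e|[]]; last by exists (s, a).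
  by case: cid => -[t b] /= [Tt eq]; exact: wd.
exists h'; split; last first.
  by move=> x Tx; rewrite -[x]addr0 -(scale0r y) h'E // !scale0r !addr0.
split=> [_ _ [s Ts [_ [a ->] ->]] [t Tt [_ [b ->] ->]]|c _ [s Ts [_ [a ->] ->]]].
  by rewrite addrACA -scalerDl !h'E //; [rewrite hD // scalerDl addrACA|exact: TD].
by rewrite scalerDr scalerA !h'E //; [rewrite hZ // scalerDr scalerA|exact: TZ].
Qed.

(** Adjoin the generators of [N] to [T] one at a time. *)
Lemma baer_extend M N (T : set N) (h : N -> M) :
  baer M -> finitely_generated N -> submodule T -> linear_on T h ->
  exists h' : {linear N -> M}, forall x, T x -> h' x = h x.
Proof.
move=> bM [k [g gN]] hT hl.
suff : forall m, (m <= k)%N -> exists T' h', [/\ submodule T', linear_on T' h',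
    T `<=` T', forall i : 'I_k, (i < m)%N -> T' (g i) & forall x, T x -> h' x = h x].
  move=> /(_ k (leqnn k))[T' [h' [hT' hl' sT Tg h'E]]].
  have TT x : T' x.
    by have [c ->] := gN x; apply: submodule_sum => // i _; case: hT' => _ _; apply; exact: Tg.
  have [||h'' h''E] := @linear_pack _ _ _ h'.
  - by move=> x y; case: hl' => hD _; exact: hD.
  - by move=> a x; case: hl' => _ hZ; exact: hZ.
  by exists h'' => x Tx; rewrite h''E h'E.
elim=> [|m IH] mk; first by exists T, h; split=> // x.
have [T' [h' [hT' hl' sT Tg h'E]]] := IH (ltnW mk).
have [h2 [h2l h2E]] := baer_extend1 (g (Ordinal mk)) bM hT' hl'.
have sT2 : T' `<=` [set x | exists2 s, T' s & exists2 t, (exists a : R, t = a *: g (Ordinal mk)) & x = s + t].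
  by move=> x Tx; exists x => //; exists 0; [exists 0; rewrite scale0r|rewrite addr0].
eexists; exists h2; split; [|exact: h2l| | |].
- by apply: submodule_add => //; exact: submodule_cyclic.
- by move=> x Tx; apply/sT2/sT.
- move=> i; rewrite ltnS leq_eqVlt => /orP[/eqP im|im]; last by apply/sT2/Tg.
  exists 0; first by case: hT'.
  exists (g (Ordinal mk)); first by exists 1; rewrite scale1r.
  by rewrite add0r; congr g; apply: val_inj.
- by move=> x Tx; rewrite h2E ?h'E //; exact: sT.
Qed.

Lemma baer_injective M : baer M -> injective_module M.
Proof.
move=> bM X Y g f fgX fgY g_inj.
pose h y := if pselect (exists x, g x = y) is left e then f (sval (cid e)) else 0.
have hE x : h (g x) = f x.
  rewrite /h; case: pselect => [e|[]]; last by exists x.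
  by case: cid => x' /= /g_inj ->.
have [|h' h'E] := @baer_extend M Y (range g) h bM fgY (submodule_range g).
  by split=> [_ _ [x _ <-] [y _ <-]|a _ [x _ <-]]; rewrite -?raddfD -?linearZ !hE ?raddfD ?linearZ.
by exists h' => x; rewrite h'E ?hE //; exists x.
Qed.

Lemma projective_dual_basis M : finitely_generated M -> projective_module M ->
  exists k (g : 'I_k -> M) (s : {linear M -> {ffun 'I_k -> R^o}}),
    forall x, x = \sum_i (s x i : R) *: g i.
Proof.
move=> [k [g gM]] pM.
have [p pE] : exists p : {linear {ffun 'I_k -> R^o} -> M},
    forall c, p c = \sum_i (c i : R) *: g i.
  apply: linear_pack => [x y|a x]; rewrite -?big_split ?scaler_sumr.
    by apply: eq_bigr => i _; rewrite ffunE scalerDl.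
  by apply: eq_bigr => i _; rewrite ffunE scalerA.
have [i iE] := @linear_pack R M M (fun x => x) (fun _ _ => erefl) (fun _ _ => erefl).
have [||y|s sE] := pM _ _ p i.
- exists k, (fun i => [ffun j => (i == j)%:R]) => x; exists x.
  apply/ffunP => j; rewrite sum_ffunE (bigD1 j) //= big1 => [|l /negPf lj].
    by rewrite !ffunE eqxx addr0 [RHS]mulr1.
  by rewrite !ffunE lj [LHS]mulr0.
- by exists k, g.
- by have [c ->] := gM y; exists [ffun i => c i]; rewrite pE; apply: eq_bigr => j _; rewrite ffunE.
by exists k, g, s => x; rewrite -pE sE iE.
Qed.

Lemma projective_form M (z : M) :
  finitely_generated M -> projective_module M -> z != 0 ->
  exists th : {linear M -> R^o}, th z != 0.
Proof.
move=> fM pM z0; have [k [g [s dual]]] := projective_dual_basis fM pM.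
case: (pselect (exists i, s z i != 0)) => [[i szi]|nz].
  have [||th thE] := @linear_pack R M R^o (fun x => s x i).
  - by move=> x y; rewrite linearD ffunE.
  - by move=> a x; rewrite linearZ ffunE.
  by exists th; rewrite thE.
case/eqP: z0; rewrite (dual z) big1 // => i _.
have [->|szi] := eqVneq (s z i) 0; first by rewrite scale0r.
by case: nz; exists i.
Qed.

End Baer.

(** * Minimal injective coresolutions over a finite-dimensional algebra *)

Lemma bounded_max (P : nat -> Prop) (m b : nat) : P m -> (forall d, P d -> (d <= b)%N) ->
  exists2 d, P d & forall d', P d' -> (d' <= d)%N.
Proof.
move=> Pm Pb; have ex : exists d, `[< P d >] by exists m; apply/asboolP.
have bd d : `[< P d >] -> (d <= b)%N by move=> /asboolP/Pb.
case: (ex_maxnP ex bd) => d /asboolP Pd dmax.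
by exists d => // d' Pd'; apply/dmax/asboolP.
Qed.

Lemma set_vspace (K : fieldType) (V : vectType K) (S : set V) :
  S 0 -> (forall x y, S x -> S y -> S (x + y)) -> (forall k x, S x -> S (k *: x)) ->
  exists U : {vspace V}, forall x, x \in U <-> S x.
Proof.
move=> S0 SD SZ.
pose P d := exists2 U : {vspace V}, (forall x, x \in U -> S x) & \dim U = d.
have [||_ [U US <-] Umax] := @bounded_max P 0 (\dim {:V}).
- by exists 0%VS; rewrite ?dimv0 // => x; rewrite memv0 => /eqP->.
- by move=> d [U _ <-]; apply/dimvS/subvf.
exists U => x; split=> [|Sx]; first exact: US.
have h : (\dim (U + <[x]>)%VS <= \dim U)%N.
  apply: Umax; exists (U + <[x]>)%VS => // y /memv_addP[u Uu [v /vlineP[k ->] ->]].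
  by apply: SD; [exact: US|exact: SZ].
have : (U + <[x]> <= U)%VS by rewrite -(geq_leqif (dimv_leqif_sup (addvSl U _))).
by rewrite subv_add => /andP[_]; rewrite -memvE.
Qed.

Section Algebra.
Variables (K : fieldType) (A : falgType K).
Implicit Types M N E : lmodType A^c.

(** Right modules over [A] are left modules over [A^c]; [rm] writes their
    action on the right. *)
Definition rm M (m : M) (a : A) : M := (a : A^c) *: m.

Lemma rmA M (m : M) a b : rm (rm m a) b = rm m (a * b).
Proof. exact: scalerA. Qed.
Lemma rm1 M (m : M) : rm m 1 = m.
Proof. exact: scale1r. Qed.
Lemma rmDl M (m n : M) a : rm (m + n) a = rm m a + rm n a.
Proof. exact: scalerDr. Qed.
Lemma rmDr M (m : M) a b : rm m (a + b) = rm m a + rm m b.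
Proof. exact: scalerDl. Qed.
Lemma rm0l M a : rm (0 : M) a = 0.
Proof. exact: scaler0. Qed.
Lemma rm0r M (m : M) : rm m 0 = 0.
Proof. exact: scale0r. Qed.
Lemma rmBl M (m n : M) a : rm (m - n) a = rm m a - rm n a.
Proof. exact: scalerBr. Qed.
Lemma rmBr M (m : M) a b : rm m (a - b) = rm m a - rm m b.
Proof. exact: scalerBl. Qed.
Lemma rm_suml M I (r : seq I) (P : pred I) (F : I -> M) a :
  rm (\sum_(i <- r | P i) F i) a = \sum_(i <- r | P i) rm (F i) a.
Proof. exact: scaler_sumr. Qed.
Lemma rm_sumr M I (r : seq I) (P : pred I) (F : I -> A) (m : M) :
  rm m (\sum_(i <- r | P i) F i) = \sum_(i <- r | P i) rm m (F i).
Proof. exact: scaler_suml. Qed.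
Lemma rm_lin M N (f : {linear M -> N}) m a : f (rm m a) = rm (f m) a.
Proof. exact: linearZ. Qed.
Lemma rm_reg (x : (A^c)^o) a : rm x a = (x : A) * a.
Proof. by []. Qed.

(** The field acts on a right [A]-module through its image in [A]. *)
Definition klinear N (V : lmodType K) (q : N -> V) : Prop :=
  (forall x y, q (x + y) = q x + q y) /\ (forall k x, q (rm x k%:A) = k *: q x).

Lemma klinear0 N (V : lmodType K) (q : N -> V) : klinear q -> q 0 = 0.
Proof. by move=> [qD _]; apply: (addIr (q 0)); rewrite -qD !add0r. Qed.

Lemma klinearB N (V : lmodType K) (q : N -> V) x y :
  klinear q -> q (x - y) = q x - q y.
Proof.
move=> hq; have [qD _] := hq; apply/eqP; by rewrite eq_sym subr_eq -qD subrK.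
Qed.

Lemma klinear_sum N (V : lmodType K) (q : N -> V) I (r : seq I) (F : I -> N) :
  klinear q -> q (\sum_(i <- r) F i) = \sum_(i <- r) q (F i).
Proof. by move=> hq; apply: big_morph; [case: hq|exact: klinear0]. Qed.

Lemma image_vspace N (V : vectType K) (q : N -> V) (S : set N) :
  klinear q -> submodule S -> exists U : {vspace V}, forall x, x \in U <-> (q @` S) x.
Proof.
move=> hq [S0 SD SZ]; have [qD qZ] := hq; apply: set_vspace.
- by exists 0 => //; exact: klinear0.
- by move=> _ _ [x Sx <-] [y Sy <-]; exists (x + y); [exact: SD|exact: qD].
- by move=> k _ [x Sx <-]; exists (rm x k%:A); [exact: SZ|exact: qZ].
Qed.

(** A [K]-basis of a submodule generates it. *)
Lemma fd_noetherian N (V : vectType K) (q : N -> V) (S : set N) :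
  klinear q -> injective q -> submodule S -> sub_fg S.
Proof.
move=> hq q_inj hS; have [U UE] := image_vspace hq hS.
have gP (i : 'I_(\dim U)) : exists2 x, S x & q x = (vbasis U)`_i.
  by apply/UE/vbasis_mem/mem_nth; rewrite size_tuple.
pose g i := s2val (cid2 (gP i)).
have Sg i : S (g i) by rewrite /g; case: cid2.
have qg i : q (g i) = (vbasis U)`_i by rewrite /g; case: cid2.
exists (\dim U), g; split=> // x Sx.
have : q x \in U by apply/UE; exists x.
move/coord_vbasis => qxE; exists (fun i => ((coord (vbasis U) i (q x))%:A : A)).
apply: q_inj; rewrite klinear_sum // [LHS]qxE; apply: eq_bigr => i _.
by case: (hq) => _ qZ; rewrite -qg -qZ.
Qed.

Lemma regular_klinear : klinear (id : (A^c)^o -> A).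
Proof. by split=> // k x; rewrite rm_reg -scalerAr mulr1. Qed.

Lemma regular_noetherian (S : set (A^c)^o) : submodule S -> sub_fg S.
Proof. exact: (fd_noetherian regular_klinear). Qed.

(** Pull [S] back to a free cover of [N] and project onto a complement there. *)
Lemma kfunctional_ex N (S : set N) : finitely_generated N -> submodule S ->
  exists m (q : N -> {ffun 'I_m -> A}), klinear q /\ forall n, q n = 0 <-> S n.
Proof.
move=> [m [g gN]] hS; have [S0 SD SZ] := hS; exists m.
pose p (c : {ffun 'I_m -> A}) : N := \sum_i rm (g i) (c i).
have pD x y : p (x + y) = p x + p y.
  by rewrite /p -big_split; apply: eq_bigr => i _; rewrite ffunE rmDr.
have pZ k x : p (k *: x) = rm (p x) k%:A.
  rewrite /p rm_suml; apply: eq_bigr => i _.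
  by rewrite ffunE rmA -scalerAr mulr1.
have [U UE] : exists U : {vspace {ffun 'I_m -> A}}, forall x, x \in U <-> S (p x).
  apply: (@set_vspace _ _ [set x | S (p x)]) => /=.
  - by rewrite /p big1 // => i _; rewrite ffunE rm0r.
  - by move=> x y; rewrite pD; exact: SD.
  - by move=> k x; rewrite pZ; exact: SZ.
have pS n : exists c, p c = n.
  by have [c ->] := gN n; exists [ffun i => c i]; apply: eq_bigr => i _; rewrite ffunE.
pose r c := c - projv U c.
have r0 c : r c = 0 <-> S (p c).
  rewrite -UE; split=> [/eqP|Uc]; last by rewrite /r projv_id // subrr.
  by rewrite subr_eq0 => /eqP->; exact: memv_proj.
have rB x y : r (x - y) = r x - r y by rewrite /r raddfB !opprD !opprK addrACA.
have rE x y : p x = p y -> r x = r y.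
  move=> e; apply/eqP; rewrite -subr_eq0 -rB; apply/eqP/r0.
  have -> : p (x - y) = 0; last exact: S0.
  by apply: (addIr (p y)); rewrite -pD subrK add0r.
pose q n := r (sval (cid (pS n))).
have qE c : q (p c) = r c by rewrite /q; case: cid => c' /= /rE.
exists q; split; last by move=> n; have [c <-] := pS n; rewrite qE; exact: r0.
split=> [x y|k x].
  have [c <-] := pS x; have [d <-] := pS y; rewrite -pD !qE /r raddfD opprD addrACA //.
have [c <-] := pS x; rewrite -pZ !qE /r linearZ scalerBr //.
Qed.

Lemma fg_embed N : finitely_generated N ->
  exists m (q : N -> {ffun 'I_m -> A}), klinear q /\ injective q.
Proof.
move=> fN; have [m [q [hq q0]]] := kfunctional_ex fN (submodule0 N).
exists m, q; split=> // x y e; apply/eqP; rewrite -subr_eq0; apply/eqP/q0.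
by rewrite klinearB // e subrr.
Qed.

Lemma fg_injective_baer M : injective_module M -> baer M.
Proof. exact/injective_baer/regular_noetherian. Qed.

End Algebra.

(** The coinduced right [A]-module of [K]-linear maps from [A] to [W]. *)
Definition coind (K : fieldType) (A : falgType K) (W : vectType K) : Type := 'Hom(A, W).
HB.instance Definition _ K A W := GRing.Zmodule.on (@coind K A W).

Section Coinduced.
Variables (K : fieldType) (A : falgType K) (W : vectType K).

Definition coind_scale (a : A^c) (h : coind A W) : coind A W :=
  ((h : 'Hom(A, W)) \o amull (a : A))%VF.

Let coind_scaleE a (h : coind A W) x : (coind_scale a h : 'Hom(A, W)) x = (h : 'Hom(A, W)) ((a : A) * x).
Proof. by rewrite /coind_scale comp_lfunE /amull lfunE. Qed.

Fact coind_scaleA a b h : coind_scale a (coind_scale b h) = coind_scale (a * b) h.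
Proof. by apply/(@lfunP K A W) => x; rewrite !coind_scaleE mulrA. Qed.
Fact coind_scale1 : left_id 1 coind_scale.
Proof. by move=> h; apply/(@lfunP K A W) => x; rewrite !coind_scaleE mul1r. Qed.
Fact coind_scaleDr : right_distributive coind_scale +%R.
Proof.
move=> a g h; apply/(@lfunP K A W) => x.
by rewrite coind_scaleE !add_lfunE !coind_scaleE.
Qed.
Fact coind_scaleDl (h : coind A W) : {morph coind_scale^~ h : a b / a + b}.
Proof.
move=> a b; apply/(@lfunP K A W) => x.
by rewrite add_lfunE !coind_scaleE mulrDl raddfD.
Qed.

HB.instance Definition _ := GRing.Zmodule_isLmodule.Build A^c (coind A W)
  coind_scaleA coind_scale1 coind_scaleDr coind_scaleDl.

Lemma coindE (h : coind A W) a x :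
  (rm h a : 'Hom(A, W)) x = (h : 'Hom(A, W)) (a * x).
Proof. exact: coind_scaleE. Qed.

Lemma coind_klinear : klinear (id : coind A W -> 'Hom(A, W)).
Proof.
split=> // k h; apply/(@lfunP K A W) => x.
by rewrite coindE scale_lfunE -linearZ -scalerAl mul1r.
Qed.

(** Coinduced modules are injective: a linear functional on a right ideal
    extends to [A]. *)
Lemma coind_baer : baer (coind A W).
Proof.
move=> S f hS [fD fZ]; have [S0 SD SZ] := hS.
have [U UE] := image_vspace (@regular_klinear K A) hS.
have US (x : A) : x \in U <-> S x by rewrite UE; split=> [[y Sy <-]|Sx] //; exists x.
pose l (x : A) : W := (f x : 'Hom(A, W)) 1.
pose b i : A := (vbasis U)`_i.
have Sb (i : 'I_(\dim U)) : S (b i) by apply/US/vbasis_mem/mem_nth; rewrite size_tuple.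
pose l' (x : A) : W := \sum_(i < \dim U) coord (vbasis U) i x *: l (b i).
have l'lin : linear l'.
  move=> k x y; rewrite /l' scaler_sumr -big_split; apply: eq_bigr => i _.
  by rewrite linearP scalerDl scalerA.
pose L : {linear A -> W} := HB.pack l' (GRing.isLinear.Build _ _ _ _ _ l'lin).
have lE x : S x -> l' x = l x.
  move=> /US/coord_vbasis xE; rewrite {2}xE /l'.
  pose F (i : 'I_(\dim U)) : (A^c)^o := rm (b i : (A^c)^o) (coord (vbasis U) i x)%:A.
  have -> : \sum_(i < \dim U) coord (vbasis U) i x *: (vbasis U)`_i = \sum_i F i.
    by apply: eq_bigr => i _; rewrite /F rm_reg -scalerAr mulr1.
  rewrite /l (linear_on_sum _ hS (conj fD fZ)) => [|i]; last exact: SZ.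
  rewrite sum_lfunE; apply: eq_bigr => i _; rewrite fZ //.
  by rewrite [RHS](coindE (f (b i)) _ 1) /l -linearZ -scalerAl mul1r.
exists (linfun L : coind A W) => s Ss; apply/(@lfunP K A W) => x.
rewrite [RHS]coindE lfunE /= lE; last exact: (SZ (x : A^c)).
have fsx : f ((s : A) * x) = rm (f s) x by exact: (fZ (x : A^c)).
by rewrite /l fsx coindE mulr1.
Qed.

End Coinduced.

Section Hulls.
Variables (K : fieldType) (A : falgType K).
Implicit Types M N E : lmodType A^c.

(** Frobenius reciprocity: a [K]-linear map out of [N] is a morphism into a
    coinduced module. *)
Lemma coind_embed N (S : set N) : finitely_generated N -> submodule S ->
  exists m (f : {linear N -> coind A ({ffun 'I_m -> A} : vectType K)}), forall n, f n = 0 <-> S n.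
Proof.
move=> fN hS; have [m [q [hq q0]]] := kfunctional_ex fN hS.
have [qD qZ] := hq; have [S0 SD SZ] := hS.
pose l n (a : A) := q (rm n a).
have lin n : linear (l n).
  rewrite /l => k a b; rewrite rmDr qD; congr (_ + _).
  by rewrite -qZ rmA -scalerAr mulr1.
pose L n : {linear A -> {ffun 'I_m -> A}} := HB.pack (l n) (GRing.isLinear.Build _ _ _ _ _ (lin n)).
pose F n : coind A {ffun 'I_m -> A} := linfun (L n).
have FE n a : (F n : 'Hom(A, _)) a = q (rm n a) by rewrite /F lfunE.
have [||f fE] := @linear_pack _ _ _ F.
- by move=> x y; apply/(@lfunP K A) => a; rewrite add_lfunE !FE rmDl qD.
- move=> a x; apply/(@lfunP K A) => b; rewrite FE -[a *: F x]/(rm (F x) a) coindE FE.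
  by rewrite -[a *: x]/(rm x a) rmA.
exists m, f => n; rewrite fE; split=> [F0|Sn].
  by apply/q0; rewrite -[n in LHS]rm1 -FE F0 zero_lfunE.
by apply/(@lfunP K A) => a; rewrite FE zero_lfunE; apply/q0/SZ.
Qed.

(** An injective hull of the quotient of [N] by [S]. Embed it into an injective
    module [V]: among the endomorphisms of [V] that fix its image pointwise, one
    with the largest kernel splits [V], and the image of that endomorphism is an
    essential extension. *)
Lemma injective_hull_ex N (S : set N) : finitely_generated N -> submodule S ->
  exists (E : lmodType A^c) (f : {linear N -> E}),
  [/\ finitely_generated E, injective_module E, (forall n, f n = 0 <-> S n)
    & essential (range f)].
Proof.
move=> fN hS; have [m [p pE]] := coind_embed fN hS.
pose W : vectType K := {ffun 'I_m -> A}; pose V := coind A W.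
have bV : baer V by exact: coind_baer.
have noethV (T : set V) : submodule T -> sub_fg T.
  by apply: (@fd_noetherian _ _ V 'Hom(A, W) id) => //; exact: coind_klinear.
have fgV : finitely_generated V.
  have [k [g [_ gV]]] := noethV setT (submoduleT V); exists k, g => x; exact: gV.
have klin (th : {linear V -> V}) : linear (th : 'Hom(A, W) -> 'Hom(A, W)).
  have vZ k (x : V) : k *: (x : 'Hom(A, W)) = rm x k%:A.
    by have [_ vZ] := coind_klinear A W; rewrite -[RHS]/(id (rm x k%:A)) vZ.
  by move=> k x y; rewrite !vZ -(rm_lin th); exact: (raddfD th).
pose kf (th : {linear V -> V}) : 'Hom(A, W) -> 'Hom(A, W) := th.
pose kl (th : {linear V -> V}) : {linear 'Hom(A, W) -> 'Hom(A, W)} :=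
  HB.pack (kf th) (GRing.isLinear.Build _ _ _ _ _ (klin th)).
pose lf (th : {linear V -> V}) : 'End('Hom(A, W)) := linfun (kl th).
have lfE th x : lf th x = th x by rewrite /lf lfunE.
pose P d := exists2 th : {linear V -> V}, (forall n, th (p n) = p n) & \dim (lker (lf th)) = d.
have [id1 id1E] : exists f : {linear V -> V}, forall x, f x = x by exact: linear_pack.
have [||_ [th thp <-] thmax] := @bounded_max P (\dim (lker (lf id1))) (\dim {:'Hom(A, W)}).
- by exists id1.
- by move=> d [th _ <-]; apply/dimvS/subvf.
have kmax (th' : {linear V -> V}) : (forall n, th' (p n) = p n) ->
    (forall x, th x = 0 -> th' x = 0) -> forall x, th' x = 0 -> th x = 0.
  move=> th'p sub x; rewrite -!lfE => /eqP; rewrite -memv_ker => h; apply/eqP.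
  have s : (lker (lf th) <= lker (lf th'))%VS.
    by apply/subvP => y; rewrite !memv_ker !lfE => /eqP/sub->.
  have d : (\dim (lker (lf th')) <= \dim (lker (lf th)))%N by apply: thmax; exists th'.
  have e : lker (lf th) == lker (lf th') by rewrite eqEdim s d.
  by rewrite -memv_ker (eqP e).
have th2 x : th (th x) = 0 -> th x = 0.
  have [h hE] := linear_comp_ex th th.
  by rewrite -hE; apply: kmax => [n|y e]; rewrite hE ?e ?linear0 ?thp.
have thinj x y : th (th x) = th (th y) -> th x = th y.
  by move=> e; apply/eqP; rewrite -subr_eq0 -(raddfB th); apply/eqP/th2; rewrite !linearB e subrr.
have thsurj x : exists y, th x = th (th y).
  have : (lf th @: limg (lf th) == limg (lf th))%VS.
    rewrite eqEdim limgS ?subvf //=.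
    have := limg_ker_dim (lf th) (limg (lf th)).
    suff -> : (limg (lf th) :&: lker (lf th) = 0)%VS by rewrite dimv0 add0n => ->.
    apply/eqP; rewrite -subv0; apply/subvP => z; rewrite memv_cap memv_ker memv0.
    by case/andP=> /memv_imgP[u _ ->]; rewrite !lfE => /eqP/th2->.
  move/eqP => limE; have : th x \in limg (lf th) by rewrite -lfE memv_img ?memvf.
  rewrite -limE.
  by case/memv_imgP=> u /memv_imgP[y _ ->]; rewrite !lfE => ->; exists y.
pose E := submod (submodule_range th); pose i : {linear E -> V} := \val.
have iE (x : E) : exists y, i x = th y.
  by have [y _ yE] := submod_mem x; exists y.
have lift y : exists x : E, i x = th y.
  by have [x xE] : exists x : E, val x = th y; [apply: submod_lift; exists y|exists x].
have i_inj : injective i by exact: val_inj.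
have bE : baer E.
  move=> T f hT [fD fZ].
  have yP s : exists y, i (f s) = th (th y).
    by have [u ->] := iE (f s); exact: thsurj.
  pose y s := th (sval (cid (yP s))).
  have yE s : th (y s) = i (f s) by rewrite /y; case: cid.
  have [|z zE] := bV T y hT.
    split=> [a b Ta Tb|a b Tb].
      have [c cE] : exists c, y a + y b = th c by exists (sval (cid (yP a)) + sval (cid (yP b))); rewrite linearD.
      by rewrite cE; apply: thinj; rewrite -cE yE fD // !linearD !yE.
    have [c cE] : exists c, a *: y b = th c by exists (a *: sval (cid (yP b))); rewrite linearZ.
    by rewrite cE; apply: thinj; rewrite -cE yE fZ // !linearZ yE.
  have [x xE] := lift z; exists x => s Ts; apply: i_inj.
  by rewrite linearZ xE -yE zE // linearZ.
have [f fE] : exists f : {linear N -> E}, forall n, i (f n) = p n.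
  have fP n : exists x : E, i x = p n by rewrite -thp; exact: lift.
  pose f n := sval (cid (fP n)).
  have fE n : i (f n) = p n by rewrite /f; case: cid.
  have [||g gE] := @linear_pack _ _ _ f.
  - by move=> x y; apply: i_inj; rewrite linearD !fE linearD.
  - by move=> a x; apply: i_inj; rewrite linearZ !fE linearZ.
  by exists g => n; rewrite gE.
exists E, f; split.
- exact/submod_fg/noethV/submodule_range.
- exact: baer_injective.
- move=> n; rewrite -pE -fE; split=> [->|e]; first by rewrite linear0.
  by apply: i_inj; rewrite e linear0.
move=> T hT Tf; have [T0 TD TZ] := hT.
pose T' : set V := i @` T.
have hT' : submodule T'.
  split; first by exists 0; rewrite ?linear0.
  - by move=> _ _ [x Tx <-] [y Ty <-]; exists (x + y); [exact: TD|rewrite linearD].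
  - by move=> a _ [x Tx <-]; exists (a *: x); [exact: TZ|rewrite linearZ].
have disj n t : T t -> p n = i t -> p n = 0.
  rewrite -fE => Tt /i_inj e; have : (range f `&` T) t by split=> //; exists n.
  by rewrite Tf => t0; rewrite e t0 linear0.
have [eta etaE] : exists eta : {linear V -> V}, (forall n, eta (p n) = p n) /\ forall t, T t -> eta (i t) = 0.
  pose h x := if pselect (exists n, exists2 t, T t & x = p n + i t) is left e then p (sval (cid e)) else 0.
  have hE n t : T t -> h (p n + i t) = p n.
    move=> Tt; rewrite /h; case: pselect => [e|[]]; last by exists n, t.
    case: cid => n' /= [t' Tt' e']; apply/eqP; rewrite eq_sym -subr_eq0 -linearB; apply/eqP.
    apply: (disj _ (t' - t)); first exact: submoduleB.
    by rewrite !linearB; apply/eqP; rewrite subr_eq addrAC eq_sym subr_eq e' addrC; apply/eqP; rewrite addrC.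
  have [|eta etaE] := @baer_extend _ V V _ h bV fgV (submodule_add (submodule_range p) hT').
    split=> [_ _ [_ [n _ <-] [_ [t Tt <-] ->]] [_ [n' _ <-] [_ [t' Tt' <-] ->]]|a _ [_ [n _ <-] [_ [t Tt <-] ->]]].
      by rewrite addrACA -!linearD !hE ?linearD //; exact: TD.
    by rewrite scalerDr -!linearZ !hE ?linearZ //; exact: TZ.
  exists eta; split=> [n|t Tt].
    rewrite etaE; first by rewrite -{1}[p n]addr0 -(linear0 i) (hE n 0 T0).
    exists (p n); [by exists n|exists 0; last by rewrite addr0].
    by case: hT'.
  rewrite etaE; first by rewrite -[i t]add0r -(linear0 p) (hE 0 t Tt).
  exists 0; first by case: (submodule_range p).
  by exists (i t); [exists t|rewrite add0r].
case: etaE => etap etaT; apply/seteqP; split=> [t Tt|_ ->] //=.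
have [h hE] := linear_comp_ex th eta.
have [x xE] := iE t; apply: i_inj; rewrite linear0 xE; apply: (kmax h).
- by move=> n; rewrite hE thp etap.
- by move=> y e; rewrite hE e linear0.
- by rewrite hE -xE etaT.
Qed.

End Hulls.

Section Coresolutions.
Variables (K : fieldType) (A : falgType K).

(** A finitely generated module with a submodule; it stands for the quotient. *)
Record stage := Stage {
  st_mod : lmodType A^c;
  st_sub : set st_mod;
  st_fg : finitely_generated st_mod;
  st_subP : submodule st_sub }.

Lemma next_stage (s : stage) : exists (s' : stage) (f : {linear st_mod s -> st_mod s'}),
  [/\ injective_module (st_mod s'), (forall n, f n = 0 <-> st_sub n),
      essential (range f) & @st_sub s' = range f].
Proof.
have [E [f [fgE iE f0 ess]]] := injective_hull_ex (st_fg s) (st_subP s).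
by exists (Stage fgE (submodule_range f)), f.
Qed.

Lemma min_coresolution_ex (M : lmodType A^c) : finitely_generated M ->
  exists (I : nat -> lmodType A^c) (eps : {linear M -> I 0%N})
    (d : forall i, {linear I i -> I i.+1}), minimal_injective_coresolution eps d.
Proof.
move=> fM; pose nx s := sval (cid (next_stage s)).
have nxP s : exists f : {linear st_mod s -> st_mod (nx s)},
    [/\ injective_module (st_mod (nx s)), (forall n, f n = 0 <-> st_sub n),
      essential (range f) & @st_sub (nx s) = range f] by rewrite /nx; case: cid.
pose s0 := Stage fM (submodule0 M).
pose st i := iter i nx s0.
pose f i : {linear st_mod (st i) -> st_mod (st i.+1)} := sval (cid (nxP (st i))).
have fP i : [/\ injective_module (st_mod (st i.+1)), (forall n, f i n = 0 <-> st_sub n),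
    essential (range (f i)) & @st_sub (st i.+1) = range (f i)] by rewrite /f; case: cid.
exists (fun i => st_mod (st i.+1)), (f 0%N), (fun i => f i.+1); split.
- by move=> i; split; [exact: st_fg|case: (fP i)].
- move=> x y e; apply/eqP; rewrite -subr_eq0; apply/eqP.
  by have [_ f0 _ _] := fP 0%N; apply: (proj1 (f0 _)); rewrite linearB e subrr.
- have [_ _ _ e] := fP 0%N; have [_ f1 _ _] := fP 1%N.
  by apply/seteqP; split=> x; rewrite /= f1 e.
- move=> i; have [_ _ _ e] := fP i.+1; have [_ f1 _ _] := fP i.+2.
  by apply/seteqP; split=> x; rewrite /= f1 e.
- by split=> [|i]; [case: (fP 0%N)|case: (fP i.+1)].
Qed.

Lemma sup_ex (D : set nat) (m : nat) : D m -> exists s, is_sup D s.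
Proof.
move=> Dm; case: (pselect (exists b, forall k, D k -> (k <= b)%N)) => [[b Db]|nb].
  by have [d Dd dmax] := bounded_max Dm Db; exists (Some d).
exists None => k; apply: contrapT => h; apply: nb; exists k => j Dj.
by rewrite leqNgt; apply/negP => kj; apply: h; exists j.
Qed.

Lemma is_domdim_ex : exists t, is_domdim A t.
Proof.
have [I [eps [d hI]]] := min_coresolution_ex (fg_regular A^c).
case: (pselect (projective_module (I 0%N))) => [p0|np0]; last first.
  by exists (Some 0%N), I, eps, d.
have [|s hs] := @sup_ex [set m | forall i, (i <= m)%N -> projective_module (I i)] 0%N.
  by move=> i; rewrite leqn0 => /eqP->.
by exists (omap succn s), I, eps, d; split=> // _; exists s.
Qed.

Lemma domdimP : is_domdim A (domdim A).
Proof. by rewrite /domdim; case: xgetP => [t -> //|no]; have [t /no] := is_domdim_ex. Qed.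

(** The hypothesis covers the coresolution that computes [domdim A]. *)
Lemma domdim_eq m :
  (forall (I : nat -> lmodType A^c) (eps : {linear (A^c)^o -> I 0%N})
      (d : forall i, {linear I i -> I i.+1}), minimal_injective_coresolution eps d ->
      (forall i, (i < m)%N -> projective_module (I i)) /\
      exists2 i, (i <= m)%N & ~ projective_module (I i)) ->
  domdim A = Some m.
Proof.
move=> H; have [I [eps [d [hI np p]]]] := domdimP.
have [lt [j jm nj]] := H _ _ _ hI.
case: (pselect (projective_module (I 0%N))) => [p0|/[dup] np0 /np ->]; last first.
  by case: m lt {jm H} => // m /(_ 0%N isT) /np0.
have [s hs ->] := p p0; case: m => [|m] in H lt jm *.
  by move: jm; rewrite leqn0 => /eqP j0; rewrite j0 in nj.
case: s hs => [k [kP kmax]|inf] /=; last first.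
  by have [k kP /ltnW km] := inf m.+1; case: nj; exact/kP/(leq_trans jm).
congr (Some _.+1); apply/eqP; rewrite eqn_leq; apply/andP; split; last first.
  by apply: kmax => i im; apply: lt.
by rewrite leqNgt; apply/negP => mk; apply/nj/kP/(leq_trans jm).
Qed.

Lemma domdim_le m :
  (forall (I : nat -> lmodType A^c) (eps : {linear (A^c)^o -> I 0%N})
      (d : forall i, {linear I i -> I i.+1}), minimal_injective_coresolution eps d ->
      exists2 i, (i <= m)%N & ~ projective_module (I i)) ->
  exists2 d : nat, domdim A = Some d & (d <= m)%N.
Proof.
move=> H; have [I [eps [d [hI np p]]]] := domdimP.
have [j jm nj] := H _ _ _ hI.
case: (pselect (projective_module (I 0%N))) => [p0|/np ->]; last by exists 0%N.
have [s hs ->] := p p0; case: s hs => [k [kP _]|inf] /=.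
  exists k.+1 => //; apply: leq_trans jm; rewrite ltnNge; apply/negP => jk.
  by apply/nj/kP.
by have [k kP /ltnW km] := inf j; case: nj; exact: kP.
Qed.

End Coresolutions.

(** * Ideals spanned by paths *)

Section IdealGen.
Variable R : pzRingType.

Lemma ideal_gen_ideal (S : set R) : two_sided_ideal (ideal_gen S).
Proof.
split.
- by move=> I [[]].
- by move=> x y Sx Sy I hI; case: (hI) => -[_ ID _ _] _; apply: ID; [exact: Sx|exact: Sy].
- by move=> a x Sx I hI; case: (hI) => -[_ _ IM _] _; apply: IM; exact: Sx.
- by move=> a x Sx I hI; case: (hI) => -[_ _ _ IM] _; apply: IM; exact: Sx.
Qed.

Lemma ideal_gen_sub (S : set R) : S `<=` ideal_gen S.
Proof. by move=> x Sx I [_]; apply. Qed.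

Lemma ideal_gen_min (S I : set R) : two_sided_ideal I -> S `<=` I -> ideal_gen S `<=` I.
Proof. by move=> hI SI x; apply. Qed.

End IdealGen.

Section PathCoefficients.
Variables (K : fieldType) (Q : quiver).
Local Notation path_algebra := (path_algebra K Q).
Implicit Types (x y : path_algebra) (p q r : qpath Q).

Definition pcoef p x : K := (coeffs x)@_p.

Lemma pcoefD p x y : pcoef p (x + y) = pcoef p x + pcoef p y.
Proof. by rewrite /pcoef coeffsD mcoeffD. Qed.

Lemma pcoefZ p k x : pcoef p (k *: x) = k * pcoef p x.
Proof. by rewrite /pcoef coeffsZ mcoeffZ. Qed.

Lemma pcoef_path p q : pcoef p (of_path K q) = (q == p)%:R.
Proof. by rewrite /pcoef coeffs_of_path [LHS]mcoeffU. Qed.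

Lemma pcoef0 p : pcoef p 0 = 0.
Proof. by rewrite /pcoef coeffs0 mcoeff0. Qed.

Lemma pcoef_sum p I (s : seq I) (P : pred I) (F : I -> path_algebra) :
  pcoef p (\sum_(i <- s | P i) F i) = \sum_(i <- s | P i) pcoef p (F i).
Proof. by apply: big_morph; [exact: pcoefD|exact: pcoef0]. Qed.

Lemma pcoef_mul r x y :
  (forall p q, path_cat p q = Some r -> pcoef p x * pcoef q y = 0) ->
  pcoef r (x * y) = 0.
Proof.
move=> H; rewrite [x * y]path_mulE pcoef_sum big1 // => p _.
rewrite pcoef_sum big1 // => q _; rewrite pcoefZ.
case e: (path_cat p q) => [u|] /=; last by rewrite pcoef0 mulr0.
rewrite pcoef_path; case: eqP => [ur|]; last by rewrite mulr0.
by rewrite mulr1; apply: H; rewrite e ur.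
Qed.

Definition subpath_closed (P : qpath Q -> Prop) : Prop :=
  forall p q r, path_cat p q = Some r -> P r -> P p /\ P q.

(** A coefficient of a product only involves coefficients at subpaths. *)
Lemma vanish_ideal (P : qpath Q -> Prop) : subpath_closed P ->
  two_sided_ideal [set x | forall p, P p -> pcoef p x = 0].
Proof.
move=> Psub; split=> /=.
- by move=> p _; exact: pcoef0.
- by move=> x y hx hy p Pp; rewrite pcoefD hx ?hy ?addr0.
- move=> a x hx r Pr; apply: pcoef_mul => p q /Psub/(_ Pr)[_ Pq].
  by rewrite hx ?mulr0.
- move=> a x hx r Pr; apply: pcoef_mul => p q /Psub/(_ Pr)[Pp _].
  by rewrite hx ?mul0r.
Qed.

Lemma path_cat_size p q r : path_cat p q = Some r ->
  size (arrows r) = (size (arrows p) + size (arrows q))%N.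
Proof.
have [e|n] := eqVneq (finish p) (start q); last by rewrite path_cat_none.
by have [u [-> _ _ au]] := path_catE e; case=> <-; rewrite au size_cat.
Qed.

Lemma short_closed m : subpath_closed (fun p => (size (arrows p) < m)%N).
Proof.
move=> p q r /path_cat_size-> lt.
by split; apply: leq_ltn_trans lt; rewrite ?leq_addr ?leq_addl.
Qed.

(** The span of the paths with at least [m] arrows. *)
Definition shortless m : set path_algebra :=
  [set x | forall p, (size (arrows p) < m)%N -> pcoef p x = 0].

Lemma shortless_ideal m : two_sided_ideal (shortless m).
Proof. exact: (vanish_ideal (@short_closed m)). Qed.

Lemma arrow_ideal_shortless : @arrow_ideal K Q `<=` shortless 1.
Proof.
apply: ideal_gen_min; first exact: shortless_ideal.
move=> _ [p pa <-] q; rewrite pcoef_path; case: eqP => // <-.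
by rewrite pa.
Qed.

Lemma shortless_mul a b x y :
  shortless a x -> shortless b y -> shortless (a + b) (x * y).
Proof.
move=> hx hy r ra; apply: pcoef_mul => p q /path_cat_size e.
have [pa|pa] := ltnP (size (arrows p)) a; first by rewrite hx ?mul0r.
rewrite hy ?mulr0 //; rewrite -(ltn_add2l a); apply: leq_ltn_trans ra.
by rewrite e leq_add2r.
Qed.

Lemma ideal_power_shortless m : ideal_power (@arrow_ideal K Q) m `<=` shortless m.
Proof.
apply: ideal_gen_min; first exact: shortless_ideal.
move=> _ [f hf ->]; elim: m f hf => [|m IH] f hf; first by [].
rewrite big_ord_recl; apply: (@shortless_mul 1 m); first exact/arrow_ideal_shortless.
by apply: IH => i.
Qed.

Lemma of_path_mul p q r : path_cat p q = Some r ->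
  of_path K r = of_path K p * of_path K q.
Proof. by move=> e; rewrite [RHS]path_mulUU e. Qed.

Definition mkpath v s (w : is_walk v s) : qpath Q := QPath (qpath_val := (v, s)) w.

Lemma mkpath_cat v s t (w : is_walk v (s ++ t)) (ws : is_walk v s)
    (wt : is_walk (last v (map (@tgt Q) s)) t) :
  path_cat (mkpath ws) (mkpath wt) = Some (mkpath w).
Proof.
have [|r [-> sr _ ar]] := @path_catE Q (mkpath ws) (mkpath wt); first by [].
by congr Some; apply: qpath_inj; rewrite ?sr ?ar.
Qed.

Lemma path_prod m p : size (arrows p) = m.+1 ->
  exists2 f : 'I_m.+1 -> path_algebra, (forall i, @arrow_ideal K Q (f i)) &
    of_path K p = \prod_i f i.
Proof.
elim: m p => [|m IH] p sp.
  exists (fun=> of_path K p); last by rewrite big_ord1.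
  by move=> _; apply: ideal_gen_sub; exists p.
case: p sp => -[v [|a s]] //= w [sp].
have w1 : is_walk v [:: a] by move: w; rewrite /= => /andP[->].
have w2 : is_walk (last v (map (@tgt Q) [:: a])) s by case/andP: w.
have [f fJ fE] := IH (mkpath w2) sp.
exists (fun i => if unlift ord0 i is Some j then f j else of_path K (mkpath w1)).
  move=> i; case: unliftP => [j _|_] //.
  by apply: ideal_gen_sub; exists (mkpath w1).
rewrite big_ord_recl unlift_none (eq_bigr f) => [|i _]; last by rewrite liftK.
by rewrite -fE; apply/of_path_mul/(@mkpath_cat v [:: a] s).
Qed.

Lemma long_path_power m p : (0 < m)%N -> (m <= size (arrows p))%N ->
  ideal_power (@arrow_ideal K Q) m (of_path K p).
Proof.
case: m => // m _; case: p => -[v s] w; rewrite /arrows /= => ms.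
have ws : is_walk v (take m.+1 s ++ drop m.+1 s) by rewrite cat_take_drop.
have := ws; rewrite is_walk_cat => /andP[w1 w2].
have <- : mkpath ws = QPath w by apply: qpath_inj => //; rewrite /arrows /= cat_take_drop.
rewrite (of_path_mul (mkpath_cat ws w1 w2)).
have [_ _ _ IM] := ideal_gen_ideal (R := path_algebra) [set x | exists2 f : 'I_m.+1 -> path_algebra, (forall i, @arrow_ideal K Q (f i)) & x = \prod_i f i].
apply: IM; apply: ideal_gen_sub; apply: path_prod.
by rewrite /arrows /= size_takel.
Qed.

End PathCoefficients.

(** * The path basis of a monomial algebra *)

Definition endp (Q : quiver) (v : vertex Q) (s : seq (arrow Q)) : vertex Q :=
  last v (map (@tgt Q) s).

Lemma endp_cat (Q : quiver) (v : vertex Q) s t : endp v (s ++ t) = endp (endp v s) t.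
Proof. by rewrite /endp map_cat last_cat. Qed.

(** [el v s] is the image in [A] of the path that starts at [v] and runs through
    the arrows [s] ([0] if there is no such path); the nonzero ones form a basis
    of [A], and [cf v s] is the coordinate along [el v s]. *)
Record presented (K : fieldType) (A : falgType K) (Q : quiver)
    (el : vertex Q -> seq (arrow Q) -> A) (cf : vertex Q -> seq (arrow Q) -> A -> K) : Prop :=
  Presented {
    el_mul : forall v s u t,
      el v s * el u t = if u == endp v s then el v (s ++ t) else 0;
    el_1 : 1 = \sum_v el v [::];
    el_walk : forall v s, el v s != 0 -> is_walk v s;
    el_long : exists L, forall v s, (L <= size s)%N -> el v s = 0;
    el_nil : forall v, el v [::] != 0;
    el_arrow : forall a, el (src a) [:: a] != 0;
    cfD : forall v s x y, cf v s (x + y) = cf v s x + cf v s y;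
    cfZ : forall v s k x, cf v s (k *: x) = k * cf v s x;
    cf_el : forall v s u t, el v s != 0 -> cf v s (el u t) = ((u, t) == (v, s))%:R;
    el_ind : forall P : A -> Prop, P 0 ->
      (forall k v s x, el v s != 0 -> P x -> P (k *: el v s + x)) -> forall x, P x;
    cf_eq0 : forall x, (forall v s, el v s != 0 -> cf v s x = 0) -> x = 0 }.

Section FromQuotient.
Variables (K : fieldType) (A : falgType K) (Q : quiver).
Variable phi : {rmorphism path_algebra K Q -> A}.
Hypothesis phiZ : scalable phi.
Hypothesis phi_surj : forall a, exists x, phi x = a.

Definition path_img (v : vertex Q) (s : seq (arrow Q)) : A :=
  oapp (fun p => phi (of_path K p)) 0 (insub (v, s) : option (qpath Q)).

(** The coefficient of an arbitrary preimage; the choice does not matter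
    because the kernel is spanned by paths. *)
Definition path_crd (v : vertex Q) (s : seq (arrow Q)) (a : A) : K :=
  if (insub (v, s) : option (qpath Q)) is Some p then
    if phi (of_path K p) != 0 then pcoef p (sval (cid (phi_surj a))) else 0 else 0.

Lemma path_imgE v s (w : is_walk v s) : path_img v s = phi (of_path K (mkpath w)).
Proof. by rewrite /path_img (insubT (fun u => is_walk u.1 u.2) (x := (v, s)) w). Qed.

Lemma path_img0 v s : ~~ is_walk v s -> path_img v s = 0.
Proof. by move=> nw; rewrite /path_img insubF //=; exact: negbTE. Qed.

Variable Z : set (qpath Q).
Hypothesis Zadm : admissible (ideal_gen [set of_path K p | p in Z]).
Hypothesis kerE : ideal_gen [set of_path K p | p in Z] = [set x | phi x = 0].

Let nzp (p : qpath Q) : Prop := phi (of_path K p) != 0.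

Let nzp_closed : subpath_closed nzp.
Proof.
move=> p q r /of_path_mul e; rewrite /nzp e rmorphM /=.
by split; apply: contraNneq H => ->; rewrite ?mul0r ?mulr0.
Qed.

Let ker_coef x p : phi x = 0 -> nzp p -> pcoef p x = 0.
Proof.
have sub : [set of_path K p | p in Z] `<=` [set x | forall p, nzp p -> pcoef p x = 0].
  move=> _ [q Zq <-] r nr /=; rewrite pcoef_path; case: eqP => // qr.
  move: nr; rewrite /nzp -qr; suff -> : phi (of_path K q) = 0 by rewrite eqxx.
  have : (ideal_gen [set of_path K p | p in Z]) (of_path K q).
    by apply: ideal_gen_sub; exists q.
  by rewrite kerE.
move=> x0; have : (ideal_gen [set of_path K p | p in Z]) x by rewrite kerE.
by move/(ideal_gen_min (vanish_ideal K nzp_closed) sub); apply.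
Qed.

Let crdE v s (w : is_walk v s) x : path_img v s != 0 ->
  path_crd v s (phi x) = pcoef (mkpath w) x.
Proof.
rewrite (path_imgE w) /path_crd (insubT (fun u => is_walk u.1 u.2) (x := (v, s)) w) => np.
rewrite -/(mkpath w) np; case: cid => y /= yx.
apply/eqP; rewrite -subr_eq0 -mulN1r -pcoefZ -pcoefD scaleN1r; apply/eqP.
by apply: ker_coef; rewrite // rmorphB yx subrr.
Qed.

Let crd0 v s x : path_img v s = 0 -> path_crd v s x = 0.
Proof. by rewrite /path_img /path_crd; case: insub => //= p ->; rewrite eqxx. Qed.

(** The ideal of relations is spanned by paths, so its elements have no
    coefficients at the paths that survive; admissibility makes vertices and
    arrows survive. *)
Lemma presented_quotient : presented path_img path_crd.
Proof.
have short v s : (size s < 2)%N -> is_walk v s -> path_img v s != 0.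
  move=> s2 w; rewrite (path_imgE w); apply/eqP => e0.
  have : (ideal_gen [set of_path K p | p in Z]) (of_path K (mkpath w)) by rewrite kerE.
  have [_ I2 _] := Zadm; move=> Ie; have := @ideal_power_shortless _ _ 2 _ (I2 _ Ie) (mkpath w) s2.
  by rewrite pcoef_path eqxx => /eqP; rewrite oner_eq0.
have walk v s : path_img v s != 0 -> is_walk v s.
  by apply: contraNT => /path_img0 ->.
have crdD v s x y : path_crd v s (x + y) = path_crd v s x + path_crd v s y.
  have [n0|n0] := eqVneq (path_img v s) 0; first by rewrite !crd0 ?addr0.
  have [x' <-] := phi_surj x; have [y' <-] := phi_surj y.
  by have w := walk _ _ n0; rewrite -rmorphD !(crdE w) // pcoefD.
have crdZ v s k x : path_crd v s (k *: x) = k * path_crd v s x.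
  have [n0|n0] := eqVneq (path_img v s) 0; first by rewrite !crd0 ?mulr0.
  have [x' <-] := phi_surj x.
  by have w := walk _ _ n0; rewrite -phiZ !(crdE w) // pcoefZ.
have img_ind (P : A -> Prop) : P 0 ->
   (forall k v s x, path_img v s != 0 -> P x -> P (k *: path_img v s + x)) -> forall x, P x.
  move=> P0 PD a; have [x <-] := phi_surj a.
  elim/path_algebra_ind: x => [|k p x IH]; first by rewrite rmorph0.
  rewrite rmorphD phiZ; have [->|n0] := eqVneq (phi (of_path K p)) 0.
    by rewrite scaler0 add0r.
  case: p n0 => -[v s] w n0; have e : phi (of_path K (QPath w)) = path_img v s by rewrite (path_imgE w).
  by rewrite e; apply: PD => //; rewrite -e.
split=> //.
- move=> v s u t; have [w|nw] := boolP (is_walk v s); last first.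
    rewrite (path_img0 nw) mul0r; case: eqP => // _; rewrite path_img0 //.
    by apply: contra nw; rewrite is_walk_cat => /andP[].
  have [w'|nw'] := boolP (is_walk u t); last first.
    rewrite (path_img0 nw') mulr0; case: eqP => // uE; rewrite path_img0 //.
    by apply: contra nw'; rewrite is_walk_cat uE => /andP[].
  rewrite (path_imgE w) (path_imgE w') -rmorphM /= [X in phi X]path_mulUU.
  case: eqP => [uE|/eqP uE].
    subst u; have wc : is_walk v (s ++ t) by rewrite is_walk_cat w.
    by rewrite (path_imgE wc) (mkpath_cat wc w w').
  by rewrite path_cat_none /= ?rmorph0 // /finish /start /= eq_sym.
- rewrite -(rmorph1 phi) -[1]/(path_one K Q) path_one.unlock rmorph_sum.
  by apply: eq_bigr => v _; rewrite path_imgE.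
- case: Zadm => _ _ [m m2 hm]; exists m => v s ms.
  have [w|nw] := boolP (is_walk v s); last exact: path_img0.
  rewrite (path_imgE w).
  have := hm _ (@long_path_power K _ m (mkpath w) (ltnW m2) ms).
  by rewrite kerE.
- by move=> v; apply: short.
- by move=> a; apply: short; rewrite //= eqxx.
- move=> v s u t n0; have w := walk _ _ n0.
  have [w'|nw'] := boolP (is_walk u t); last first.
    rewrite (path_img0 nw') -[0]/(0 : A) -(rmorph0 phi) (crdE w) // pcoef0.
    by case: eqP => // -[uv ts]; rewrite uv ts w in nw'.
  rewrite (path_imgE w') (crdE w) // pcoef_path.
  by congr (nat_of_bool _)%:R; apply/eqP/eqP => [[-> ->]|[uv ts]] //; exact: val_inj.
- move=> x x0; have [y yx] := phi_surj x; rewrite -yx in x0 *.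
  rewrite [y]path_algebraE rmorph_sum big1 // => -[[v s] w] _.
  rewrite phiZ; have e : phi (of_path K (QPath w)) = path_img v s by rewrite (path_imgE w).
  rewrite e; have [->|n0] := eqVneq (path_img v s) 0; first by rewrite scaler0.
  by have := x0 v s n0; rewrite (crdE w) // /pcoef => ->; rewrite scale0r.
Qed.

End FromQuotient.

Lemma monomial_presented (K : fieldType) (A : falgType K) : monomial_algebra A ->
  exists (Q : quiver) (el : vertex Q -> seq (arrow Q) -> A) cf, presented el cf.
Proof.
move=> [_ [Q [Z [adm [phi [phiZ surj kerE]]]]]].
by exists Q, (path_img phi), (path_crd surj); exact: presented_quotient phiZ surj _ adm kerE.
Qed.

Lemma cat_eqr (T : eqType) (s1 s2 t : seq T) : (s1 ++ t == s2 ++ t) = (s1 == s2).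
Proof. by rewrite -(can_eq revK) !rev_cat eqseq_cat // eqxx /= (can_eq revK). Qed.

Lemma rmZ (K : fieldType) (A : falgType K) (M : lmodType A^c) (z : M) k a :
  rm z (k *: a) = rm (rm z a) k%:A.
Proof. by rewrite rmA -scalerAr mulr1. Qed.

Section PathBasis.
Variables (K : fieldType) (A : falgType K) (Q : quiver).
Variables (el : vertex Q -> seq (arrow Q) -> A) (cf : vertex Q -> seq (arrow Q) -> A -> K).
Hypothesis H : presented el cf.
Implicit Types (v u : vertex Q) (s t w : seq (arrow Q)) (M : lmodType A^c).

Definition nonzero v s : bool := el v s != 0.
Local Notation nz := nonzero.
Definition vertex_idem v : A := el v [::].
Local Notation idm := vertex_idem.
Definition arrow_el (a : arrow Q) : A := el (src a) [:: a].

Lemma el_cat v s t : el v (s ++ t) = el v s * el (endp v s) t.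
Local Notation arr := arrow_el.
Proof. by rewrite (el_mul H) eqxx. Qed.

Lemma nz_cat v s t : nz v (s ++ t) -> nz v s /\ nz (endp v s) t.
Proof.
by rewrite /nonzero el_cat => h; split; apply: contraNneq h => ->; rewrite ?mul0r ?mulr0.
Qed.

Lemma nz_nil v : nz v [::]. Proof. exact: (el_nil H). Qed.

Lemma nz_cons v a s : nz v (a :: s) -> v = src a /\ nz (tgt a) s.
Proof.
move=> n; have /(el_walk H)/= /andP[/eqP-> _] := n; split=> //.
by have [_] := @nz_cat v [:: a] s n.
Qed.

Lemma el_cons v a s : src a = v -> el v (a :: s) = arr a * el (tgt a) s.
Proof. by move=> <-; rewrite -(el_cat _ [:: a]). Qed.

Lemma el_src v a : el v [:: a] = if v == src a then arr a else 0.
Proof.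
case: eqP => [->|ne] //; apply/eqP/negPn/negP => /(el_walk H)/=.
by rewrite andbT => /eqP e; apply: ne.
Qed.

Lemma idm_el u v s : idm u * el v s = if v == u then el v s else 0.
Proof. by rewrite /vertex_idem (el_mul H) /endp /=; case: eqP => [->|]. Qed.

Lemma idm_el1 v s : idm v * el v s = el v s. Proof. by rewrite idm_el eqxx. Qed.

Lemma el_idm v s u : el v s * idm u = if u == endp v s then el v s else 0.
Proof. by rewrite /vertex_idem (el_mul H) cats0. Qed.

Lemma el_idm1 v s : el v s * idm (endp v s) = el v s. Proof. by rewrite el_idm eqxx. Qed.

Lemma idm_idm v : idm v * idm v = idm v. Proof. exact: idm_el1. Qed.

Lemma cf0 v s : cf v s 0 = 0.
Proof. by rewrite -(scale0r (0 : A)) (cfZ H) mul0r. Qed.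

Lemma cfN v s x : cf v s (- x) = - cf v s x.
Proof. by rewrite -scaleN1r (cfZ H) mulN1r. Qed.

Lemma cfB v s x y : cf v s (x - y) = cf v s x - cf v s y.
Proof. by rewrite (cfD H) cfN. Qed.

Lemma cf_sum v s I (r : seq I) (P : pred I) (F : I -> A) :
  cf v s (\sum_(i <- r | P i) F i) = \sum_(i <- r | P i) cf v s (F i).
Proof. by apply: big_morph; [exact: (cfD H)|exact: cf0]. Qed.

Lemma cf_el1 v s : nz v s -> cf v s (el v s) = 1.
Proof. by move=> n; rewrite (cf_el H) // eqxx. Qed.

Lemma el_ext (V : lmodType K) (f g : A -> V) :
  (forall x y, f (x + y) = f x + f y) -> (forall k x, f (k *: x) = k *: f x) ->
  (forall x y, g (x + y) = g x + g y) -> (forall k x, g (k *: x) = k *: g x) ->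
  (forall v s, f (el v s) = g (el v s)) -> f =1 g.
Proof.
move=> fD fZ gD gZ fg; apply: (el_ind H); last first.
  by move=> k v s x _ e; rewrite fD gD fZ gZ fg e.
by rewrite -(scale0r (0 : A)) fZ gZ !scale0r.
Qed.

Lemma cf_ext (f g : A -> K) :
  (forall x y, f (x + y) = f x + f y) -> (forall k x, f (k *: x) = k * f x) ->
  (forall x y, g (x + y) = g x + g y) -> (forall k x, g (k *: x) = k * g x) ->
  (forall v s, f (el v s) = g (el v s)) -> f =1 g.
Proof. exact: (@el_ext K^o). Qed.

(** Cancelling a path on either side is injective on paths, so multiplying by
    a path only moves coordinates around. *)
Lemma cf_mulr v s t a : nz v (s ++ t) ->
  cf v (s ++ t) (a * el (endp v s) t) = cf v s a.
Proof.
move=> n; move: a; apply: cf_ext => [x y|k x|x y|k x|u w];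
  rewrite ?mulrDl ?(cfD H) -?scalerAl ?(cfZ H) //.
have [n1 _] := nz_cat n; rewrite (el_mul H) (cf_el H) //.
have [e|ne] := eqVneq (endp v s) (endp u w); last first.
  rewrite cf0; case: eqP => // -[uv ws]; by rewrite uv ws eqxx in ne.
by rewrite (cf_el H) // !xpair_eqE cat_eqr.
Qed.

Lemma cf_mulr_neq0 v w u t a : nz v w -> cf v w (a * el u t) != 0 ->
  exists2 s, w = s ++ t & endp v s = u.
Proof.
move=> n c; apply: contrapT => no; case/eqP: c; move: a.
apply: (@cf_ext _ (fun=> 0)) => [x y|k x|x y|k x|u' s];
  rewrite ?mulrDl ?(cfD H) -?scalerAl ?(cfZ H) ?addr0 ?mulr0 //.
rewrite (el_mul H); case: eqP => [e|_]; last exact: cf0.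
rewrite (cf_el H) //; case: eqP => // -[uv sw].
by case: no; exists s; rewrite -?sw -?uv.
Qed.

Lemma cf_mull v s t a : nz v (s ++ t) ->
  cf v (s ++ t) (el v s * a) = cf (endp v s) t a.
Proof.
move=> n; move: a; apply: cf_ext => [x y|k x|x y|k x|u w];
  rewrite ?mulrDr ?(cfD H) -?scalerAr ?(cfZ H) //.
have [_ n1] := nz_cat n; rewrite (el_mul H) (cf_el H) //.
have [e|ne] := eqVneq u (endp v s); last first.
  by rewrite cf0 xpair_eqE (negPf ne).
by rewrite (cf_el H) // !xpair_eqE e !eqxx /= eqseq_cat // eqxx.
Qed.

Lemma cf_mull_neq0 v w u s a : nz v w -> cf v w (el u s * a) != 0 ->
  u = v /\ exists t, w = s ++ t.
Proof.
move=> n c; apply: contrapT => no; case/eqP: c; move: a.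
apply: (@cf_ext _ (fun=> 0)) => [x y|k x|x y|k x|u' t];
  rewrite ?mulrDr ?(cfD H) -?scalerAr ?(cfZ H) ?addr0 ?mulr0 //.
rewrite (el_mul H); case: eqP => [e|_]; last exact: cf0.
rewrite (cf_el H) //; case: eqP => // -[uv sw].
by case: no; split=> //; exists t.
Qed.

Lemma cf_idm v s a : nz v s -> cf v s (a * idm (endp v s)) = cf v s a.
Proof. by move=> n; rewrite -{1}(cats0 s) cf_mulr ?cats0. Qed.

Lemma idm_cf v s a : nz v s -> cf v s (idm v * a) = cf v s a.
Proof. by move=> n; rewrite (@cf_mull v [::] s). Qed.

(** The character of [A] at a vertex. *)
Definition vertex_char v (a : A) : K := cf v [::] a.
Local Notation chi := vertex_char.

(** A product of two paths is trivial only if both paths are. *)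
Lemma chiM v a b : chi v (a * b) = chi v a * chi v b.
Proof.
move: b; apply: cf_ext => [x y|k x|x y|k x|u t];
  rewrite /vertex_char ?mulrDr ?(cfD H) -?scalerAr ?(cfZ H) ?mulrDr //; first by rewrite mulrCA.
rewrite (cf_el H _ _ (nz_nil v)) // xpair_eqE.
have [-> /=|tn] := eqVneq t [::]; last first.
  rewrite andbF mulr0; apply/eqP/negPn/negP => /(cf_mulr_neq0 (nz_nil v))[s].
  by move/esym/eqP; rewrite -size_eq0 size_cat addn_eq0 !size_eq0 (negPf tn) andbF.
have [->|uv] := eqVneq u v; first by rewrite mulr1 cf_idm ?nz_nil.
rewrite mulr0; apply/eqP/negPn/negP => /(cf_mulr_neq0 (nz_nil v))[[|//] _ uE].
by rewrite -uE eqxx in uv.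
Qed.

Lemma chi1 v : chi v 1 = 1.
Proof. by rewrite -[LHS]idm_cf ?nz_nil // mulr1 cf_el1 ?nz_nil. Qed.

Lemma sum_idm_l a : a = \sum_v idm v * a.
Proof. by rewrite -mulr_suml -(el_1 H) mul1r. Qed.

Lemma rm_sum_idm M (m : M) : m = \sum_v rm m (idm v).
Proof. by rewrite -rm_sumr -(el_1 H) rm1. Qed.

Lemma el_neq0_idm (a : A) : a != 0 -> exists v s, nz v s /\ cf v s a != 0.
Proof.
move=> a0; apply: contrapT => no; case/eqP: a0; apply: (cf_eq0 H) => v s n.
by apply: contrapT => /eqP c; apply: no; exists v, s.
Qed.

Definition maximal_path v s : Prop := nz v s /\ forall a, el v (rcons s a) = 0.
Local Notation maximal := maximal_path.

Lemma maximal_ex v s : nz v s -> exists t, maximal v (s ++ t).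
Proof.
have [L hL] := el_long H; move: {2}(L - size s)%N (erefl (L - size s)%N) => n.
elim: n s => [|n IH] s e ns.
  by move/eqP: ns; rewrite hL //; rewrite -subn_eq0 e.
case: (pselect (exists a, el v (rcons s a) != 0)) => [[a na]|no]; last first.
  exists [::]; rewrite cats0; split=> // a; apply/eqP/negPn/negP => na.
  by apply: no; exists a.
have [|t ht] := IH (rcons s a) _ na; last by exists (a :: t); rewrite -cat_rcons.
by rewrite size_rcons subnS e.
Qed.

Lemma maximal_cat v s t : maximal v s -> nz v (s ++ t) -> t = [::].
Proof.
move=> [n m]; case: t => // a t; rewrite -cat_rcons => /nz_cat[].
by rewrite /nonzero m eqxx.
Qed.

Lemma maximal_el v s u t : maximal v s -> t != [::] -> el v s * el u t = 0.
Proof.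
move=> ms tn; rewrite (el_mul H); case: eqP => // _.
by apply/eqP/negPn/negP => n; move/eqP: tn; apply; exact: maximal_cat n.
Qed.

Lemma maximal_mul v s a : maximal v s -> el v s * a = chi (endp v s) a *: el v s.
Proof.
move=> ms; move: a; apply: el_ext => [x y|k x|x y|k x|u t].
- exact: mulrDr.
- by rewrite scalerAr.
- by rewrite /vertex_char (cfD H) scalerDl.
- by rewrite /vertex_char (cfZ H) scalerA.
rewrite /vertex_char (cf_el H _ _ (nz_nil (endp v s))) // xpair_eqE.
have [->|tn] := eqVneq t [::]; last by rewrite maximal_el // andbF scale0r.
by rewrite -/(idm u) el_idm andbT; case: eqP; rewrite ?scale1r ?scale0r.
Qed.

(** The elements that span a copy of the simple module at [v], together with
    [0]. *)
Definition socle_at M v (z : M) : Prop :=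
  rm z (idm v) = z /\ forall a, rm z (arr a) = 0.
Local Notation socle := socle_at.

Lemma socle_el M v (z : M) u t : socle v z ->
  rm z (el u t) = if (u, t) == (v, [::]) then z else 0.
Proof.
move=> [ze za]; case: t => [|a t].
  rewrite -/(idm u) xpair_eqE andbT; case: eqP => [->|/eqP uv] //.
  by rewrite -ze rmA idm_el (negPf uv) rm0r.
rewrite xpair_eqE andbF; have [au|n] := eqVneq (src a) u.
  by rewrite el_cons // -rmA za rm0l.
rewrite (_ : el u (a :: t) = 0) ?rm0r //; apply/eqP/negPn/negP.
by move/nz_cons => [ua _]; rewrite ua eqxx in n.
Qed.

Lemma socle_act M v (z : M) a : socle v z -> rm z a = rm z (chi v a)%:A.
Proof.
move=> hz; move: a; apply: (el_ind H); first by rewrite /vertex_char cf0 scale0r.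
move=> k u t x n e; rewrite /vertex_char (cfD H) (cfZ H) rmDr scalerDl rmDr -/(chi v x) e.
congr (_ + _); rewrite rmZ (socle_el _ _ hz) (cf_el H _ _ (nz_nil v)) //.
by case: eqP => _; rewrite ?mulr1 ?mulr0 ?scale0r ?rm0l ?rm0r.
Qed.

End PathBasis.

(** Baer's criterion for the right ideal [b * A]: the equation [z * b = y] is
    solvable as soon as [y] satisfies the relations of [b]. *)
Lemma baer_cyclic (K : fieldType) (A : falgType K) (M : lmodType A^c) (b : A) (y : M) :
  baer M -> (forall a, b * a = 0 -> rm y a = 0) -> exists z, rm z b = y.
Proof.
move=> bM hb; pose S : set (A^c)^o := [set x | exists a : A, x = b * a].
have hS : submodule S.
  split; first by exists 0; rewrite mulr0.
    by move=> _ _ [a ->] [c ->]; exists (a + c); rewrite mulrDr.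
  by move=> c _ [a ->]; exists (a * (c : A)); rewrite mulrA.
pose f (x : (A^c)^o) : M := if pselect (exists a : A, x = b * a) is left e then rm y (sval (cid e)) else 0.
have fE a : f (b * a) = rm y a.
  rewrite /f; case: pselect => [e|[]]; last by exists a.
  case: cid => c /= bc; apply/eqP; rewrite -subr_eq0 -rmBr; apply/eqP/hb.
  by rewrite mulrBr bc subrr.
have [|z zE] := bM S f hS.
  split=> [_ _ [a ->] [c ->]|c _ [a ->]].
    by rewrite -[X in f X]/(b * a + b * c) -mulrDr !fE rmDr.
  by rewrite -[X in f X]/(b * a * (c : A)) -mulrA !fE -rmA.
exists z; rewrite -[y]rm1 -fE; apply/esym; rewrite mulr1; apply: (zE b).
by exists 1; rewrite mulr1.
Qed.

Section Good.
Variables (K : fieldType) (A : falgType K) (Q : quiver).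
Variables (el : vertex Q -> seq (arrow Q) -> A) (cf : vertex Q -> seq (arrow Q) -> A -> K).
Hypothesis H : presented el cf.
Implicit Types (v u j : vertex Q) (s t w : seq (arrow Q)) (M : lmodType A^c).
Local Notation nz := (nonzero el).
Local Notation idm := (vertex_idem el).
Local Notation arr := (arrow_el el).
Local Notation chi := (vertex_char cf).
Local Notation maximal := (maximal_path el).
Local Notation socle := (socle_at el).

Definition good_from v j w : Prop :=
  [/\ nz j w, endp j w = v,
      forall u s, nz u s -> endp u s = v -> exists t, w = t ++ s &
      forall s, nz j s -> exists t, w = s ++ t].

(** Combinatorial form of: the indecomposable injective module with socle at [v]
    is projective. *)
Definition good_vertex v : Prop := exists j w, good_from v j w.
Local Notation good := good_vertex.

(** A linear form that does not kill a socle element forces every path ending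
    at [v] to be a tail of one path [w]; injectivity then leaves no room for
    another path out of the source of [w]. *)
Lemma socle_good M v (z : M) :
  finitely_generated M -> projective_module M -> baer M ->
  socle v z -> z != 0 -> good v.
Proof.
move=> fM pM bM hz z0; have [th thz] := projective_form fM pM z0.
have thr m a : th (rm m a) = (th m : A) * a by exact: rm_lin.
set y : A := th z in thz; have [j [w [n c]]] := el_neq0_idm H thz.
have ya a : y * arr a = 0 by rewrite -thr (proj2 hz) linear0.
have wv : endp j w = v.
  have := c; rewrite -[y]/(th z) -{1}(proj1 hz) thr => /(cf_mulr_neq0 H n)[s].
  by rewrite cats0 => ->.
have tail u s : nz u s -> endp u s = v -> exists2 t, w = t ++ s & endp j t = u.
  move=> ns us; have [|x xE] := @baer_cyclic _ _ _ (el u s) z bM.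
    move=> a e; rewrite (socle_act H _ hz); have := @cf_mull _ _ _ _ _ H u s [::] a.
    by rewrite cats0 e (cf0 H) us /chi => <- //; rewrite scale0r rm0r.
  have := c; rewrite -{1}[y]/(th z) -xE thr => /(cf_mulr_neq0 H n)[t -> <-].
  by exists t.
have mw : maximal j w.
  split=> // a; apply/eqP/negPn/negP; rewrite -cats1 => na.
  have := cf_mulr H y na; have [_] := nz_cat H na.
  rewrite /nonzero (el_src H) wv; case: (v =P src a) => [va _|_]; last by rewrite eqxx.
  by rewrite ya (cf0 H) => e; rewrite -e eqxx in c.
exists j, w; split=> // [u s ns us|s ns]; first by have [t wE _] := tail u s ns us; exists t.
have [r ms] := maximal_ex H ns; suff <- : s ++ r = w by exists r.
apply/eqP/negPn/negP => sw; set s' := s ++ r in ms sw.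
have ns' : nz j s' by case: ms.
(* two different maximal paths span a right ideal, on which [M] could separate them *)
pose S : set (A^c)^o := [set x | exists k l, x = k *: el j w + l *: el j s'].
have mulS k l b : (k *: el j w + l *: el j s') * b =
    (k * chi v b) *: el j w + (l * chi (endp j s') b) *: el j s'.
  by rewrite mulrDl -!scalerAl (maximal_mul H _ mw) (maximal_mul H _ ms) wv !scalerA.
have cfS k l : cf j w (k *: el j w + l *: el j s') = k.
  rewrite (cfD H) !(cfZ H) (cf_el1 H n) (cf_el H _ _ n) xpair_eqE eqxx /=.
  by rewrite (negPf sw) mulr0 addr0 mulr1.
have hS : submodule S.
  split; first by exists 0, 0; rewrite !scale0r [RHS]addr0.
    by move=> _ _ [k [l ->]] [k2 [l2 ->]]; exists (k + k2), (l + l2); rewrite !scalerDl [LHS]addrACA.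
  by move=> b _ [k [l ->]]; eexists; eexists; exact: mulS.
have [|x xE] := bM S (fun a => rm z (cf j w a)%:A) hS.
  split=> [a b _ _|b _ [k [l ->]]]; first by rewrite (cfD H) scalerDl rmDr.
  rewrite [X in cf j w X]mulS !cfS -[RHS]/(rm (rm z k%:A) b) rmA -scalerAl mul1r.
  by rewrite [RHS]rmZ [in RHS](socle_act H _ hz) -[RHS]rmZ scalerA.
have e1 : rm x (el j w) = z.
  rewrite -[LHS]xE; first by rewrite (cf_el1 H n) scale1r rm1.
  by exists 1, 0; rewrite scale1r scale0r addr0.
have e2 : rm x (el j s') = 0.
  rewrite -[LHS]xE; last by exists 0, 1; rewrite scale1r scale0r add0r.
  by rewrite (cf_el H _ _ n) xpair_eqE eqxx /= (negPf sw) scale0r rm0r.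
have e1' := @cf_mulr _ _ _ _ _ H j [::] w (th x) n.
have e2' := @cf_mulr _ _ _ _ _ H j [::] s' (th x) ns'.
rewrite -thr /= e1 in e1'; rewrite -thr /= e2 linear0 (cf0 H) -e1' in e2'.
by move: c; rewrite -e2' eqxx.
Qed.

(** The right module [idm j * A] has simple socle, spanned by [el j w]: multiply
    [x] by the path that completes a shortest path in its support to [w]. *)
Lemma good_socle v j w (x : A) : good_from v j w -> idm j * x = x -> x != 0 ->
  exists (b : A) c, c != 0 /\ x * b = c *: el j w.
Proof.
move=> [n wv _ pre] xj x0.
have supp u s : nz u s -> cf u s x != 0 -> u = j.
  by move=> ns; rewrite -{1}xj => /(cf_mull_neq0 H ns)[-> _].
have [m [s [ns c <-]] smin] : exists2 m, (exists s, [/\ nz j s, cf j s x != 0 & size s = m])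
    & forall s, nz j s -> cf j s x != 0 -> (m <= size s)%N.
  have ex : exists m, `[< exists s, [/\ nz j s, cf j s x != 0 & size s = m] >].
    have [u [s [ns c]]] := el_neq0_idm H x0; have uj := supp _ _ ns c; subst u.
    by exists (size s); apply/asboolP; exists s.
  case: (ex_minnP ex) => m /asboolP hm mmin; exists m => // s ns c.
  by apply: mmin; apply/asboolP; exists s.
have [t wE] := pre s ns; exists (el (endp j s) t), (cf j s x); split=> //.
apply/eqP; rewrite -subr_eq0; apply/eqP/(cf_eq0 H) => u r nr.
rewrite (cfB H) (cfZ H) (cf_el H _ _ nr); case: eqP => [[ju wr]|ne].
  by subst u r; rewrite mulr1 wE (cf_mulr H) -?wE // subrr.
rewrite mulr0 subr0; apply/eqP/negPn/negP => cu.
have [s' rE es] := cf_mulr_neq0 H nr cu; have [ns' _] : nz u s' /\ nz (endp u s') t.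
  by apply: (nz_cat H); rewrite -rE.
have cs : cf u s' x != 0 by move: cu; rewrite rE -es (cf_mulr H) // -rE.
have uj := supp _ _ ns' cs; subst u.
have [r' wE'] := pre r nr; have := smin _ ns' cs.
have e1 := congr1 size wE'; have e2 := congr1 size wE; have e3 := congr1 size rE.
rewrite !size_cat in e1 e2 e3 => le; have /size0nil r0 : size r' = 0%N by lia.
by apply: ne; rewrite wE' r0 cats0.
Qed.

(** The module [idm j * A] is injective: extend the coordinate along [w],
    which detects the socle, to a functional on [A]. *)
Lemma good_baer v j w (S : set (A^c)^o) (f : (A^c)^o -> A) : good_from v j w ->
  submodule S -> linear_on S (f : (A^c)^o -> (A^c)^o) ->
  (forall x, S x -> idm j * f x = f x) ->
  exists2 y, idm j * y = y & forall x, S x -> f x = y * (x : A).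
Proof.
move=> g hS hf fj; have [n wv suf pre] := g.
have bK := @coind_baer K A K^o.
have kl (l : A -> K) : (forall x y, l (x + y) = l x + l y) -> (forall k x, l (k *: x) = k * l x) ->
  exists h : {linear A -> K^o}, forall x, h x = l x.
  by move=> lD lZ; exact: (@linear_pack K A K^o l lD lZ).
have klF (s : (A^c)^o) : exists h : {linear A -> K^o}, forall x, h x = cf j w (f s * x).
  by apply: kl => [x y|k x]; rewrite ?mulrDr ?(cfD H) -?scalerAr ?(cfZ H).
pose F (s : (A^c)^o) : coind A K^o := linfun (sval (cid (klF s))).
have FE (s : (A^c)^o) x : (F s : 'Hom(A, K^o)) x = cf j w (f s * x) by rewrite /F lfunE; case: cid.
have [|z zE] := bK S F hS.
  have [fD fZ] := hf; split=> [s t Ss St|a s Ss].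
    by apply/(@lfunP K A K^o) => x; rewrite add_lfunE !FE fD // mulrDl (cfD H).
  apply/(@lfunP K A K^o) => x; rewrite FE fZ // -[a *: F s]/(rm (F s) a) coindE FE.
  by rewrite mulrA.
pose l (a : A) : K := (z : 'Hom(A, K^o)) a.
(* the coordinate of [y] along an initial segment of [w] is the value of the
   extended functional at the complementary final segment *)
pose y := \sum_(i < (size w).+1) l (el (endp j (take i w)) (drop i w)) *: el j (take i w).
have yE a : cf j w (y * a) = l (a * idm v).
  have lD x1 x2 : l (x1 + x2) = l x1 + l x2 by rewrite /l linearD.
  have lZ k x1 : l (k *: x1) = k * l x1 by rewrite /l linearZ.
  have l0 : l 0 = 0 by rewrite /l linear0.
  move: a; apply: (cf_ext H) => [x1 x2|k x1|x1 x2|k x1|u s].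
  - by rewrite mulrDr (cfD H).
  - by rewrite -scalerAr (cfZ H).
  - by rewrite mulrDl lD.
  - by rewrite -scalerAl lZ.
  rewrite mulr_suml (cf_sum H) (el_idm H) //.
  under eq_bigr => i _ do rewrite -scalerAl (cfZ H) (el_mul H).
  have [us|us] := eqVneq v (endp u s); last first.
    rewrite l0 big1 // => i _.
    case: eqP => [ue|_]; last by rewrite (cf0 H) mulr0.
    rewrite (cf_el H _ _ n) xpair_eqE eqxx /=; case: eqP; rewrite ?mulr0 // => we.
    by move: us; rewrite ue -endp_cat we wv eqxx.
  have [n0|ns] := eqVneq (el u s) 0.
    rewrite n0 l0 big1 // => i _.
    case: eqP => [ue|_]; last by rewrite (cf0 H) mulr0.
    by rewrite (el_cat H) -ue n0 mulr0 (cf0 H) mulr0.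
  have [t wE] := suf u s ns (esym us).
  have ts : (size t < (size w).+1)%N by rewrite ltnS wE size_cat leq_addr.
  have tu : s != [::] -> endp j t = u.
    have := n; rewrite wE; case: (s) ns => // a s' ns' /(nz_cat H)[_ /(nz_cons H)[-> _]] _.
    by have [-> _] := nz_cons H ns'.
  rewrite (bigD1 (Ordinal ts)) //= big1 ?addr0; last first.
    move=> i ni; case: eqP => [ue|_]; last by rewrite (cf0 H) mulr0.
    rewrite (cf_el H _ _ n) xpair_eqE eqxx /=; case: eqP; rewrite ?mulr0 // => we.
    have e1 := congr1 size we; rewrite size_cat size_takel ?leq_ord // in e1.
    have e2 := congr1 size wE; rewrite size_cat in e2.
    by case/eqP: ni; apply: val_inj; apply: (@addIn (size s)); exact: etrans e1 e2.
  rewrite [in take _ w]wE take_size_cat // [in drop _ w]wE drop_size_cat //.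
  have eu : endp j t = u.
    have [s0|/tu //] := eqVneq s [::].
    by have := us; rewrite -wv wE s0 cats0.
  by rewrite eu eqxx -wE (cf_el1 H n) mulr1.
have yj : idm j * y = y.
  rewrite mulr_sumr; apply: eq_bigr => i _.
  by rewrite -scalerAr (idm_el1 H).
exists y => // x Sx; apply/eqP; rewrite -subr_eq0; apply/negPn/negP => d0.
have [|b [c [c0 xb]]] := good_socle g _ d0; first by rewrite mulrBr fj // mulrA yj.
case/eqP: c0; rewrite -[c]mulr1 -(cf_el1 H n) -(cfZ H) -xb.
have [_ _ SZ] := hS; have [_ fZ] := hf; have wv' := wv.
have Sxb : S ((x : A) * (b * idm v)) by exact: (SZ (b * idm v : A^c)).
have e : f ((x : A) * (b * idm v)) = f x * (b * idm v) by exact: (fZ (b * idm v : A^c)).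
have := congr1 (fun h : 'Hom(A, K^o) => h 1) (zE _ Sxb).
rewrite FE mulr1 [X in _ = X -> _](coindE z _ 1) mulr1 e mulrA -{1}wv cf_idm //.
by rewrite mulrBl (cfB H) -mulrA yE /l -mulrA => ->; rewrite subrr.
Qed.

(** Different good vertices [v] have different sources [j], so [A] is the
    direct sum of the injective modules [idm j * A]. *)
Lemma all_good_baer : (forall v, good v) -> baer (A^c)^o.
Proof.
move=> allg; pose jv v := sval (cid (allg v)).
have gP v : exists w, good_from v (jv v) w by rewrite /jv; case: cid.
have jv_inj : injective jv.
  move=> u v e; have [w gw] := gP u; have [w' gw'] := gP v.
  rewrite e in gw; have [n wu _ pre] := gw; have [n' wv _ pre'] := gw'.
  have [t tE] := pre _ n'; have [t' tE'] := pre' _ n.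
  suff ww : w' = w by rewrite -[LHS]wu -[RHS]wv ww.
  have e1 := congr1 size tE; have e2 := congr1 size tE'; rewrite !size_cat in e1 e2.
  have /size0nil t0 : size t = 0%N by lia.
  by rewrite tE t0 cats0.
move=> S f hS hf; have [fD fZ] := hf.
have yP v : exists y : A, forall x, S x -> idm (jv v) * (f x : A) = y * (x : A).
  have [w gw] := gP v.
  have [|x Sx|y _ yE] := @good_baer v (jv v) w S (fun x => idm (jv v) * (f x : A)) gw hS.
  - split=> [a b Sa Sb|a b Sb]; first by rewrite fD // [LHS]mulrDr.
    by rewrite fZ // [LHS]mulrA.
  - by rewrite mulrA (idm_idm H).
  by exists y.
pose y v := sval (cid (yP v)).
have yE v x : S x -> idm (jv v) * (f x : A) = y v * (x : A) by rewrite /y; case: cid => y' /=; apply.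
exists (\sum_v y v : A) => x Sx; rewrite [RHS]mulr_suml.
rewrite [LHS](sum_idm_l H) (reindex_inj jv_inj) /=.
by apply: eq_bigr => v _; exact: yE.
Qed.

End Good.

Section GoodProjective.
Variables (K : fieldType) (A : falgType K) (Q : quiver).
Variables (el : vertex Q -> seq (arrow Q) -> A) (cf : vertex Q -> seq (arrow Q) -> A -> K).
Hypothesis H : presented el cf.
Variable M : lmodType A^c.
Local Notation idm := (vertex_idem el).
Local Notation arr := (arrow_el el).
Local Notation chi := (vertex_char cf).
Local Notation socle := (socle_at el).

(** Generators [x i] of a direct sum of projective-injective submodules. *)
Definition indep_sys k (x : 'I_k -> M) (j : 'I_k -> vertex Q) (w : 'I_k -> seq (arrow Q)) : Prop :=
  [/\ forall i, good_from el (endp (j i) (w i)) (j i) (w i),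
      forall i, rm (x i) (idm (j i)) = x i &
      forall a : 'I_k -> A, (forall i, idm (j i) * a i = a i) ->
        \sum_i rm (x i) (a i) = 0 -> forall i, a i = 0].

Lemma indep_sys_bound (W : vectType K) (q : M -> W) k (x : 'I_k -> M) j w :
  klinear q -> injective q -> indep_sys x j w -> (k <= \dim {:W})%N.
Proof.
move=> hq q_inj [_ xj ind].
have fr : free [tuple q (x i) | i < k].
apply/freeP => c cE i.
  have e0 : \sum_i rm (x i) (c i *: idm (j i)) = 0.
    apply: q_inj; rewrite (klinear0 hq) klinear_sum // -[RHS]cE.
    apply: eq_bigr => l _; rewrite -tnth_nth tnth_mktuple.
    by have [_ qZ] := hq; rewrite rmZ xj qZ.
  have /eqP : c i *: idm (j i) = 0.
    apply: (ind (fun i => c i *: idm (j i))) => // l.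
    by rewrite -scalerAr (idm_idm H).
  by rewrite scaler_eq0 => /orP[/eqP//|]; rewrite (negPf (el_nil H _)).
by rewrite -[k](size_tuple [tuple q (x i) | i < k]) -(eqnP fr) dimvS ?subvf.
Qed.

Hypotheses (fM : finitely_generated M) (bM : baer M).
Hypothesis goodM : forall v (z : M), socle v z -> z != 0 -> good_vertex el v.

Lemma max_indep_sys : exists k (x : 'I_k -> M) j w, indep_sys x j w /\
  forall (x' : 'I_k.+1 -> M) j' w', ~ indep_sys x' j' w'.
Proof.
have [m [q [hq q_inj]]] := fg_embed fM.
pose P k := exists (x : 'I_k -> M) j w, indep_sys x j w.
have [||k [x [j [w h]]] kmax] := @bounded_max P 0 (\dim {: {ffun 'I_m -> A}}).
- have no0 (i : 'I_0) : False by case: i.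
  by exists (fun=> 0), (fun i => match no0 i with end), (fun=> [::]); split=> [i|i|a _ _ i]; case: (no0 i).
- by move=> d [x [j [w h]]]; exact: (indep_sys_bound hq q_inj h).
exists k, x, j, w; split=> // x' j' w' h'.
by have := kmax k.+1 (ex_intro _ x' (ex_intro _ j' (ex_intro _ w' h'))); rewrite ltnn.
Qed.

Section Generate.
Variables (k : nat) (x : 'I_k -> M) (j : 'I_k -> vertex Q) (w : 'I_k -> seq (arrow Q)).
Hypothesis sys : indep_sys x j w.
Hypothesis sys_max : forall (x' : 'I_k.+1 -> M) j' w', ~ indep_sys x' j' w'.

Definition gen_by : set M := [set m | exists a : 'I_k -> A,
  (forall i, idm (j i) * a i = a i) /\ m = \sum_i rm (x i) (a i)].

Lemma gen_by_submodule : submodule gen_by.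
Proof.
split.
- exists (fun=> 0); split=> [i|]; first by rewrite mulr0.
  by rewrite big1 // => i _; rewrite rm0r.
- move=> _ _ [a [ha ->]] [b [hb ->]]; exists (fun i => a i + b i); split=> [i|].
    by rewrite mulrDr ha hb.
  by rewrite -big_split; apply: eq_bigr => i _; rewrite rmDr.
- move=> c _ [a [ha ->]]; exists (fun i => a i * (c : A)); split=> [i|].
    by rewrite mulrA ha.
  by rewrite scaler_sumr; apply: eq_bigr => i _; rewrite -rmA.
Qed.

(** Otherwise the projective-injective module with this socle element could be
    added to the system. *)
Lemma gen_by_socle v z : socle v z -> gen_by z.
Proof.
move=> hz; have [->|z0] := eqVneq z 0; first by case: gen_by_submodule.
apply: contrapT => nz; have [j0 [w0 g0]] := goodM hz z0.
have [n0 wv _ _] := g0.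
have [|x1 x1E] := @baer_cyclic _ _ _ (el j0 w0) z bM.
  move=> a e; rewrite (socle_act H _ hz); have := @cf_mull _ _ _ _ _ H j0 w0 [::] a.
  by rewrite cats0 e (cf0 H) wv /vertex_char => <- //; rewrite scale0r rm0r.
pose ext T (t0 : T) (t : 'I_k -> T) i := if unlift ord0 i is Some i' then t i' else t0.
have ext0 T (t0 : T) t : ext T t0 t ord0 = t0 by rewrite /ext unlift_none.
have extS T (t0 : T) t i : ext T t0 t (lift ord0 i) = t i by rewrite /ext liftK.
have [gs xj ind] := sys.
pose x0 := rm x1 (idm j0).
have x0E : rm x0 (el j0 w0) = z by rewrite rmA (idm_el1 H).
apply: (sys_max (x' := ext _ x0 x) (j' := ext _ j0 j) (w' := ext _ w0 w)); split.
- move=> i; case: (unliftP ord0 i) => [i' ->|->]; rewrite ?extS ?ext0 //.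
  by rewrite wv.
- move=> i; case: (unliftP ord0 i) => [i' ->|->]; rewrite ?extS ?ext0 //.
  by rewrite rmA (idm_idm H).
move=> a ha; rewrite big_ord_recl ext0 => e.
have ha0 := ha ord0; rewrite ext0 in ha0.
have a0 : a ord0 = 0.
  apply/eqP/negPn/negP => a0; have [b [c [c0 ab]]] := good_socle H g0 ha0 a0.
  have : gen_by (rm z c%:A).
    rewrite -x0E -rmZ -ab -rmA; have /eqP := e; rewrite addr_eq0 => /eqP ->.
    have [_ _ gZ] := gen_by_submodule.
    apply/(gZ (b : A^c))/(submoduleN gen_by_submodule).
    exists (fun i => a (lift ord0 i)); split=> [i|].
      by have := ha (lift ord0 i); rewrite extS.
    by apply: eq_bigr => i _; rewrite extS.
  have [_ _ gZ] := gen_by_submodule.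
  move/(gZ (c^-1%:A : A)); rewrite -[X in gen_by X]/(rm (rm z c%:A) c^-1%:A).
  by rewrite -rmZ scalerA mulVf // scale1r rm1.
move=> i; case: (unliftP ord0 i) => [i' ->|->] //.
apply: (ind (fun i => a (lift ord0 i))) => [l|]; first by have := ha (lift ord0 l); rewrite extS.
rewrite -[RHS]e a0 rm0r add0r; by apply: eq_bigr => l _; rewrite extS.
Qed.

(** Induction on the length of the paths that kill [m]. Multiplication by [m]
    maps the radical into the module generated by the [x i], which is
    injective, so [m] differs from an element of that module by socle
    elements. *)
Lemma gen_by_all m : gen_by m.
Proof.
have [g0 gD gZ] := gen_by_submodule; have [gs xj ind] := sys.
have [L hL] := el_long H.
suff : forall n m, (forall u s, (n <= size s)%N -> rm m (el u s) = 0) -> gen_by m.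
  by move=> /(_ L m); apply=> u s Ls; rewrite hL ?rm0r.
elim=> [|n IH] {}m hm.
  by rewrite [m](rm_sum_idm H) big1 // => v _; exact: hm.
have ga a : gen_by (rm m (arr a)).
  apply: IH => u s ns; rewrite rmA (el_mul H); case: eqP => _; last exact: rm0r.
  by apply: hm; rewrite /= ltnS.
have gr r : gen_by (rm m (r - \sum_v chi v r *: idm v)).
  move: r; apply: (el_ind H).
    by rewrite big1 ?subr0 ?rm0r // => v _; rewrite /vertex_char (cf0 H) scale0r.
  move=> c u s r ns IHr.
  have -> : c *: el u s + r - \sum_v chi v (c *: el u s + r) *: idm v =
      c *: (el u s - \sum_v chi v (el u s) *: idm v) + (r - \sum_v chi v r *: idm v).
    rewrite scalerBr scaler_sumr addrACA -opprD -big_split; congr (_ - _).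
    by apply: eq_bigr => v _; rewrite /vertex_char (cfD H) (cfZ H) scalerDl scalerA.
  rewrite rmDr; apply: gD => //; rewrite rmZ; apply: (gZ).
  case: s ns => [|a s] ns.
    rewrite (bigD1 u) //= big1 => [|v vu].
      by rewrite /vertex_char (cf_el1 H) ?(nz_nil H) // scale1r addr0 subrr rm0r.
    by rewrite /vertex_char (cf_el H _ _ (nz_nil H v)) xpair_eqE eq_sym (negPf vu) scale0r.
  rewrite big1 => [|v _].
    have [us _] := nz_cons H ns; rewrite subr0 (el_cons H) // -rmA.
    exact: (gZ (el (tgt a) s : A^c) _ (ga a)).
  by rewrite /vertex_char (cf_el H _ _ (nz_nil H v)) xpair_eqE andbF scale0r.
pose S : set (A^c)^o := [set r | forall v, chi v r = 0].
have hS : submodule S.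
  split=> [v|r r' hr hr' v|b r hr v]; first exact: (cf0 H).
    by rewrite /vertex_char (cfD H) [cf v [::] r]hr [cf v [::] r']hr' addr0.
  by rewrite [LHS](chiM H) hr mul0r.
have gS r : S r -> gen_by (rm m r).
  by move=> Sr; have := gr r; rewrite big1 ?subr0 // => v _; rewrite Sr scale0r.
pose co m' : 'I_k -> A := if pselect (gen_by m') is left e then sval (cid e) else fun=> 0.
have coP m' : gen_by m' -> (forall i, idm (j i) * co m' i = co m' i) /\ m' = \sum_i rm (x i) (co m' i).
  by rewrite /co; case: pselect => // e _; case: cid.
have coU m' a : gen_by m' -> (forall i, idm (j i) * a i = a i) ->
    m' = \sum_i rm (x i) (a i) -> forall i, co m' i = a i.
  move=> gm ha mE i; have [hc cE] := coP _ gm; apply/eqP; rewrite -subr_eq0; apply/eqP.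
  apply: (ind (fun i => co m' i - a i)) => [l|]; first by rewrite mulrBr hc ha.
  under eq_bigr do rewrite rmBr.
  by rewrite sumrB -cE -mE subrr.
have yP i : exists2 y, idm (j i) * y = y & forall r, S r -> co (rm m r) i = y * (r : A).
  apply: (good_baer H (gs i) hS); last by move=> r /gS/coP[].
  split=> [r r' Sr Sr'|b r Sr].
    have [hr er] := coP _ (gS _ Sr); have [hr' er'] := coP _ (gS _ Sr').
    apply: (coU _ (fun i => co (rm m r) i + co (rm m r') i)).
    - by rewrite rmDr; apply: (gD _ _ (gS _ Sr) (gS _ Sr')).
    - by move=> l; rewrite mulrDr hr hr'.
    - rewrite rmDr {1}er {1}er' -big_split; apply: eq_bigr => l _.
      by rewrite rmDr.
  have [hr er] := coP _ (gS _ Sr).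
  apply: (coU _ (fun i => co (rm m r) i * (b : A))).
  - by have := gZ (b : A^c) _ (gS _ Sr); rewrite -[X in gen_by X]/(rm (rm m r) b) rmA.
  - by move=> l; rewrite mulrA hr.
  - rewrite -[LHS]/(rm m ((r : A) * b)) -rmA {1}er rm_suml; apply: eq_bigr => l _.
    by rewrite rmA.
pose y i := s2val (cid2 (yP i)).
have yj i : idm (j i) * y i = y i by rewrite /y; case: cid2.
have yE i r : S r -> co (rm m r) i = y i * (r : A) by rewrite /y; case: cid2 => y' _ /=; apply.
pose m' := \sum_i rm (x i) (y i); have gm' : gen_by m' by exists y.
have dS r : S r -> rm (m - m') r = 0.
  move=> Sr; rewrite rmBl; have [_ ->] := coP _ (gS _ Sr); rewrite rm_suml -sumrB.
  by rewrite big1 // => i _; rewrite yE // rmA subrr.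
rewrite -[m](subrK m') addrC; apply: gD => //.
rewrite [m - m'](rm_sum_idm H); apply: submodule_sum => [|v _]; first exact: gen_by_submodule.
apply: (@gen_by_socle v); split=> [|a]; first by rewrite rmA (idm_idm H).
rewrite rmA; apply: dS => u; rewrite (chiM H) [X in _ * X](_ : _ = 0) ?mulr0 //.
by rewrite /vertex_char (cf_el H _ _ (nz_nil H u)) xpair_eqE andbF.
Qed.

(** Coordinates along the [x i] are unique, so a lift of the [x i] extends. *)
Lemma gen_by_projective : projective_module M.
Proof.
have [gs xj ind] := sys; move=> X Y g f _ _ gsurj.
pose co m : 'I_k -> A := sval (cid (gen_by_all m)).
have coP m : (forall i, idm (j i) * co m i = co m i) /\ m = \sum_i rm (x i) (co m i).
  by rewrite /co; case: cid.
have coU m a : (forall i, idm (j i) * a i = a i) ->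
    m = \sum_i rm (x i) (a i) -> forall i, co m i = a i.
  move=> ha mE i; have [hc cE] := coP m; apply/eqP; rewrite -subr_eq0; apply/eqP.
  apply: (ind (fun i => co m i - a i)) => [l|]; first by rewrite mulrBr hc ha.
  under eq_bigr do rewrite rmBr.
  by rewrite sumrB -cE -mE subrr.
pose xi i := sval (cid (gsurj (f (x i)))).
have xiE i : g (xi i) = f (x i) by rewrite /xi; case: cid.
have [||h hE] := @linear_pack _ M X (fun m => \sum_i rm (xi i) (co m i)).
- move=> m m'; rewrite -big_split; apply: eq_bigr => i _; rewrite /= -rmDr; congr rm.
  have [hm em] := coP m; have [hm' em'] := coP m'; apply: (coU _ (fun i => co m i + co m' i)).
    by move=> l; rewrite mulrDr hm hm'.
  by rewrite {1}em {1}em' -big_split; apply: eq_bigr => l _; rewrite rmDr.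
- move=> b m; rewrite scaler_sumr; apply: eq_bigr => i _.
  rewrite -[RHS]/(rm (rm (xi i) (co m i)) b) rmA; congr rm.
  have [hm em] := coP m; apply: (coU _ (fun i => co m i * (b : A))).
    by move=> l; rewrite mulrA hm.
  rewrite {1}em -[LHS]/(rm (\sum_i rm (x i) (co m i)) b) rm_suml.
  by apply: eq_bigr => l _; rewrite rmA.
exists h => m; rewrite hE linear_sum; have [_ em] := coP m; rewrite [in RHS]em linear_sum.
by apply: eq_bigr => i _; rewrite !rm_lin xiE.
Qed.

End Generate.

Lemma good_socle_projective : projective_module M.
Proof.
by have [k [x [j [w [h hmax]]]]] := max_indep_sys; exact: gen_by_projective h hmax.
Qed.

End GoodProjective.

(** * Dimension shifting *)

Section Shift.
Variables (K : fieldType) (A : falgType K).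
Variables (I : nat -> lmodType A^c) (eps : {linear (A^c)^o -> I 0%N})
  (d : forall i, {linear I i -> I i.+1}).
Hypothesis min : minimal_injective_coresolution eps d.

(** [e 0 * A <- e 1 * A <- ... <- e m * A], with differentials the left
    multiplications by the [x k], is the start of a projective resolution of
    [e 0 * A / x 1 * A]. *)
Variables (x e : nat -> A) (m : nat).

Record resolving : Prop := Resolving {
  res_idem : forall k, e k * e k = e k;
  res_0 : x 0%N = 0;
  res_l : forall k, (k < m)%N -> e k * x k.+1 = x k.+1;
  res_r : forall k, (k < m)%N -> x k.+1 * e k.+1 = x k.+1;
  res_d : forall k, (k < m)%N -> x k * x k.+1 = 0;
  res_exact : forall k a, (0 < k)%N -> (k < m)%N -> x k * a = 0 ->
    exists b, e k * a = x k.+1 * b }.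

Hypothesis res : resolving.

(** A cocycle of degree [k] is an element that kills all these [a]. *)
Definition boundary k (a : A) : Prop :=
  if k is 0%N then exists b, e 0%N * a = x 1%N * b else x k * a = 0.

(** [y] represents a nonzero class in the [k]-th extension group with
    coefficients in the [i]-th cosyzygy, the kernel of [d i]. *)
Definition ext_class i k (y : I i) : Prop :=
  [/\ d i y = 0, rm y (e k) = y, forall a, boundary k a -> rm y a = 0 &
      ~ exists u, d i u = 0 /\ y = rm u (x k)].

Lemma min_exact i (y : I i.+1) : d i.+1 y = 0 <-> exists z, d i z = y.
Proof.
have [_ _ _ ex _] := min; have := ex i; move/seteqP => [sub1 sub2].
by split=> [y0|[z <-]]; [have [z _ zE] := sub2 y y0; exists z|apply: sub1; exists z].
Qed.

Lemma min_exact0 (y : I 0%N) : d 0%N y = 0 <-> exists a : A, eps a = y.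
Proof.
have [_ _ ex _ _] := min; move/seteqP: ex => [sub1 sub2].
by split=> [y0|[z <-]]; [have [z _ zE] := sub2 y y0; exists z|apply: sub1; exists z].
Qed.

Lemma min_eps_inj a : eps a = 0 -> a = 0.
Proof. by have [_ inj _ _ _] := min => e0; apply: inj; rewrite e0 linear0. Qed.

Lemma min_baer i : baer (I i).
Proof. by have [fI _ _ _ _] := min; have [_] := fI i; exact: fg_injective_baer. Qed.

Lemma min_fg i : finitely_generated (I i).
Proof. by have [fI _ _ _ _] := min; have [] := fI i. Qed.

Lemma boundary_lift k a : (k < m)%N -> boundary k a ->
  exists b, e k * a = x k.+1 * b.
Proof. by case: k => [|k] km //= ka; exact: (res_exact res). Qed.

(** Solve [z * x k.+1 = y] in the injective module [I i] and apply [d i] to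
    [z]. *)
Lemma ext_shift i k (y : I i) : (k < m)%N -> ext_class k.+1 y ->
  exists y' : I i.+1, ext_class k y'.
Proof.
move=> km [dy ye ykill ynt].
have [z0 z0E] := baer_cyclic (@min_baer i) (b := x k.+1) (y := y) ykill.
pose z := rm z0 (e k).
have zx : rm z (x k.+1) = y by rewrite rmA (res_l res).
have ze : rm z (e k) = z by rewrite rmA (res_idem res).
exists (d i z); split.
- by apply/min_exact; exists z.
- by rewrite -rm_lin ze.
- move=> a /(boundary_lift km)[b ab].
  by rewrite -rm_lin -ze rmA ab -rmA zx rm_lin dy rm0l.
- move=> [u [/min_exact[c cu] yu]]; apply: ynt; exists (z - rm c (x k)); split.
    by rewrite linearB (rm_lin _ c) cu yu subrr.
  by rewrite rmBl zx rmA (res_d res) // rm0r subr0.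
Qed.

(** Lift [y] along [d i] and multiply by [x k.+1]. For [k = 0] the minimality
    of the coresolution takes the place of the exactness at [x k]. *)
Lemma ext_unshift i k (y : I i.+1) : (k < m)%N ->
  (k = 0%N -> forall z : I i, rm z (e 0%N) = z -> rm z (x 1%N) = 0 -> d i z = 0) ->
  ext_class k y -> exists y' : I i, ext_class k.+1 y'.
Proof.
move=> km k0 [dy ye ykill ynt]; have [z0 z0E] := (min_exact y).1 dy.
pose z := rm z0 (e k).
have ze : rm z (e k) = z by rewrite rmA (res_idem res).
have dz : d i z = y by rewrite rm_lin z0E.
exists (rm z (x k.+1)); split.
- rewrite rm_lin dz ykill //; case: (k) km => [|k'] km /=; last exact: (res_d res).
  by exists 1; rewrite mulr1 (res_l res).
- by rewrite rmA (res_r res).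
- by move=> a /= ax; rewrite rmA ax rm0r.
- move=> [u [du zu]]; apply: ynt.
  pose z' := rm (z - u) (e k).
  have z'e : rm z' (e k) = z' by rewrite rmA (res_idem res).
  have z'x : rm z' (x k.+1) = 0 by rewrite rmA (res_l res) // rmBl zu subrr.
  have dz' : d i z' = y by rewrite rm_lin linearB du subr0 dz.
  have [k00|kp] := posnP k.
    exists 0; rewrite linear0 rm0l; split=> //; rewrite -dz'.
    by apply: (k0 k00); rewrite -k00.
  have [|c cE] := @baer_cyclic _ _ _ (x k) z' (@min_baer i).
    move=> a xa; have [b ab] := res_exact res kp km xa.
    by rewrite -z'e rmA ab -rmA z'x rm0l.
  exists (d i c); rewrite -rm_lin cE; split=> //.
  by apply/min_exact; exists c.
Qed.

Lemma ext_shifts k i (y : I i) : (k <= m)%N -> ext_class k y ->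
  exists y' : I (i + k)%N, ext_class 0%N y'.
Proof.
elim: k i y => [|k IH] i y km hy; first by rewrite addn0; exists y.
by have [y' hy'] := ext_shift km hy; rewrite addnS -addSn; apply: IH hy'; exact: ltnW.
Qed.

Lemma ext_unshifts k i (y : I (i + k)%N) : (k <= m)%N ->
  (forall i (z : I i), rm z (e 0%N) = z -> rm z (x 1%N) = 0 -> d i z = 0) ->
  ext_class 0%N y -> exists y' : I i, ext_class k y'.
Proof.
move=> + hmin; elim: k i y => [|k IH] i; first by rewrite addn0 => y _ hy; exists y.
rewrite addnS -addSn => y km hy; have [y' hy'] := IH _ _ (ltnW km) hy.
by apply: ext_unshift hy' => // _; exact: hmin.
Qed.

(** A class in [Ext^m] produces an element of [I m] annihilated by [x 1]. *)
Lemma ext_socle (y : A) : (0 < m)%N ->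
  y * e m = y -> (forall a, x m * a = 0 -> y * a = 0) -> (~ exists u, y = u * x m) ->
  exists z : I m, [/\ z != 0, rm z (e 0%N) = z & rm z (x 1%N) = 0].
Proof.
move=> m0 ye yk ynt.
have [|z [_ ze zk znt]] := @ext_shifts m 0 (eps y) (leqnn m).
  split.
  - by apply/min_exact0; exists y.
  - by rewrite -rm_lin -[X in _ = eps X]ye.
  - case: (m) m0 yk => // m' _ yk a /= xa; rewrite -rm_lin -[RHS](linear0 eps).
    by congr (eps _); exact: yk.
  - move=> [u [/min_exact0[a <-] e1]]; apply: ynt; exists a.
    apply/eqP; rewrite -subr_eq0; apply/eqP/min_eps_inj.
    by rewrite (linearB eps) e1 -rm_lin subrr.
exists z; split=> //; last by apply: zk; exists 1; rewrite mulr1 (res_l res).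
by apply/eqP => z0; apply: znt; exists 0; rewrite linear0 rm0l.
Qed.

(** The converse, for a minimal coresolution. *)
Lemma socle_ext (z : I m) : (0 < m)%N ->
  (forall i (z : I i), rm z (e 0%N) = z -> rm z (x 1%N) = 0 -> d i z = 0) ->
  z != 0 -> rm z (e 0%N) = z -> rm z (x 1%N) = 0 ->
  exists y : A, [/\ y * e m = y, forall a, x m * a = 0 -> y * a = 0 &
    ~ exists u, y = u * x m].
Proof.
move=> m0 hmin z0 ze zx.
have [|y [dy ye yk ynt]] := @ext_unshifts m 0 z (leqnn m) hmin.
  split=> //; first exact: hmin.
    by move=> a [b ab]; rewrite -ze rmA ab -rmA zx rm0l.
  by move=> [u [_ zu]]; rewrite (res_0 res) rm0r in zu; rewrite zu eqxx in z0.
have [a aE] := (min_exact0 y).1 dy; have [_ inj _ _ _] := min; exists a; split.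
- by apply: inj; rewrite -[LHS]/(eps (rm (a : (A^c)^o) (e m))) rm_lin aE.
- move=> b xb; apply: min_eps_inj; rewrite -[LHS]/(eps (rm (a : (A^c)^o) b)) rm_lin aE.
  by apply: yk; case: (m) m0 xb.
- move=> [u au]; apply: ynt; exists (eps u); split; first by apply/min_exact0; exists u.
  by rewrite -aE au -rm_lin.
Qed.

End Shift.

(** * Monomial algebras of dominant dimension at least two are Nakayama *)

Lemma cat_suffix (T : Type) (t t' a b : seq T) : t ++ a = t' ++ b ->
  (size a <= size b)%N -> exists y, b = y ++ a.
Proof.
move=> e ab; have := congr1 size e; rewrite !size_cat => es.
have := congr1 (drop (size t')) e; rewrite [RHS]drop_size_cat // drop_cat.
case: ltnP => le <-; first by exists (drop (size t') t).
have -> : (size t' - size t)%N = 0%N by lia.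
by exists [::]; rewrite drop0.
Qed.

Section Upper.
Variables (K : fieldType) (A : falgType K) (Q : quiver).
Variables (el : vertex Q -> seq (arrow Q) -> A) (cf : vertex Q -> seq (arrow Q) -> A -> K).
Hypothesis H : presented el cf.
Local Notation idm := (vertex_idem el).
Local Notation arr := (arrow_el el).
Local Notation nz := (nonzero el).
Local Notation maximal := (maximal_path el).
Local Notation good := (good_vertex el).
Local Notation socle := (socle_at el).

Variables (I : nat -> lmodType A^c) (eps : {linear (A^c)^o -> I 0%N})
  (d : forall i, {linear I i -> I i.+1}).
Hypothesis min : minimal_injective_coresolution eps d.

(** The image of the preceding map is essential, so it contains the line
    spanned by [z]. *)
Lemma min_socle i v (z : I i) : socle v z -> d i z = 0.
Proof.
move=> hz; apply: contrapT => dz; have [_ _ _ _ [ess0 ess]] := min.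
pose T : set (I i) := [set t | exists k, t = rm z k%:A].
have hT : submodule T.
  split; first by exists 0; rewrite scale0r rm0r.
    by move=> _ _ [k ->] [l ->]; exists (k + l); rewrite scalerDl rmDr.
  move=> b _ [k ->]; exists (vertex_char cf v b * k).
  rewrite -[LHS]/(rm (rm z k%:A) b) rmA -scalerAl mul1r rmZ (socle_act H b hz).
  by rewrite -rmZ scalerA mulrC.
have T0 : T = [set 0]; last first.
  have : T z by exists 1; rewrite scale1r rm1.
  by rewrite T0 => z0; apply: dz; rewrite z0 linear0.
have kd k : d i (rm z k%:A) = 0 -> rm z k%:A = 0.
  rewrite rm_lin; have [->|k0] := eqVneq k 0; first by rewrite scale0r !rm0r.
  move=> e; case: dz; have -> : d i z = rm (rm (d i z) k%:A) k^-1%:A; last by rewrite e rm0l.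
  by rewrite -rmZ scalerA mulVf // scale1r rm1.
have zz : (T `&` [set y | d i y = 0]) = [set 0].
  apply/seteqP; split=> [_ [[k ->] /kd]|_ ->] //.
  by split; [case: hT|rewrite /= linear0].
case: i z hz dz T hT kd zz => [|i] z hz dz T hT kd zz.
  by apply: ess0 => //; have [_ _ -> _ _] := min; rewrite setIC.
by apply: ess => //; have [_ _ _ -> _] := min; rewrite setIC.
Qed.

Lemma proj_socle_good i v (z : I i) : projective_module (I i) ->
  socle v z -> z != 0 -> good v.
Proof.
by move=> p; apply: (socle_good H) => //; [exact: min_fg min i|exact: min_baer min i].
Qed.

(** A maximal path is a socle element of [A]. *)
Lemma maximal_good v s : projective_module (I 0%N) -> maximal v s -> good (endp v s).
Proof.
move=> p0 ms; apply: (@proj_socle_good 0%N _ (eps (el v s))) => //.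
  split=> [|a]; rewrite -rm_lin; first by rewrite rm_reg (el_idm1 H).
  by rewrite rm_reg (maximal_el H) // linear0.
by apply: contraTneq (ms.1) => /(min_eps_inj min) e; rewrite /nonzero e eqxx.
Qed.

Lemma nz_src_eq j j' s : nz j s -> nz j' s -> endp j s = endp j' s -> j = j'.
Proof. by case: s => // a s /(nz_cons H)[-> _] /(nz_cons H)[-> _]. Qed.

(** The radical is the direct sum of the right ideals generated by the arrows,
    hence some [x] in [I 0] acts like [eps 1] on the arrow [a] and kills the
    other arrows; it is a socle element modulo [A]. *)
Lemma fork_good a b : projective_module (I 1%N) -> src a = src b -> a <> b -> good (src a).
Proof.
move=> p1 ab nab.
pose S : set (A^c)^o := [set y | exists r : arrow Q -> A, y = \sum_c arr c * r c].
have hS : submodule S.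
  split; first by exists (fun=> 0); rewrite big1 // => c _; rewrite mulr0.
  - move=> _ _ [r ->] [r' ->]; exists (fun c => r c + r' c).
    by rewrite -[LHS](big_split) /=; apply: eq_bigr => c _; rewrite mulrDr.
  - move=> y _ [r ->]; exists (fun c => r c * (y : A)).
    by rewrite [LHS]mulr_suml; apply: eq_bigr => c _; rewrite mulrA.
have uniq (r : arrow Q -> A) : \sum_c arr c * r c = 0 -> arr a * r a = 0.
  move=> r0; apply: (cf_eq0 H) => u s ns; apply/eqP/negPn/negP => ca.
  have [su [t st]] := cf_mull_neq0 H ns ca.
  have := congr1 (cf u s) r0; rewrite (cf0 H) (cf_sum H) (bigD1 a) //= big1 ?addr0.
    by move/eqP; rewrite (negPf ca).
  move=> c ca'; apply/eqP/negPn/negP => /(cf_mull_neq0 H ns)[_ [t' st']].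
  by move: ca'; rewrite st in st'; case: st' => ->; rewrite eqxx.
pose co (y : (A^c)^o) : A :=
  if pselect (exists r : arrow Q -> A, y = \sum_c arr c * r c) is left e
  then arr a * sval (cid e) a else 0.
have coE (r : arrow Q -> A) : co (\sum_c arr c * r c) = arr a * r a.
  rewrite /co; case: pselect => [e|[]]; last by exists r.
  case: cid => r' /= rr'; apply/eqP; rewrite -subr_eq0 -mulrBr; apply/eqP.
  apply: (uniq (fun c => r' c - r c)).
  by under eq_bigr do rewrite mulrBr; rewrite sumrB -rr' subrr.
have [|x xE] := @min_baer _ _ _ _ _ min 0%N S (fun y => eps (co y)) hS.
  split=> [_ _ [r ->] [r' ->]|y _ [r ->]].
    have -> : (\sum_c arr c * r c : (A^c)^o) + \sum_c arr c * r' c = \sum_c arr c * (r c + r' c).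
      by rewrite -big_split; apply: eq_bigr => c _; rewrite mulrDr.
    by rewrite !coE mulrDr [LHS](linearD eps).
  have -> : y *: (\sum_c arr c * r c : (A^c)^o) = \sum_c arr c * (r c * (y : A)).
    by rewrite [LHS]mulr_suml; apply: eq_bigr => c _; rewrite mulrA.
  by rewrite !coE mulrA -[RHS]linearZ.
have xarr c : rm x (arr c) = if c == a then eps (arr a) else 0.
  have cE : arr c = \sum_c' arr c' * (c' == c)%:R.
    by rewrite (bigD1 c) //= eqxx mulr1 big1 ?addr0 // => c' /negPf ->; rewrite mulr0.
  rewrite -[LHS]xE; last by exists (fun c' => (c' == c)%:R).
  rewrite cE coE eq_sym; case: eqP => _; first by rewrite mulr1.
  by rewrite mulr0 linear0.
pose z := rm x (idm (src a)).
have zarr c : rm z (arr c) = if c == a then eps (arr a) else 0.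
  rewrite rmA /idm (el_mul H) /endp /=; have [e|ne] := eqVneq (src c) (src a).
    by rewrite -e -/(arr c) xarr.
  rewrite rm0r; case: eqP => // ca; by rewrite ca eqxx in ne.
apply: (@proj_socle_good 1%N _ (d 0%N z)) => //.
  split=> [|c]; first by rewrite -rm_lin rmA (idm_idm H).
  rewrite -rm_lin zarr; case: eqP => _; last by rewrite linear0.
  by apply/(min_exact0 min); exists (arr a).
apply/eqP => /(min_exact0 min)[y yE].
have [_ inj _ _ _] := min.
have ya : y * arr a = arr a.
  by apply: inj; rewrite -rm_reg rm_lin yE zarr eqxx.
have yb : y * arr b = 0.
  apply: inj; rewrite -rm_reg rm_lin yE zarr linear0.
  by case: eqP => // ba; case: nab.
have na := el_arrow H a; have nb := el_arrow H b.
have := @cf_mulr _ _ _ _ _ H (src a) [::] [:: a] y na.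
have := @cf_mulr _ _ _ _ _ H (src b) [::] [:: b] y nb.
rewrite /endp /= -/(arr a) -/(arr b) ya yb (cf0 H) (cf_el1 H na) -ab => <- /eqP.
by rewrite oner_eq0.
Qed.

Section DomDim2.
Hypotheses (p0 : projective_module (I 0%N)) (p1 : projective_module (I 1%N)).

(** Since [up] is a tail of [uq], it can be followed by [b]; but the only way
    on from the source of [up] is through [a]. *)
Lemma fork_contra a b jp up p' jq uq y : src a = src b -> a <> b ->
  good_from el (endp (src a) (a :: p')) jp (up ++ a :: p') ->
  nz jq (uq ++ [:: b]) -> uq = y ++ up -> endp jp up = endp jq uq -> False.
Proof.
move=> ab nab [np _ _ pre] nq uqE e.
have [nup _] := nz_cat H np; rewrite uqE -catA in nq.
have [_ nb] := nz_cat H nq; have [nup' _] := nz_cat H nb.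
have jE : jp = endp jq y by apply: (nz_src_eq nup nup'); rewrite e uqE endp_cat.
rewrite -jE in nb; have [t /eqP] := pre _ nb.
by rewrite -catA eqseq_cat // eqxx /= => /eqP[].
Qed.

(** If two arrows leave a vertex, then it is good, so the paths that lead to
    it from the sources attached to the ends of two maximal paths, one through
    each arrow, are comparable. *)
Lemma no_fork (a b : arrow Q) : src a = src b -> a = b.
Proof.
move=> ab; apply: contrapT => nab.
have [p mp] := maximal_ex H (el_arrow H a); have [q mq] := maximal_ex H (el_arrow H b).
rewrite /= in mp mq.
have [jp [wp gp]] := maximal_good p0 mp; have [jq [wq gq]] := maximal_good p0 mq.
have [w0 [j0 g0]] := fork_good p1 ab nab.
have [np] := gp => _ /(_ _ _ mp.1 erefl)[up wpE] _.
have [nq] := gq => _ /(_ _ _ mq.1 erefl)[uq wqE] _.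
rewrite wpE in gp np; rewrite wqE in gq nq.
have [nup na] := nz_cat H np; have [nuq nb] := nz_cat H nq.
have [ep _] := nz_cons H na; have [eq _] := nz_cons H nb.
have [_ _ suf _] := g0; have [t tE] := suf _ _ nup ep.
have [t' tE'] := suf _ _ nuq (etrans eq (esym ab)).
have nqb : nz jq (uq ++ [:: b]) by have := nq; rewrite -cat1s catA => /(nz_cat H)[].
have npa : nz jp (up ++ [:: a]) by have := np; rewrite -cat1s catA => /(nz_cat H)[].
have e : endp jp up = endp jq uq by rewrite ep eq.
have tt : t ++ up = t' ++ uq by rewrite -tE -tE'.
have [le|/ltnW le] := leqP (size up) (size uq).
  have [y yE] := cat_suffix tt le.
  exact: (fork_contra ab nab gp nqb yE e).
have [y yE] := cat_suffix (esym tt) le.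
exact: (fork_contra (esym ab) (not_eq_sym nab) gq npa yE (esym e)).
Qed.

Lemma walk_comparable (v : vertex Q) s t : is_walk v s -> is_walk v t ->
  exists r, s = t ++ r \/ t = s ++ r.
Proof.
elim: s v t => [|a s IH] v t; first by exists t; right.
case: t => [|b t]; first by exists (a :: s); left.
rewrite /=; case/andP=> /eqP av ws /andP[/eqP bv wt].
have ab : b = a by apply: no_fork; rewrite av bv.
subst b; have [r [->|->]] := IH _ _ ws wt; exists r; auto.
Qed.

(** Prolong the arrow with the shorter maximal continuation to a maximal path.
    The other arrow has a continuation of the same length, and both end at the
    same good vertex. *)
Lemma no_join (a b : arrow Q) : tgt a = tgt b -> a = b.
Proof.
have sym (a1 b1 : arrow Q) p r : tgt a1 = tgt b1 -> maximal (src a1) (a1 :: p) ->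
    maximal (src b1) (b1 :: p ++ r) -> a1 = b1.
  move=> ab ma mb; have [j [w [_ _ suf _]]] := maximal_good p0 ma.
  have nb : nz (src b1) (b1 :: p) by have := mb.1; rewrite -cat_cons => /(nz_cat H)[].
  have [t tE] := suf _ _ ma.1 erefl.
  have [|t' tE'] := suf _ _ nb; first by rewrite /endp /= ab.
  have := etrans (esym tE) tE'; move/eqP; rewrite eqseq_cat; first by case/andP=> _ /eqP[].
  have := congr1 size (etrans (esym tE) tE'); rewrite !size_cat /=; lia.
move=> ab.
have [p mp] := maximal_ex H (el_arrow H a); have [q mq] := maximal_ex H (el_arrow H b).
rewrite /= in mp mq; have [_ np] := nz_cons H mp.1; have [_ nq] := nz_cons H mq.1.
have wq : is_walk (tgt a) q by rewrite ab; exact: (el_walk H nq).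
have [r [pE|qE]] := walk_comparable (el_walk H np) wq.
  by apply/esym/(sym b a q r) => //; rewrite -pE.
by apply: (sym a b p r) => //; rewrite -qE.
Qed.

Lemma end_comparable (v u : vertex Q) s t : is_walk v s -> is_walk u t -> endp v s = endp u t ->
  exists r, s = r ++ t \/ t = r ++ s.
Proof.
elim/last_ind: s t => [|s a IH]; first by move=> t _ _ _; exists t; right; rewrite cats0.
elim/last_ind => [_ _ _|t b _]; first by exists (rcons s a); left; rewrite cats0.
rewrite -!cats1 !is_walk_cat !endp_cat /= andbT => /andP[ws /eqP sa].
rewrite andbT => /andP[wt /eqP tb]; rewrite /endp /= => /no_join ab.
subst b; have [|r [->|->]] := IH _ ws wt; first by rewrite /endp -sa -tb.
  by exists r; left; rewrite catA.
by exists r; right; rewrite catA.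
Qed.

End DomDim2.
End Upper.

(** * The bound: following minimal relations around the quiver *)

Section Multiples.
Variables (K : fieldType) (A : falgType K) (Q : quiver).
Variables (el : vertex Q -> seq (arrow Q) -> A) (cf : vertex Q -> seq (arrow Q) -> A -> K).
Hypothesis H : presented el cf.

(** The part of [a] supported on the paths that begin with a given path is a
    right multiple of that path. *)
Lemma left_part (v : vertex Q) p a : exists b, forall u s, nonzero el u s ->
  cf u s (el v p * b) =
    if (u == v) && (take (size p) s == p) then cf u s a else 0.
Proof.
move: a; apply: (el_ind H).
  by exists 0 => u s _; rewrite mulr0 (cf0 H); case: ifP.
move=> k u0 s0 x n0 [b bE].
have [/andP[/eqP uv /eqP sp]|ne] := boolP ((u0 == v) && (take (size p) s0 == p)).
  exists (k *: el (endp v p) (drop (size p) s0) + b) => u s ns.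
  rewrite mulrDr (cfD H) bE // -scalerAr -(el_cat H) -{1}sp cat_take_drop -uv.
  rewrite (cfD H); case: ifP => // h; rewrite addr0 (cfZ H) (cf_el H) //.
  case: eqP => [[us ss]|_]; last by rewrite mulr0.
  by rewrite -us -ss uv sp !eqxx in h.
exists b => u s ns; rewrite bE // (cfD H); case: ifP => // h.
rewrite (cfZ H) (cf_el H) //; case: eqP => [[us ss]|_]; last by rewrite mulr0 add0r.
by rewrite us ss h in ne.
Qed.

Lemma left_multiple (v : vertex Q) p a : vertex_idem el v * a = a ->
  (forall s, nonzero el v s -> cf v s a != 0 -> exists t, s = p ++ t) ->
  exists b, a = el v p * b.
Proof.
move=> va hp; have [b bE] := left_part v p a; exists b.
apply/eqP; rewrite -subr_eq0; apply/eqP/(cf_eq0 H) => u s ns; rewrite (cfB H) bE //.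
have [->|c] := eqVneq (cf u s a) 0; first by case: ifP; rewrite subrr.
have uv : u = v by move: c; rewrite -{1}va => /(cf_mull_neq0 H ns)[->].
subst u; have [t st] := hp s ns c.
by rewrite eqxx st take_size_cat // eqxx subrr.
Qed.

End Multiples.

Section Bound.
Variables (K : fieldType) (A : falgType K) (Q : quiver).
Variables (el : vertex Q -> seq (arrow Q) -> A) (cf : vertex Q -> seq (arrow Q) -> A -> K).
Hypothesis H : presented el cf.
Local Notation idm := (vertex_idem el).
Local Notation arr := (arrow_el el).
Local Notation nz := (nonzero el).
Local Notation maximal := (maximal_path el).
Local Notation good := (good_vertex el).
Local Notation socle := (socle_at el).

(** Minimal paths among those that vanish in [A]. *)
Definition minrel (c : vertex Q) (r : seq (arrow Q)) : Prop :=
  [/\ is_walk c r, el c r = 0, forall s t, r = s ++ t -> t != [::] -> nz c s &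
      forall s t, r = s ++ t -> s != [::] -> nz (endp c s) t].

(** Take a shortest vanishing initial segment of [s]. *)
Lemma minrel_ex c s a y : s = a :: y -> is_walk c s -> el c s = 0 -> nz (tgt a) y ->
  exists r, minrel c r.
Proof.
move=> sE ws s0 ny.
have ex : exists n, el c (take n s) == 0 by exists (size s); rewrite take_size s0.
case: (ex_minnP ex) => n /eqP n0 nmin.
have np : (0 < n)%N by case: n n0 {nmin} => // /eqP; rewrite take0 (negPf (el_nil H c)).
have ns : (n <= size s)%N by apply: nmin; rewrite take_size s0.
exists (take n s); split=> //.
- by move: ws; rewrite -{1}(cat_take_drop n s) is_walk_cat => /andP[].
- move=> s1 t1 e t1n; apply/negP => /eqP e0.
  have e1 := congr1 size e; rewrite size_cat size_takel // in e1.
  have s1E : s1 = take (size s1) s.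
    by rewrite -(cat_take_drop n s) e -catA take_size_cat.
  have := nmin (size s1); rewrite -s1E e0 eqxx => /(_ isT).
  by case: t1 t1n e1 {e} => //= ? ? _; lia.
- move=> s1 t1 e s1n; case: s1 s1n e => // b s1 _ e.
  have e2 : s = b :: (s1 ++ t1 ++ drop n s) by rewrite -{1}(cat_take_drop n s) e /= catA.
  move: e2; rewrite {1}sE => -[ab yE]; rewrite yE ab in ny.
  have [_ n1] := nz_cat H ny; have [] := nz_cat H n1.
  by rewrite /endp.
Qed.

Variables (I : nat -> lmodType A^c) (eps : {linear (A^c)^o -> I 0%N})
  (d : forall i, {linear I i -> I i.+1}).
Hypothesis min : minimal_injective_coresolution eps d.
Hypotheses (p0 : projective_module (I 0%N)) (p1 : projective_module (I 1%N)).

Local Notation comparable := (walk_comparable H min p0 p1).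
Local Notation ecomparable := (end_comparable H min p0 p1).
Local Notation nofork := (no_fork H min p0 p1).
Local Notation nojoin := (no_join H min p0 p1).

Lemma minrel_uniq c r r' : minrel c r -> minrel c r' -> r = r'.
Proof.
move=> [wr r0 lr _] [wr' r'0 lr' _].
have [t [rE|rE]] := comparable wr wr'; have [t0|tn] := eqVneq t [::].
- by rewrite rE t0 cats0.
- by have := lr _ _ rE tn; rewrite /nonzero r'0 eqxx.
- by rewrite rE t0 cats0.
- by have := lr' _ _ rE tn; rewrite /nonzero r0 eqxx.
Qed.

Lemma minrel_neq0 c r : minrel c r -> r != [::].
Proof.
by move=> [_ r0 _ _]; apply/eqP => rE; move: r0; rewrite rE => /eqP; rewrite (negPf (el_nil H c)).
Qed.

Lemma walk_src (c : vertex Q) s c' t : is_walk c (s ++ t) -> is_walk c' t -> t != [::] ->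
  c' = endp c s.
Proof.
rewrite is_walk_cat => /andP[_]; case: t => //= a t.
by move=> /andP[/eqP e1 _] /andP[/eqP <- _].
Qed.

Lemma minrel_inj c r c' r' : minrel c r -> minrel c' r' -> endp c r = endp c' r' -> c = c'.
Proof.
move=> hr hr' e; have rn := minrel_neq0 hr; have rn' := minrel_neq0 hr'.
move: hr hr' => [wr r0 _ rr] [wr' r'0 _ rr'].
have [t [rE|rE]] := ecomparable wr wr' e.
  have e1 := walk_src (etrans (congr1 (is_walk c) (esym rE)) wr) wr' rn'.
  have [t0|tn] := eqVneq t [::]; first by rewrite e1 t0.
  by have := rr _ _ rE tn; rewrite -e1 /nonzero r'0 eqxx.
have e1 := walk_src (etrans (congr1 (is_walk c') (esym rE)) wr') wr rn.
have [t0|tn] := eqVneq t [::]; first by rewrite e1 t0.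
by have := rr' _ _ rE tn; rewrite -e1 /nonzero r0 eqxx.
Qed.

Variables (v : vertex Q) (al : arrow Q).
Hypotheses (vbad : ~ good v) (al_src : src al = v).

(** Otherwise the relation ends with [al], and what precedes [al] is a maximal
    path ending at [v], which makes [v] good. *)
Lemma minrel_end c r : minrel c r -> endp c r != tgt al.
Proof.
move=> hr; apply/eqP => e; have := minrel_neq0 hr; case: hr.
case/lastP: r e => // r b e wr r0 lr _ _.
move: e; rewrite -cats1 endp_cat /endp /= => /nojoin ba; subst b.
have nr : nz c r by apply: (lr _ [:: al]); rewrite ?cats1.
have er : endp c r = v.
  by move: wr; rewrite -cats1 is_walk_cat /= andbT => /andP[_ /eqP]; rewrite al_src => ->.
apply: vbad; rewrite -er; apply: (maximal_good H min p0); split=> // b.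
have [<- //|ne] := eqVneq al b.
apply/eqP/negPn/negP => /(el_walk H); rewrite -cats1 is_walk_cat /= andbT.
case/andP=> _ /eqP sb; case/eqP: ne; apply: nofork.
by rewrite sb -[last _ _]/(endp c r) er.
Qed.

Definition minrel_at (c : vertex Q) : seq (arrow Q) :=
  if pselect (exists r, minrel c r) is left e then sval (cid e) else [::].

Lemma minrel_atP c : (exists r, minrel c r) -> minrel c (minrel_at c).
Proof. by rewrite /minrel_at; case: pselect => // e _; case: cid. Qed.

(** [res_state k] is the pair of the vertex of the [k]-th term of the minimal
    projective resolution of the simple module at [v] and of the path of its
    next differential, as long as minimal relations start at these vertices:
    each path is completed to a minimal relation by the next one. *)
Fixpoint res_state (k : nat) : vertex Q * seq (arrow Q) :=
  if k is k'.+1 then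
    (endp (res_state k').1 (res_state k').2, drop (size (res_state k').2) (minrel_at (res_state k').1))
  else (v, [:: al]).

Definition res_e k : A := idm (res_state k).1.
Definition res_x k : A := if k is k'.+1 then el (res_state k').1 (res_state k').2 else 0.

Lemma res_valid k : (forall i, (i < k)%N -> exists r, minrel (res_state i).1 r) ->
  nz (res_state k).1 (res_state k).2 /\ (res_state k).2 != [::].
Proof.
elim: k => [|k IH] hk /=; first by split=> //; rewrite -al_src; exact: (el_arrow H).
have [nk sk] := IH (fun i ik => hk i (leqW ik)).
have hr := minrel_atP (hk k (ltnSn k)); have [wr r0 lr rr] := hr.
have [t [rE|rE]] := comparable wr (el_walk H nk); last first.
  by move: nk; rewrite rE => /(nz_cat H)[]; rewrite /nonzero r0 eqxx.
have dE : drop (size (res_state k).2) (minrel_at (res_state k).1) = t by rewrite rE drop_size_cat.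
rewrite dE; split; first exact: rr rE sk.
by apply/eqP => t0; move: nk; rewrite /nonzero; move: r0; rewrite rE t0 cats0 => ->; rewrite eqxx.
Qed.

Lemma res_minrel k : (forall i, (i <= k)%N -> exists r, minrel (res_state i).1 r) ->
  minrel (res_state k).1 ((res_state k).2 ++ (res_state k.+1).2).
Proof.
move=> hk; have [nk sk] := res_valid (fun i ik => hk i (ltnW ik)).
have hr := minrel_atP (hk k (leqnn k)); have [wr r0 lr rr] := hr.
have [t [rE|rE]] := comparable wr (el_walk H nk); last first.
  by move: nk; rewrite rE => /(nz_cat H)[]; rewrite /nonzero r0 eqxx.
by rewrite /= [X in drop _ X]rE drop_size_cat // -rE.
Qed.

Lemma res_resolving m : (forall i, (i.+1 < m)%N -> exists r, minrel (res_state i).1 r) ->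
  resolving res_x res_e m.
Proof.
move=> hm; split=> //.
- by move=> k; exact: (idm_idm H).
- by move=> k _; exact: (idm_el1 H).
- by move=> k _; exact: (el_idm1 H).
- move=> [|k] km; first by rewrite mul0r.
  have [|_ r0 _ _] := @res_minrel k; last by rewrite -[RHS]r0 (el_cat H).
  by move=> i ik; apply: hm; apply: leq_ltn_trans km.
- move=> [//|k] a _ km xa.
  have hk i : (i <= k)%N -> exists r, minrel (res_state i).1 r.
    by move=> ik; apply: hm; apply: leq_ltn_trans km.
  have [wr r0 lr rr] := res_minrel hk.
  have [nk sk] := res_valid (fun i ik => hk i (ltnW ik)).
  apply: (left_multiple H); first by rewrite mulrA (idm_idm H).
  move=> s ns; rewrite (idm_cf H) // => c.
  have ps0 : el (res_state k).1 ((res_state k).2 ++ s) = 0.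
    apply/eqP/negPn/negP => n; have := cf_mull H a n.
    by rewrite -/(res_x k.+1) xa (cf0 H) => /esym/eqP; rewrite (negPf c).
  have ws : is_walk (res_state k).1 ((res_state k).2 ++ s).
    by rewrite is_walk_cat (el_walk H nk) (el_walk H ns).
  have [t [e|e]] := comparable ws wr.
    by exists t; move/eqP: e; rewrite -catA eqseq_cat // eqxx => /eqP.
  have [t0|tn] := eqVneq t [::]; last by have := lr _ _ e tn; rewrite /nonzero ps0 eqxx.
  by exists [::]; move/eqP: e; rewrite t0 !cats0 eqseq_cat // eqxx => /eqP ->.
Qed.

Lemma socle_at_v (M : lmodType A^c) (z : M) : rm z (idm v) = z -> rm z (arr al) = 0 ->
  socle v z.
Proof.
move=> zv za; split=> // a; rewrite -zv rmA /vertex_idem (el_mul H).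
case: eqP => [av|_]; last exact: rm0r.
have -> : a = al by apply: nofork; rewrite av al_src.
by have := za; rewrite -[in X in X -> _]zv rmA /vertex_idem (el_mul H) al_src eqxx.
Qed.

(** If no minimal relation starts at the [m]-th vertex, then left
    multiplication by the arrow from there is injective, and the [m]-th path
    without its first arrow is a nonzero class in degree [m.+1]. Then the
    simple module at [v] occurs in the socle of a projective-injective module. *)
Lemma minrel_res m : (forall i, (i < m)%N -> exists r, minrel (res_state i).1 r) ->
  projective_module (I m.+1) -> exists r, minrel (res_state m).1 r.
Proof.
move=> hm pm; apply: contrapT => nr.
have res : resolving res_x res_e m.+1 by exact: res_resolving.
have [nk sk] := res_valid hm.
case E: (res_state m).2 nk sk => [//|a y] nk _; have [cE ny] := nz_cons H nk.
have xE : res_x m.+1 = el (res_state m).1 (a :: y) by rewrite /= E.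
have eE : res_e m.+1 = idm (endp (tgt a) y) by rewrite /res_e /= E.
have [||b xb|[u yE]|z [z0 ze zx]] := ext_socle min res (y := el (tgt a) y).
- by [].
- by rewrite eE (el_idm1 H).
- apply: (cf_eq0 H) => u s ns; apply/eqP/negPn/negP => c.
  have [au [t sE]] := cf_mull_neq0 H ns c; subst u s.
  rewrite (cf_mull H) // in c.
  apply: nr; apply: (@minrel_ex _ (a :: y ++ t) a (y ++ t)) => //.
    by rewrite /= cE eqxx; exact: (el_walk H ns).
  apply/eqP/negPn/negP; rewrite -cat_cons => n; have := cf_mull H b n.
  by rewrite -xE xb (cf0 H) => /esym/eqP; rewrite (negPf c).
- have : cf (tgt a) y (u * el (res_state m).1 (a :: y)) != 0.
    by rewrite -xE -yE (cf_el1 H ny) oner_eq0.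
  by case/(cf_mulr_neq0 H ny) => s /(congr1 size); rewrite size_cat /=; lia.
apply: vbad; apply: (proj_socle_good H min pm) z0.
by apply: socle_at_v => //; move: zx; rewrite /= /arrow_el al_src.
Qed.

Lemma res_endp k : (forall i, (i <= k)%N -> exists r, minrel (res_state i).1 r) ->
  (res_state k.+2).1 = endp (res_state k).1 (minrel_at (res_state k).1).
Proof.
move=> hk; have h1 := res_minrel hk; have h2 := minrel_atP (hk k (leqnn k)).
by rewrite (minrel_uniq h2 h1) endp_cat.
Qed.

Variable n : nat.
Hypotheses (n2 : (2 <= n)%N) (nE : #|vertex Q| = n).

(** If all terms up to degree [2n-2] were projective then minimal relations
    would start at every vertex of the resolution, in particular at all vertices,
    and their end points would give an injective map on the vertices that misses
    the target of [al]. *)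
Lemma bad_bound : ~ (forall i, (i <= 2 * n - 2)%N -> projective_module (I i)).
Proof.
move=> pI.
have D k : (k <= 2 * n - 3)%N -> exists r, minrel (res_state k).1 r.
  elim/ltn_ind: k => k IH kn; apply: minrel_res => [i ik|].
    by apply: IH => //; lia.
  by apply: pI; lia.
pose psi c := endp c (minrel_at c).
have psi_inj c c' : (exists r, minrel c r) -> (exists r, minrel c' r) -> psi c = psi c' -> c = c'.
  by move=> /minrel_atP h /minrel_atP h'; exact: minrel_inj.
have psi_al c : (exists r, minrel c r) -> psi c <> tgt al.
  by move=> /minrel_atP h; apply/eqP; exact: minrel_end.
have stE k : (k <= 2 * n - 3)%N -> (res_state k.+2).1 = psi (res_state k).1.
  by move=> kn; apply: res_endp => i ik; apply: D; exact: leq_trans kn.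
pose t j := (res_state (2 * j).+1).1.
have tS j : (j.+1 < n)%N -> t j.+1 = psi (t j).
  move=> jn; rewrite /t -stE; last by lia.
  by congr (res_state _).1; lia.
have t0 : t 0%N = tgt al by [].
have Dt j : (j.+1 < n)%N -> exists r, minrel (t j) r by move=> jn; apply: D; lia.
have t_inj i j : (i < n)%N -> (j < n)%N -> t i = t j -> i = j.
  elim: i j => [|i IH] [|j] // i_n j_n.
  - by rewrite t0 tS // => /esym/psi_al; case; exact: Dt.
  - by rewrite t0 tS // => /psi_al; case; exact: Dt.
  - rewrite !tS // => /psi_inj e; congr _.+1; apply: IH; [exact: ltnW|exact: ltnW|].
    by apply: e; exact: Dt.
have t_surj c : exists2 j, (j < n)%N & t j = c.
  have inj : injective (fun i : 'I_n => t i) by move=> i j /t_inj e; apply: val_inj; exact: e.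
  have [|g _ gK] := inj_card_bij inj; first by rewrite nE card_ord.
  by exists (g c); [exact: ltn_ord|exact: gK].
have Dall c : exists r, minrel c r.
  have [j jn <-] := t_surj c; have [|jn1] := ltnP j.+1 n; first exact: Dt.
  have {jn jn1} -> : j = n.-1 by lia.
  have [[|i] i_n iv] := t_surj v.
    (* a loop at [v]: all paths from [v] end at [v] *)
    have loop s : is_walk v s -> endp v s = v.
      elim: s => //= a s IH /andP[/eqP av ws].
      have aa : a = al by apply: nofork; rewrite av al_src.
      by move: ws IH; rewrite aa /endp /= -t0 iv => ws; apply.
    have stv k : (k <= 3)%N -> (res_state k).1 = v.
      elim: k => // k IH k3 /=; rewrite IH; last exact: ltnW.
      apply: loop; have [|nk _] := @res_valid k; first by move=> i ik; apply: D; lia.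
      by move: (el_walk H nk); rewrite IH // ltnW.
    have e01 : t 0%N = t 1%N by rewrite /t !stv.
    by have := @t_inj 0%N 1%N (ltnW n2) n2 e01.
  have tk k : (k + i.+1 < n)%N -> (res_state (2 * k)).1 = t (k + i.+1)%N.
    elim: k => [|k IH] kn; first by rewrite add0n iv.
    rewrite addSn tS // -IH; last by lia.
    rewrite -stE; last by lia.
    by congr (res_state _).1; lia.
  have e : n.-1 = (n.-1 - i.+1 + i.+1)%N by lia.
  rewrite e -tk; last by lia.
  by apply: D; lia.
have psi_bij : bijective psi by apply: injF_bij => c c'; exact: psi_inj.
have [g _ gK] := psi_bij.
by apply: (psi_al (g (tgt al))) => //; exact: gK.
Qed.

End Bound.

Section BoundThm.
Variables (K : fieldType) (A : falgType K) (Q : quiver).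
Variables (el : vertex Q -> seq (arrow Q) -> A) (cf : vertex Q -> seq (arrow Q) -> A -> K).
Hypothesis H : presented el cf.

Lemma coresolution_bound (I : nat -> lmodType A^c) (eps : {linear (A^c)^o -> I 0%N})
    (d : forall i, {linear I i -> I i.+1}) n :
  minimal_injective_coresolution eps d -> (2 <= n)%N -> #|vertex Q| = n ->
  ~ selfinjective A -> exists2 i, (i <= 2 * n - 2)%N & ~ projective_module (I i).
Proof.
move=> min n2 nE nself; apply: contrapT => no.
have pI i : (i <= 2 * n - 2)%N -> projective_module (I i).
  by move=> i_n; apply: contrapT => np; apply: no; exists i.
have p0 : projective_module (I 0%N) by apply: pI; lia.
have p1 : projective_module (I 1%N) by apply: pI; lia.
apply: nself; apply: baer_injective; apply: (all_good_baer H) => v.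
apply: contrapT => vbad.
case: (pselect (exists al : arrow Q, src al = v)) => [[al av]|nal].
  exact: (bad_bound H min p0 p1 vbad av n2 nE).
apply: vbad; apply: (maximal_good H min p0 (v := v) (s := [::])); split.
  exact: (nz_nil H).
move=> a; apply/eqP/negPn/negP => /(nz_cons H)[va _]; apply: nal.
by exists a.
Qed.

End BoundThm.

(** * Simple modules *)

Lemma isomorphic_sym (R : nzRingType) (M N : lmodType R) : isomorphic M N -> isomorphic N M.
Proof.
move=> [f [g fg gf]]; have [||h hE] := @linear_pack _ _ _ g.
- by move=> x y; rewrite -{1}(gf x) -{1}(gf y) -linearD fg.
- by move=> a x; rewrite -{1}(gf x) -linearZ fg.
by exists h; exists f => x; rewrite hE.
Qed.

Lemma isomorphic_trans (R : nzRingType) (M N P : lmodType R) :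
  isomorphic M N -> isomorphic N P -> isomorphic M P.
Proof.
move=> [f [f' ff' f'f]] [g [g' gg' g'g]]; have [h hE] := linear_comp_ex f g.
by exists h; exists (f' \o g') => x; rewrite hE /= ?gg' ?ff' ?f'f ?g'g.
Qed.

Lemma has_n_simples_uniq (A : nzRingType) n m : has_n_simples A n -> has_n_simples A m -> n = m.
Proof.
have le n1 n2 : has_n_simples A n1 -> has_n_simples A n2 -> (n1 <= n2)%N.
  move=> [S [simS injS _]] [S' [_ _ surj]].
  pose g i := sval (cid (surj _ (simS i))).
  have gP i : isomorphic (S i) (S' (g i)) by rewrite /g; case: cid.
  have g_inj : injective g.
    move=> i j e; apply: injS; apply: isomorphic_trans (gP i) _.
    by rewrite e; exact: isomorphic_sym (gP j).
  by have := leq_card g g_inj; rewrite !card_ord.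
by move=> hn hm; apply/eqP; rewrite eqn_leq !le.
Qed.

Section Simples.
Variables (K : fieldType) (A : falgType K) (Q : quiver).
Variables (el : vertex Q -> seq (arrow Q) -> A) (cf : vertex Q -> seq (arrow Q) -> A -> K).

Definition simple_at (H : presented el cf) (v : vertex Q) : Type := K.

Variable H : presented el cf.
HB.instance Definition _ v := GRing.Zmodule.on (simple_at H v).

Section OneVertex.
Variable v : vertex Q.
Local Notation chi := (vertex_char cf v).

Definition simple_scale (a : A^c) (x : simple_at H v) : simple_at H v :=
  (chi a * (x : K) : K).

Fact simple_scaleA a b x : simple_scale a (simple_scale b x) = simple_scale (a * b) x.
Proof. by rewrite /simple_scale mulrA (chiM H) [chi b * _]mulrC. Qed.
Fact simple_scale1 : left_id 1 simple_scale.
Proof. by move=> x; rewrite /simple_scale (chi1 H) mul1r. Qed.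
Fact simple_scaleDr : right_distributive simple_scale +%R.
Proof. by move=> a x y; exact: mulrDr. Qed.
Fact simple_scaleDl (x : simple_at H v) : {morph simple_scale^~ x : a b / a + b}.
Proof. by move=> a b; rewrite /simple_scale /vertex_char (cfD H) mulrDl. Qed.

HB.instance Definition _ := GRing.Zmodule_isLmodule.Build A^c (simple_at H v)
  simple_scaleA simple_scale1 simple_scaleDr simple_scaleDl.

Lemma simple_rm (x : simple_at H v) a : rm x a = (chi a * (x : K) : K).
Proof. by []. Qed.

Lemma chiK k : chi k%:A = k.
Proof. by rewrite /vertex_char (cfZ H) -/(vertex_char cf v 1) (chi1 H) mulr1. Qed.

Lemma simple_atP : simple_module (simple_at H v : lmodType A^c).
Proof.
split; first by exists (1 : K); exact: oner_neq0.
move=> S [S0 SD SZ]; case: (pselect (exists2 x, S x & x != 0)) => [[x Sx x0]|no]; [right|left].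
  apply/seteqP; split=> // y _; have := SZ ((((y : K) / x)%:A : A) : A^c) x Sx.
  by rewrite -[X in S X]/(chi ((y : K) / x)%:A * (x : K) : K) chiK divfK.
apply/seteqP; split=> [x Sx|_ ->] //=; apply/eqP/negPn/negP => x0.
by apply: no; exists x.
Qed.

End OneVertex.

Lemma simple_at_inj u v :
  isomorphic (simple_at H u : lmodType A^c) (simple_at H v : lmodType A^c) -> u = v.
Proof.
move=> [f [g fg _]]; pose x1 : simple_at H u := (1 : K).
have xu : rm x1 (vertex_idem el u) = x1.
  by rewrite simple_rm /vertex_char (cf_el1 H) ?(nz_nil H) // mul1r.
have fx0 : f x1 != 0.
  apply/eqP => e; have := fg x1; rewrite e -(linear0 f) fg => /esym/eqP.
  by apply/negP; exact: oner_neq0.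
have := rm_lin f x1 (vertex_idem el u); rewrite xu simple_rm /vertex_char (cf_el H _ _ (nz_nil H v)).
rewrite xpair_eqE eqxx andbT; case: eqP => // _ /eqP; rewrite mul0r.
by rewrite (negPf fx0).
Qed.

(** A longest path that acts nontrivially on [M] produces a socle element. *)
Lemma simple_classify (M : lmodType A^c) : simple_module M ->
  exists v, isomorphic M (simple_at H v : lmodType A^c).
Proof.
move=> [[m0 m0n] simM]; have [L hL] := el_long H.
pose P n := exists (m : M) u s, size s = n /\ rm m (el u s) != 0.
have [u u0] : exists u, rm m0 (vertex_idem el u) != 0.
  apply: contrapT => no; case/eqP: m0n; rewrite [m0](rm_sum_idm H) big1 // => u _.
  by apply/eqP/negPn/negP => h; apply: no; exists u.
have [||n [m [u1 [s [sn ms]]]] nmax] := @bounded_max P 0 L.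
- by exists m0, u, [::].
- move=> n [m [u1 [s [<- ms]]]]; rewrite leqNgt; apply/negP => /ltnW Ls.
  by rewrite hL ?rm0r ?eqxx in ms.
pose v := endp u1 s; pose z := rm m (el u1 s).
have hz : socle_at el v z.
  split=> [|a]; first by rewrite rmA (el_idm1 H).
  apply/eqP/negPn/negP => za; suff : (n.+1 <= n)%N by rewrite ltnn.
  apply: nmax; exists m, u1, (rcons s a).
  rewrite size_rcons sn; split=> //; move: za; rewrite rmA (el_mul H) -cats1.
  by case: (src a =P endp u1 s) => // _; rewrite rm0r eqxx.
have zE k a : rm (rm z k%:A) a = rm z (vertex_char cf v a * k)%:A.
  rewrite rmA -scalerAl mul1r rmZ (socle_act H a hz) -rmZ scalerA mulrC //.
have [|/(congr1 (fun S : set M => S z)) e|/seteqP[_ all]] := simM [set x | exists k, x = rm z k%:A].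
- split; first by exists 0; rewrite scale0r rm0r.
    by move=> _ _ [k ->] [l ->]; exists (k + l); rewrite scalerDl rmDr.
  by move=> a _ [k ->]; exists (vertex_char cf v a * k); exact: zE.
- have : [set 0] z by rewrite -e /=; exists 1; rewrite scale1r rm1.
  by move=> z0; rewrite -/z z0 eqxx in ms.
have z_inj k l : rm z k%:A = rm z l%:A -> k = l.
  move=> /eqP; rewrite -subr_eq0 -rmBr -scalerBl => /eqP e; apply/eqP; rewrite -subr_eq0.
  apply/negPn/negP => kl; case/eqP: ms; rewrite -/z.
  have -> : z = rm (rm z (k - l)%:A) (k - l)^-1%:A by rewrite -rmZ scalerA mulVf // scale1r rm1.
  by rewrite e rm0l.
pose f x : simple_at H v := sval (cid (all x I)).
have fE x : x = rm z (f x : K)%:A by rewrite /f; case: cid.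
have [||h hE] := @linear_pack _ M (simple_at H v) f.
- by move=> x y; apply: z_inj; rewrite -fE scalerDl rmDr -!fE.
- move=> a x; apply: z_inj; rewrite -fE -[a *: f x]/(vertex_char cf v a * (f x : K) : K).
  by rewrite -zE -fE.
exists v, h; exists (fun k : simple_at H v => rm z (k : K)%:A) => x; rewrite hE -?fE //.
by apply: z_inj; rewrite -fE.
Qed.

Lemma presented_simples : has_n_simples A #|vertex Q|.
Proof.
exists (fun i => simple_at H (enum_val i) : lmodType A^c); split.
- by move=> i; exact: simple_atP.
- by move=> i j /simple_at_inj/enum_val_inj.
- move=> M /simple_classify[v hv]; exists (enum_rank v).
  by rewrite enum_rankK.
Qed.

End Simples.

(** * Finite-dimensional quotients of path algebras by paths *)

Record pathset (Q : quiver) := Pathset {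
  ps_seq : seq (qpath Q);
  ps_closed : subpath_closed (fun p => p \in ps_seq);
  ps_short : forall p, (size (arrows p) < 2)%N -> p \in ps_seq;
  ps_vertex : vertex Q }.

(** The algebra with basis a set of paths that is closed under subpaths. *)
Definition path_quotient (K : fieldType) (Q : quiver) (P : pathset Q) : Type :=
  {ffun seq_sub (ps_seq P) -> K^o}.
HB.instance Definition _ K Q P := Vector.on (@path_quotient K Q P).

Section PathQuotient.
Variables (K : fieldType) (Q : quiver) (P : pathset Q).
Local Notation B := (path_quotient K P).
Local Notation PA := (path_algebra K Q).

Definition pq_proj (y : PA) : B := [ffun b => pcoef (ssval b) y].
Definition pq_lift (x : B) : PA := \sum_b (x b : K) *: of_path K (ssval b).

Let V : set PA := [set x | forall p, p \in ps_seq P -> pcoef p x = 0].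

Let V_ideal : two_sided_ideal V.
Proof. exact: (vanish_ideal K (@ps_closed _ P)). Qed.

Lemma pq_projD x y : pq_proj (x + y) = pq_proj x + pq_proj y.
Proof. by apply/ffunP => b; rewrite !ffunE pcoefD. Qed.

Lemma pq_projZ k x : pq_proj (k *: x) = k *: pq_proj x.
Proof. by apply/ffunP => b; rewrite !ffunE pcoefZ. Qed.

Lemma pq_proj0 x : pq_proj x = 0 <-> V x.
Proof.
split=> [x0 p Pp|Vx]; last by apply/ffunP => b; rewrite !ffunE Vx // ssvalP.
by have /ffunP/(_ (SeqSub Pp)) := x0; rewrite !ffunE.
Qed.

Lemma pq_proj_eq x y : V (x - y) -> pq_proj x = pq_proj y.
Proof. by move=> /pq_proj0 h; rewrite -(subrK y x) pq_projD h add0r. Qed.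

Lemma pq_liftK x : pq_proj (pq_lift x) = x.
Proof.
apply/ffunP => b; rewrite ffunE pcoef_sum (bigD1 b) //= big1 => [|c cb].
  by rewrite pcoefZ pcoef_path eqxx mulr1 addr0.
rewrite pcoefZ pcoef_path; case: eqP => [/val_inj e|_]; last exact: mulr0.
by rewrite e eqxx in cb.
Qed.

Lemma pq_projK y : V (y - pq_lift (pq_proj y)).
Proof.
apply/pq_proj0; rewrite -scaleN1r pq_projD pq_projZ pq_liftK scaleN1r.
by rewrite subrr.
Qed.

(** The multiplication of the quotient ring, computed with the linear section
    [pq_lift]. *)
Definition pq_mul (x y : B) : B := pq_proj (pq_lift x * pq_lift y).
Definition pq_one : B := pq_proj 1.

Lemma pq_projM x y : pq_proj (x * y) = pq_mul (pq_proj x) (pq_proj y).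
Proof.
have [_ VD Vl Vr] := V_ideal; apply: pq_proj_eq.
set x' := pq_lift _; set y' := pq_lift _.
have -> : x * y - x' * y' = (x - x') * y + x' * (y - y').
  by rewrite mulrBl mulrBr addrA subrK.
by apply: VD; [apply: Vr; exact: pq_projK|apply: Vl; exact: pq_projK].
Qed.

Fact pq_mulA : associative pq_mul.
Proof. by move=> x y z; rewrite -[x]pq_liftK -[y]pq_liftK -[z]pq_liftK -!pq_projM mulrA. Qed.
Fact pq_mul1 : left_id pq_one pq_mul.
Proof. by move=> x; rewrite -[x]pq_liftK -pq_projM mul1r. Qed.
Fact pq_mulr1 : right_id pq_one pq_mul.
Proof. by move=> x; rewrite -[x]pq_liftK -pq_projM mulr1. Qed.
Fact pq_mulDl : left_distributive pq_mul +%R.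
Proof.
move=> x y z; rewrite -[x]pq_liftK -[y]pq_liftK -[z]pq_liftK.
by rewrite -pq_projD -!pq_projM mulrDl pq_projD.
Qed.
Fact pq_mulDr : right_distributive pq_mul +%R.
Proof.
move=> x y z; rewrite -[x]pq_liftK -[y]pq_liftK -[z]pq_liftK.
by rewrite -pq_projD -!pq_projM mulrDr pq_projD.
Qed.
Fact pq_one_neq0 : pq_one != 0.
Proof.
have tP : trivial_path (ps_vertex P) \in ps_seq P by exact: ps_short.
apply/eqP => /pq_proj0/(_ _ tP).
rewrite -[1]/(path_one K Q) path_one.unlock pcoef_sum (bigD1 (ps_vertex P)) //= big1.
  by rewrite pcoef_path eqxx addr0 => /eqP; rewrite oner_eq0.
move=> v vn; rewrite pcoef_path; case: eqP => // /(congr1 (@start Q)) e.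
by rewrite [v]e eqxx in vn.
Qed.

HB.instance Definition _ := GRing.Zmodule_isNzRing.Build B
  pq_mulA pq_mul1 pq_mulr1 pq_mulDl pq_mulDr pq_one_neq0.

Lemma pq_mulE (x y : B) : x * y = pq_mul x y. Proof. by []. Qed.

Fact pq_scaleAl (k : K) (x y : B) : k *: (x * y) = (k *: x) * y.
Proof.
rewrite -[x]pq_liftK -[y]pq_liftK !pq_mulE -!pq_projM -!pq_projZ -pq_projM.
by congr pq_proj; exact/esym/path_mulZl.
Qed.
HB.instance Definition _ := GRing.Lmodule_isLalgebra.Build K B pq_scaleAl.

Fact pq_scaleAr (k : K) (x y : B) : k *: (x * y) = x * (k *: y).
Proof.
rewrite -[x]pq_liftK -[y]pq_liftK !pq_mulE -!pq_projM -!pq_projZ -pq_projM.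
by congr pq_proj; exact/esym/path_mulZr.
Qed.
HB.instance Definition _ := GRing.Lalgebra_isAlgebra.Build K B pq_scaleAr.
HB.instance Definition _ := Algebra_isFalgebra.Build K B.

Lemma pq_morphism : exists f : {rmorphism PA -> B}, forall x, f x = pq_proj x.
Proof.
have fB : zmod_morphism pq_proj.
  by move=> x y; rewrite -scaleN1r pq_projD pq_projZ scaleN1r.
have fM : monoid_morphism pq_proj by split=> // x y; rewrite pq_projM.
pose f : {rmorphism PA -> B} := HB.pack pq_proj
  (GRing.isZmodMorphism.Build _ _ _ fB) (GRing.isMonoidMorphism.Build _ _ _ fM).
by exists f.
Qed.

Definition pq_zero : set (qpath Q) := [set p | p \notin ps_seq P].

Lemma pq_kernel x : V x <-> ideal_gen [set of_path K p | p in pq_zero] x.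
Proof.
split; last first.
  apply: ideal_gen_min => // _ [p /negP pP <-] q qP; rewrite pcoef_path.
  by case: eqP => // pq; case: pP; rewrite pq.
move=> Vx; have [I0 ID Il _] := ideal_gen_ideal [set of_path K p | p in pq_zero].
rewrite [x]path_algebraE; elim: (X in \sum_(p <- X) _) => [|p s IH].
  by rewrite big_nil.
rewrite big_cons; apply: ID => //.
have [pP|pP] := boolP (p \in ps_seq P); first by rewrite [(coeffs x)@_p](Vx _ pP) scale0r.
rewrite -[of_path K p]mul1r -[_ *: _]path_mulZl; apply: Il.
by apply: ideal_gen_sub; exists p.
Qed.

Lemma pq_admissible : admissible (ideal_gen [set of_path K p | p in pq_zero]).
Proof.
split; first exact: ideal_gen_ideal.
  apply: ideal_gen_min; first exact: ideal_gen_ideal.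
  move=> _ [p pP <-]; apply: long_path_power => //.
  by rewrite leqNgt; apply: contra pP => /ps_short.
exists (\max_(p <- ps_seq P) size (arrows p)).+2 => // x Jx; apply/pq_kernel => p pP.
apply: (ideal_power_shortless Jx); rewrite ltnS; apply: leqW.
exact: leq_bigmax_seq.
Qed.

Lemma pq_iso_quotient (f : {rmorphism PA -> B}) : (forall x, f x = pq_proj x) ->
  [/\ scalable f, forall a, exists x, f x = a &
      ideal_gen [set of_path K p | p in pq_zero] = [set x | f x = 0]].
Proof.
move=> fE; split.
- by move=> k x; rewrite !fE pq_projZ.
- by move=> a; exists (pq_lift a); rewrite fE pq_liftK.
- by apply/seteqP; split=> x; rewrite /= fE => h; [apply/pq_proj0/pq_kernel|apply/pq_kernel/pq_proj0].
Qed.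

Lemma pq_presented : exists (el : vertex Q -> seq (arrow Q) -> B) cf, presented el cf /\
  forall v s, el v s != 0 <-> exists w : is_walk v s, mkpath w \in ps_seq P.
Proof.
have [f fE] := pq_morphism; have [fZ fsurj fker] := pq_iso_quotient fE.
exists (path_img f), (path_crd fsurj); split.
  exact: presented_quotient fZ fsurj _ pq_admissible fker.
move=> v s; case: (pselect (is_true (is_walk v s))) => [w|nw]; last first.
  by split=> [|[w]]; [rewrite path_img0 ?eqxx //; exact/negP|case: (nw w)].
rewrite (path_imgE _ w) fE; split=> [n0|[w' wP]].
  exists w; apply/negPn/negP => wP; case/eqP: n0; apply/pq_proj0 => p pP.
  by rewrite pcoef_path; case: eqP => // e; rewrite e pP in wP.
apply/eqP => /pq_proj0/(_ _ wP)/eqP; rewrite pcoef_path.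
by rewrite (_ : mkpath w = mkpath w') ?eqxx ?oner_eq0 //; exact: val_inj.
Qed.

Lemma pq_monomial : connected_algebra B -> monomial_algebra B /\ quiver_algebra B.
Proof.
move=> conn; have [f fE] := pq_morphism; have [fZ fsurj fker] := pq_iso_quotient fE.
have iso : iso_quotient B (ideal_gen [set of_path K p | p in pq_zero]) by exists f.
split; split=> //; first by exists Q, pq_zero; split=> //; exact: pq_admissible.
exists Q, (ideal_gen [set of_path K p | p in pq_zero]); split=> //.
exact: pq_admissible.
Qed.

End PathQuotient.

(** * Indecomposable projective modules *)

Section Uniserial.
Variables (R : nzRingType) (T : finType) (e : T -> R) (F : nat -> R -> Prop) (L : nat).
Hypotheses (e1 : \sum_v e v = 1) (ee : forall v, e v * e v = e v) (e0 : forall v, e v != 0).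
(** The filtration by the powers of the nilpotent ideal [F 1]. *)
Hypotheses (F0 : forall a, F 0 a) (F_0 : forall k, F k 0)
  (FD : forall k a b, F k a -> F k b -> F k (a + b))
  (FM : forall k a b, F k a -> F 1 b -> F k.+1 (a * b)) (FL : forall a, F L a -> a = 0).
Hypothesis unit_ex : forall u v r, ~ F 1 (e u * r * e v) -> exists s, s * (e u * r * e v) = e v.
Hypothesis chain : forall v a b, a * e v = a -> b * e v = b ->
  (exists r, a = r * b) \/ (exists r, b = r * a).

(** By a dual basis some linear form into some [R * e v] takes a value outside
    the nilpotent ideal [F 1]; it splits, so the module is [R * e v]. *)
Lemma uniserial_projective (P : lmodType R) :
  finitely_generated P -> projective_module P -> indecomposable_module P ->
  uniserial_module P.
Proof.
move=> fP pP [[x0 x0n] ind].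
have [k [g [s dual]]] := projective_dual_basis fP pP.
have sZ a x j : s (a *: x) j = a * (s x j : R) by rewrite linearZ ffunE.
have sD x y j : s (x + y) j = s x j + s y j by rewrite linearD ffunE.
have F_sum I (r : seq I) n (f : I -> R) : (forall i, F n (f i)) -> F n (\sum_(i <- r) f i).
  by move=> h; elim/big_ind: _ => // a b; exact: FD.
have [u [v [j [l]]]] : exists u v j l, ~ F 1 (e u * (s (g l) j : R) * e v).
  apply: contrapT => no.
  have F1 l j : F 1 (s (g l) j).
    rewrite -[s _ _]mul1r -[1 * _]mulr1 -e1 mulr_sumr; apply: (F_sum) => v.
    rewrite mulr_suml mulr_suml; apply: (F_sum) => u; apply: contrapT => nF.
    by apply: no; exists u, v, j, l.
  case/eqP: x0n; suff [c [cL ->]] : exists c : 'I_k -> R, (forall i, F L (c i)) /\ x0 = \sum_i c i *: g i.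
    by rewrite big1 // => a _; rewrite (FL (cL a)) scale0r.
  elim: L => [|n [c [cn ->]]]; first by exists (s x0); split; [move=> a; exact: F0|exact: dual].
  exists (fun j => \sum_i c i * (s (g i) j : R)); split=> [a|].
    by apply: (F_sum) => b; exact: FM.
  under eq_bigr => a _ do rewrite (dual (g a)) scaler_sumr.
  rewrite exchange_big; apply: eq_bigr => a _; rewrite scaler_suml.
  by apply: eq_bigr => b _; rewrite scalerA.
move/unit_ex => [t tE].
pose th x : R := (s x j : R) * e v; pose q : P := e v *: (t *: (e u *: g l)).
have thZ a x : th (a *: x) = a * th x by rewrite /th sZ mulrA.
have thD x y : th (x + y) = th x + th y by rewrite /th sD mulrDl.
have thq : th q = e v by rewrite /q !thZ /th [e u * (_ * _)]mulrA tE ee.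
have the x : th x * e v = th x by rewrite /th -mulrA ee.
have evq a : a * e v *: q = a *: q by rewrite /q scalerA [RHS]scalerA -mulrA ee.
pose S : set P := [set x | th x = 0]; pose U : set P := [set x | exists a : R, x = a *: q].
have hS : submodule S.
  split; rewrite /S /=; first by rewrite -(scale0r q) thZ mul0r.
    by move=> x y hx hy; rewrite thD hx hy addr0.
  by move=> a x hx; rewrite thZ hx mulr0.
have [|x|S0|U0] := ind S U hS (submodule_cyclic q).
- apply/seteqP; split=> [x [Sx [a xE]]|_ ->].
    have : th x = 0 by []; rewrite xE thZ thq => h.
    by rewrite /= -evq h scale0r.
  by split; [case: hS|exists 0; rewrite scale0r].
- exists (x - th x *: q); last by exists (th x *: q); [exists (th x)|rewrite subrK].
  by rewrite /S /= thD -scaleNr thZ thq mulNr the subrr.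
- have gen x : x = th x *: q.
    have : S (x - th x *: q) by rewrite /S /= thD -scaleNr thZ thq mulNr the subrr.
    by rewrite S0 => /eqP; rewrite subr_eq0 => /eqP.
  have cmp (x y : P) : (exists r : R, x = r *: y) \/ (exists r : R, y = r *: x).
    by have [[r rE]|[r rE]] := chain (the x) (the y); [left|right]; exists r;
       rewrite [LHS]gen rE -scalerA -gen.
  move=> S1 S2 [_ _ S1Z] [_ _ S2Z].
  case: (pselect (exists2 x, S1 x & ~ S2 x)) => [[x x1 x2]|no]; [right|left].
    move=> y y2; have [[r xy]|[r ->]] := cmp x y; last exact: S1Z.
    by case: x2; rewrite xy; exact: S2Z.
  by move=> x x1; apply: contrapT => x2; apply: no; exists x.
- have : U q by exists 1; rewrite scale1r.
  rewrite U0 => q0; have := thq; rewrite q0 -(scale0r q) thZ mul0r => /esym/eqP.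
  by rewrite (negPf (e0 v)).
Qed.

End Uniserial.

Section RightMultiples.
Variables (K : fieldType) (A : falgType K) (Q : quiver).
Variables (el : vertex Q -> seq (arrow Q) -> A) (cf : vertex Q -> seq (arrow Q) -> A -> K).
Hypothesis H : presented el cf.

Lemma right_multiple (v : vertex Q) p a :
  (forall u s, nonzero el u s -> cf u s a != 0 -> exists2 t, s = t ++ p & endp u t = v) ->
  exists b, a = b * el v p.
Proof.
move=> hp; have [b bE] : exists b, forall u s, nonzero el u s -> cf u s (b * el v p) =
    if `[< exists2 t, s = t ++ p & endp u t = v >] then cf u s a else 0.
  move: {hp} a; apply: (el_ind H).
    by exists 0 => u s _; rewrite mul0r (cf0 H); case: ifP.
  move=> k u0 s0 x n0 [b bE].
  case: (pselect (exists2 t, s0 = t ++ p & endp u0 t = v)) => [[t sE tv]|no].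
    exists (k *: el u0 t + b) => u s ns.
    rewrite mulrDl (cfD H) bE // -scalerAl -tv -(el_cat H) -sE.
    rewrite (cfD H); case: asboolP => // h; rewrite addr0 (cfZ H) (cf_el H) //.
    case: eqP => [[us ss]|_]; last by rewrite mulr0.
    by case: h; exists t; rewrite -?ss -?us.
  exists b => u s ns; rewrite bE // (cfD H); case: asboolP => // h.
  rewrite (cfZ H) (cf_el H) //; case: eqP => [[us ss]|_]; last by rewrite mulr0 add0r.
  by case: no; rewrite us ss.
exists b; apply/eqP; rewrite -subr_eq0; apply/eqP/(cf_eq0 H) => u s ns.
rewrite (cfB H) bE //; case: asboolP => [_|h]; first exact: subrr.
rewrite subr0; apply/eqP/negPn/negP => c; apply: h.
exact: hp.
Qed.

End RightMultiples.

(** * A Nakayama algebra that attains the bound *)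

Section Cycle.
Variable m : nat.
Local Notation N := m.+2.

Definition cyc : quiver := @Quiver 'I_N 'I_N id (@ordS N).

Definition cwalk (v : 'I_N) (l : nat) : seq 'I_N := traject (@ordS N) v l.

Lemma is_walk_cyc (v : vertex cyc) (s : seq (arrow cyc)) :
  is_walk v s = (s == cwalk v (size s)).
Proof.
elim: s v => //= a s IH v; rewrite IH eqseq_cons.
by case: eqP => // ->.
Qed.

Lemma cwalk_walk (v : vertex cyc) l : is_walk v (cwalk v l : seq (arrow cyc)).
Proof. by rewrite is_walk_cyc size_traject. Qed.

Lemma endp_cwalk (v : vertex cyc) l : endp v (cwalk v l : seq (arrow cyc)) = iter l (@ordS N) v.
Proof. by elim: l v => // l IH v; rewrite iterSr -IH. Qed.

Lemma cwalk_cat v k l : cwalk v (k + l) = cwalk v k ++ cwalk (iter k (@ordS N) v) l.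
Proof. exact: trajectD. Qed.

Lemma val_iter (v : 'I_N) l : iter l (@ordS N) v = ((v + l) %% N)%N :> nat.
Proof.
elim: l => [|l IH]; first by rewrite addn0 modn_small.
by rewrite iterS /= IH -addn1 modnDml addn1 addnS.
Qed.

Lemma iterN (v : 'I_N) : iter N (@ordS N) v = v.
Proof. by apply: val_inj; rewrite [LHS]val_iter modnDr modn_small. Qed.

Lemma shift_inj l : injective (iter l (@ordS N)).
Proof. by elim: l => // l IH u v /(can_inj (@ordSK N))/IH. Qed.

Lemma iter0_small l : (l < N)%N -> iter l (@ordS N) ord0 = l :> nat.
Proof. by move=> lN; rewrite val_iter add0n modn_small. Qed.

(** The nonzero paths: those with at most [N] arrows, except the path with [N]
    arrows from the vertex [0] to itself; the indecomposable projective modules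
    have length [N] at the vertex [0] and [N + 1] at the other vertices. *)
Definition okpath (v : 'I_N) (l : nat) : bool := (l < N)%N || ((l == N) && (v != ord0)).

Definition cyc_paths : seq (qpath cyc) :=
  [seq p : qpath cyc <- [seq mkpath (cwalk_walk v l) | v <- enum 'I_N, l <- iota 0 N.+1]
    | okpath (start p) (size (arrows p))].

Lemma mem_cyc_paths (p : qpath cyc) : (p \in cyc_paths) = okpath (start p) (size (arrows p)).
Proof.
rewrite mem_filter; case ok: (okpath _ _); rewrite ?andTb //.
have sz : (size (arrows p) <= N)%N by case/orP: ok => [/ltnW //|/andP[/eqP ->]].
apply/allpairsPdep; exists (start p), (size (arrows p)); split.
- by rewrite mem_enum.
- by rewrite mem_iota /= ltnS.
- apply: qpath_inj => //; have := valP p; rewrite is_walk_cyc => /eqP.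
  by rewrite /arrows /= => <-.
Qed.

Lemma okpath_le v l : okpath v l -> (l <= N)%N.
Proof. by case/orP => [/ltnW //|/andP[/eqP ->]]. Qed.

Lemma cyc_paths_closed : subpath_closed (fun p => p \in cyc_paths).
Proof.
move=> p q r e; rewrite !mem_cyc_paths => okr.
have sr := path_cat_size e.
have epq : finish p = start q.
  by apply/eqP; apply: contraPT (e) => ne; rewrite path_cat_none.
have [r' [e' str _ _]] := path_catE epq; move: e'; rewrite e => -[rr]; subst r'.
have szr := okpath_le okr.
have N0 x y : (x + y)%N = size (arrows r) -> (x < N)%N || ((x == N) && (y == 0%N)).
  by move=> xy; lia.
split.
  rewrite /okpath; have [//|pN /=] := ltnP (size (arrows p)) N.
  have /eqP pE : size (arrows p) == N by lia.
  rewrite pE eqxx -str; move: okr; rewrite /okpath sr pE; lia.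
rewrite /okpath; have [//|qN /=] := ltnP (size (arrows q)) N.
have /eqP qE : size (arrows q) == N by lia.
have /size0nil p0 : size (arrows p) = 0%N by lia.
have -> : start q = start r by rewrite -epq /finish p0 str.
by rewrite qE eqxx; move: okr; rewrite /okpath sr qE p0 ltnn eqxx.
Qed.

Lemma cyc_paths_short (p : qpath cyc) : (size (arrows p) < 2)%N -> p \in cyc_paths.
Proof. by rewrite mem_cyc_paths /okpath; lia. Qed.

Definition cyc_pathset : pathset cyc :=
  @Pathset cyc cyc_paths cyc_paths_closed cyc_paths_short (ord0 : 'I_N).

End Cycle.

Section CycleAlgebra.
Variables (K : fieldType) (m : nat) (A : falgType K).
Local Notation N := m.+2.
Local Notation V := 'I_m.+2.
Variables (el : vertex (cyc m) -> seq (arrow (cyc m)) -> A)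
  (cf : vertex (cyc m) -> seq (arrow (cyc m)) -> A -> K).
Hypothesis H : presented el cf.
Hypothesis nzE : forall v s, el v s != 0 <->
  exists w : is_walk v s, mkpath w \in cyc_paths m.
Local Notation sh l v := (iter l (@ordS N) v).
Local Notation idm := (@vertex_idem K A (cyc m) el).
Local Notation arr := (@arrow_el K A (cyc m) el).
Local Notation nz := (@nonzero K A (cyc m) el).
Local Notation chi := (@vertex_char K A (cyc m) cf).

Definition cyc_path (v : V) (l : nat) : A := el v (cwalk v l).
Local Notation E := cyc_path.

Lemma nz_cwalk v l : nz v (cwalk v l) = okpath v l.
Proof.
apply/idP/idP => [/nzE[w]|ok]; first by rewrite mem_cyc_paths /arrows /= size_traject.
by apply/nzE; exists (cwalk_walk v l); rewrite mem_cyc_paths /arrows /= size_traject.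
Qed.

Lemma nzP v s : nz v s -> s = cwalk v (size s) /\ okpath v (size s).
Proof.
by move=> /nzE[w]; rewrite mem_cyc_paths => ok; move: (w); rewrite is_walk_cyc => /eqP.
Qed.

Lemma E_cat v k l : E v k * E (sh k v) l = E v (k + l).
Proof. by rewrite /cyc_path (el_mul H) endp_cwalk eqxx -cwalk_cat. Qed.

Lemma E_neq v k u l : u != sh k v -> E v k * E u l = 0.
Proof. by move=> ne; rewrite /cyc_path (el_mul H) endp_cwalk (negPf ne). Qed.

Lemma E0 v l : ~~ okpath v l -> E v l = 0.
Proof. by rewrite -nz_cwalk negbK => /eqP. Qed.

(** A nilpotent normal element that generates the radical; the elements [idm v
    * T ^+ l] span [A]. *)
Definition arrow_sum : A := \sum_(v : V) arr v.
Local Notation T := arrow_sum.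

Lemma arrE (v : V) : arr v = E v 1. Proof. by []. Qed.
Lemma E_T v l : E v l * T = E v l.+1.
Proof.
rewrite /arrow_sum mulr_sumr (bigD1 (sh l v)) //= big1 => [|u ul].
  by rewrite arrE E_cat addn1 addr0.
by rewrite arrE E_neq.
Qed.

Lemma T_E v l : T * E (ordS v) l = E v l.+1.
Proof.
rewrite /arrow_sum mulr_suml (bigD1 v) //= big1 => [|u uv].
  by rewrite arrE -[ordS v]/(sh 1 v) E_cat add1n addr0.
rewrite arrE E_neq //; apply: contra uv => /eqP e.
by apply/eqP; apply: (@shift_inj m 1).
Qed.

Lemma E_Tn v l : E v l = idm v * T ^+ l.
Proof. by elim: l => [|l IH]; [rewrite mulr1|rewrite exprSr mulrA -IH E_T]. Qed.

Lemma Tn_E u l : T ^+ l * idm (sh l u) = E u l.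
Proof.
elim: l u => [|l IH] u; first by rewrite mul1r.
by rewrite exprS -mulrA iterSr IH T_E.
Qed.

Lemma T_nil : T ^+ N.+1 = 0.
Proof.
rewrite -[LHS](mul1r _) (el_1 H) mulr_suml big1 // => v _.
by rewrite -/(idm v) -E_Tn E0 // /okpath; lia.
Qed.

Lemma T_comm_l a : exists b, a * T = T * b.
Proof.
move: a; apply: (el_ind H); first by exists 0; rewrite mul0r mulr0.
move=> k v s a /nzP[sE _] [b bE].
exists (k *: E (ordS v) (size s) + b).
by rewrite mulrDl bE mulrDr -scalerAr T_E -E_T /cyc_path -sE scalerAl.
Qed.

Lemma T_comm_r a : exists b, T * a = b * T.
Proof.
move: a; apply: (el_ind H); first by exists 0; rewrite mul0r mulr0.
move=> k v s a /nzP[sE _] [b bE].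
exists (k *: E (ord_pred v) (size s) + b).
rewrite mulrDr bE mulrDl; congr (_ + _).
by rewrite -scalerAl E_T -T_E ord_predK /cyc_path -sE scalerAr.
Qed.

Definition pT (p : {poly K}) : A := horner_alg T p.

Lemma pT_mono k l p : pT (k *: 'X^l + p) = k *: T ^+ l + pT p.
Proof.
by rewrite /pT rmorphD -mul_polyC rmorphM rmorphXn /= horner_algX horner_algC mulr_algl.
Qed.

(** On either side, the modules generated by the vertices are quotients of
    [K[T]], and these are uniserial because [T] is nilpotent. *)
Lemma idm_poly v a : exists p, idm v * a = idm v * pT p.
Proof.
move: a; apply: (el_ind H); first by exists 0; rewrite /pT rmorph0.
move=> k u s a /nzP[sE _] [p pE].
have [e|uv] := eqVneq u v; last first.
  by exists p; rewrite mulrDr -scalerAr (idm_el H) (negPf uv) scaler0 add0r.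
exists (k *: 'X^(size s) + p); rewrite mulrDr pE pT_mono mulrDr; congr (_ + _).
by subst u; rewrite -!scalerAr (idm_el1 H) {1}sE -/(E v _) E_Tn.
Qed.

Lemma poly_idm v a : exists p, a * idm v = pT p * idm v.
Proof.
move: a; apply: (el_ind H); first by exists 0; rewrite /pT rmorph0.
move=> k u s a /nzP[sE _] [p pE].
rewrite mulrDl pE -scalerAl (el_idm H).
have [->|uv] := eqVneq v (endp u s); last first.
  by exists p; rewrite scaler0 add0r.
exists (k *: 'X^(size s) + p); rewrite pT_mono mulrDl; congr (_ + _).
have -> : endp u s = sh (size s) u by rewrite {1}sE endp_cwalk.
by rewrite -scalerAl Tn_E /cyc_path -sE.
Qed.

Lemma pT_comm p q : pT p * pT q = pT q * pT p.
Proof. by rewrite /pT -!rmorphM mulrC. Qed.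

(** The element [pT p] differs from a nonzero scalar by a nilpotent element. *)
Lemma pT_unit (p : {poly K}) : p`_0 != 0 -> exists q, pT p * pT q = 1.
Proof.
move=> c0; set c := p`_0 in c0.
have [q pE] : exists q, p = c%:P * (1 - q * 'X).
  exists (- c^-1 *: (drop_poly 1 p)).
  rewrite mulrBr mulr1 -{1}(poly_take_drop 1 p) expr1; congr (_ + _).
    by apply/polyP => i; rewrite coef_take_poly coefC; case: i.
  by rewrite -scalerAl scaleNr mulrN opprK mul_polyC scalerA mulfV // scale1r.
pose x := pT (q * 'X).
have xN : x ^+ N.+1 = 0.
  by rewrite /x /pT -rmorphXn exprMn rmorphM !rmorphXn /= horner_algX T_nil mulr0.
have sE : (1 - x) * (\sum_(i < N.+1) x ^+ i) = 1.
  by apply: oppr_inj; rewrite -mulNr opprB -subrX1 xN sub0r.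
have e1 : pT p = c *: (1 - x).
  by rewrite pE /pT rmorphM rmorphB rmorph1 /= horner_algC mulr_algl.
exists (c^-1 *: \sum_(i < N.+1) (q * 'X) ^+ i).
have -> : pT (c^-1 *: \sum_(i < N.+1) (q * 'X) ^+ i) = c^-1 *: \sum_(i < N.+1) x ^+ i.
  rewrite /pT -mul_polyC rmorphM /= horner_algC mulr_algl rmorph_sum; congr (_ *: _).
  by apply: eq_bigr => i _; rewrite rmorphXn.
by rewrite e1 -scalerAl -scalerAr scalerA mulfV // scale1r.
Qed.

Lemma pT_fact (p : {poly K}) : p != 0 -> exists k (q : {poly K}), q`_0 != 0 /\ pT p = pT q * T ^+ k.
Proof.
move=> p0; have [k] := multiplicity_XsubC p 0; rewrite p0 /= => -[q q0 ->].
exists k, q; split; first by rewrite -horner_coef0.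
by rewrite /pT rmorphM rmorphXn /= subr0 horner_algX.
Qed.

Lemma T_pT p : T * pT p = pT p * T.
Proof. by have := pT_comm 'X p; rewrite /pT horner_algX. Qed.

Lemma Tn_pT k p : T ^+ k * pT p = pT p * T ^+ k.
Proof. by have := pT_comm 'X^k p; rewrite /pT rmorphXn /= horner_algX. Qed.

Lemma pT_dvd p q : (exists r, pT p = pT r * pT q) \/ (exists r, pT q = pT r * pT p).
Proof.
have [->|p0] := eqVneq p 0; first by left; exists 0; rewrite /pT rmorph0 mul0r.
have [->|q0] := eqVneq q 0; first by right; exists 0; rewrite /pT rmorph0 mul0r.
have [k [p' [p'0 ->]]] := pT_fact p0; have [l [q' [q'0 ->]]] := pT_fact q0.
have main (a b : {poly K}) i j : a`_0 != 0 -> (j <= i)%N ->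
    exists r, pT b * T ^+ i = pT r * (pT a * T ^+ j).
  move=> /pT_unit[a' aa'] ji; exists (b * a' * 'X^(i - j)).
  have aa2 : pT a' * pT a = 1 by rewrite pT_comm.
  rewrite /pT !rmorphM rmorphXn /= horner_algX -!/(pT _) -!mulrA; congr (_ * _).
  by rewrite [T ^+ _ * _]mulrA Tn_pT -mulrA -exprD subnK // mulrA aa2 mul1r.
have [kl|/ltnW lk] := leqP k l; [right|left]; exact: main.
Qed.

(** The powers of the radical, generated by [T]. *)
Definition rad k (a : A) : Prop := exists b, a = T ^+ k * b.

Lemma rad_alt k a : rad k a <-> exists b, a = b * T ^+ k.
Proof.
split=> [[b ->]|[b ->]]; elim: k b => [|k IH] b.
- by exists b; rewrite mul1r mulr1.
- have [c cE] := IH b; rewrite exprS -mulrA cE; have [c' c'E] := T_comm_r c.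
  by exists c'; rewrite mulrA c'E -mulrA -exprS.
- by exists b; rewrite mul1r mulr1.
- have [c cE] := IH b; rewrite exprSr mulrA cE -mulrA; have [c' ->] := T_comm_l c.
  by exists c'; rewrite mulrA -exprSr.
Qed.

Lemma radD k a b : rad k a -> rad k b -> rad k (a + b).
Proof. by move=> [c ->] [d ->]; exists (c + d); rewrite mulrDr. Qed.

Lemma rad0 k : rad k 0. Proof. by exists 0; rewrite mulr0. Qed.

Lemma radM k l a b : rad k a -> rad l b -> rad (k + l) (a * b).
Proof.
move=> [c ->] /rad_alt[d ->]; rewrite mulrA.
have /rad_alt[f fE] : rad k (T ^+ k * (c * d)) by exists (c * d).
rewrite -[T ^+ k * c * d]mulrA fE -mulrA -exprD.
by apply/rad_alt; exists f.
Qed.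

Lemma rad_nil a : rad N.+1 a -> a = 0.
Proof. by move=> [b ->]; rewrite T_nil mul0r. Qed.

Lemma pT_rad (p : {poly K}) : p`_0 = 0 -> rad 1 (pT p).
Proof.
move=> p0; exists (pT (drop_poly 1 p)); rewrite expr1 T_pT.
rewrite -{1}(poly_take_drop 1 p) (_ : take_poly 1 p = 0) ?add0r.
  by rewrite /pT rmorphM /= expr1 horner_algX.
by apply/polyP => i; rewrite coef_take_poly coef0; case: i.
Qed.

Lemma rad_unit_l u v r : ~ rad 1 (idm u * r * idm v) -> exists s, s * (idm u * r * idm v) = idm v.
Proof.
have [p ->] := poly_idm v (idm u * r) => nr.
have [p0|/pT_unit[q pq]] := eqVneq (p`_0) 0; last first.
  by exists (pT q); rewrite mulrA pT_comm pq mul1r.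
by case: nr; rewrite -[1%N]addn0; apply: radM; [exact: pT_rad|exists (idm v); rewrite mul1r].
Qed.

Lemma rad_unit_r u v r : ~ rad 1 (idm v * r * idm u) -> exists s, (idm v * r * idm u) * s = idm v.
Proof.
rewrite -mulrA; have [p ->] := idm_poly v (r * idm u) => nr.
have [p0|/pT_unit[q pq]] := eqVneq (p`_0) 0; last first.
  by exists (pT q); rewrite -mulrA pq mulr1.
by case: nr; rewrite -[1%N]add0n; apply: radM; [exists (idm v); rewrite mul1r|exact: pT_rad].
Qed.

Lemma chain_l v a b : a * idm v = a -> b * idm v = b ->
  (exists r, a = r * b) \/ (exists r, b = r * a).
Proof.
have [p pE] := poly_idm v a; have [q qE] := poly_idm v b.
rewrite pE qE => <- <-; have [[r ->]|[r ->]] := pT_dvd p q; [left|right];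
  by exists (pT r); rewrite mulrA.
Qed.

Lemma chain_r v a b : idm v * a = a -> idm v * b = b ->
  (exists r, a = b * r) \/ (exists r, b = a * r).
Proof.
have [p pE] := idm_poly v a; have [q qE] := idm_poly v b.
rewrite pE qE => <- <-; have [[r ->]|[r ->]] := pT_dvd p q; [left|right];
  by exists (pT r); rewrite -mulrA [in RHS]pT_comm.
Qed.

Lemma cycle_uniserial_left (P : lmodType A) : finitely_generated P ->
  projective_module P -> indecomposable_module P -> uniserial_module P.
Proof.
apply: (@uniserial_projective A V idm rad N.+1).
- by rewrite -(el_1 H).
- exact: (idm_idm H).
- exact: (el_nil H).
- by move=> a; exists a; rewrite mul1r.
- exact: rad0.
- exact: radD.
- by move=> k a b ha hb; rewrite -addn1; exact: radM.
- exact: rad_nil.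
- exact: rad_unit_l.
- exact: chain_l.
Qed.

Lemma cycle_uniserial_right (P : lmodType A^c) : finitely_generated P ->
  projective_module P -> indecomposable_module P -> uniserial_module P.
Proof.
apply: (@uniserial_projective A^c V idm rad N.+1).
- by rewrite -[RHS]/(1 : A) (el_1 H).
- exact: (idm_idm H).
- exact: (el_nil H).
- by move=> a; exists a; rewrite mul1r.
- exact: rad0.
- exact: radD.
- move=> k a b ha hb; rewrite -add1n; exact: (radM hb ha).
- exact: rad_nil.
- move=> u v r; rewrite -[X in rad 1 X]/((idm v : A) * ((r : A) * (idm u : A))) mulrA.
  by move=> /rad_unit_r[s sE]; exists s; rewrite -[RHS]sE -[LHS]/(((idm v : A) * ((r : A) * (idm u : A))) * (s : A)) mulrA.
- exact: chain_r.
Qed.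

Lemma rad_chi a : (forall v, chi v a = 0) -> rad 1 a.
Proof.
move=> ha; have -> : a = a - \sum_v chi v a *: idm v.
  by rewrite big1 ?subr0 // => v _; rewrite ha scale0r.
move: {ha} a; apply: (el_ind H).
  by rewrite big1 ?subr0 => [|v _]; [exact: rad0|rewrite /vertex_char (cf0 H) scale0r].
move=> k u s a ns ra.
have -> : k *: el u s + a - \sum_v chi v (k *: el u s + a) *: idm v =
    k *: (el u s - \sum_v chi v (el u s) *: idm v) + (a - \sum_v chi v a *: idm v).
  rewrite scalerBr scaler_sumr addrACA -opprD -big_split; congr (_ - _).
  by apply: eq_bigr => v _; rewrite /vertex_char (cfD H) (cfZ H) scalerDl scalerA.
apply: radD => //; rewrite -[k *: _]mulr_algl -[1%N]add0n; apply: radM.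
  by exists k%:A; rewrite mul1r.
case: s ns => [|c s] ns.
  rewrite (bigD1 u) //= big1 => [|v vu].
    by rewrite /vertex_char (cf_el1 H) ?(nz_nil H) // scale1r addr0 subrr; exact: rad0.
  by rewrite /vertex_char (cf_el H _ _ (nz_nil H v)) xpair_eqE eq_sym (negPf vu) scale0r.
rewrite big1 => [|v _].
  rewrite subr0; have [-> _] := nzP ns; rewrite -/(E u _) /= -T_E.
  by exists (E (ordS u) (size s)); rewrite expr1.
by rewrite /vertex_char (cf_el H _ _ (nz_nil H v)) xpair_eqE andbF scale0r.
Qed.

(** The characters of a central idempotent agree at consecutive vertices, so
    they are all [0] or all [1]; and an idempotent in the radical is [0]. *)
Lemma cycle_connected : connected_algebra A.
Proof.
move=> e ee ec.
have idem0 f : f * f = f -> rad 1 f -> f = 0.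
  move=> ff rf; suff h k : rad k.+1 f by exact: (rad_nil (h N)).
  by elim: k => // k IH; rewrite -{1}ff -add1n; exact: radM.
have cS v : chi v e = chi (ordS v) e.
  have n1 : nz v [:: v : arrow (cyc m)] by apply: (el_arrow H).
  have h1 := @cf_mulr _ _ _ _ _ H v [::] [:: v : arrow (cyc m)] e n1.
  have h2 := @cf_mull _ _ _ _ _ H v [:: v : arrow (cyc m)] [::] e n1.
  by rewrite /vertex_char -h1 -[RHS]h2 /= ec.
have c0 v : chi v e = chi (ord0 : V) e.
  have ind l : (l < N)%N -> chi (inord l : V) e = chi (ord0 : V) e.
    elim: l => [_|l IH lN]; first by congr (chi _ e); apply: val_inj; rewrite /= inordK.
    rewrite -IH ?(ltnW lN) // [RHS]cS; congr (chi _ e); apply: val_inj.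
    by rewrite /= !inordK ?(ltnW lN) // modn_small.
  by rewrite -[v]inord_val ind.
have cc : chi (ord0 : V) e * chi (ord0 : V) e = chi (ord0 : V) e.
  by rewrite -(chiM H) ee.
have : chi (ord0 : V) e * (1 - chi (ord0 : V) e) = 0 by rewrite mulrBr mulr1 cc subrr.
move/eqP; rewrite mulf_eq0 subr_eq0 => /orP[/eqP h|/eqP h]; [left|right].
  by apply: idem0 => //; apply: rad_chi => v; rewrite c0.
apply/eqP; rewrite eq_sym -subr_eq0; apply/eqP; apply: idem0.
  by rewrite mulrBr mulr1 mulrBl mul1r ee subrr subr0.
by apply: rad_chi => v; rewrite /vertex_char (cfB H) -!/(chi v _) (chi1 H) c0 -h subrr.
Qed.

End CycleAlgebra.

Section CycleDomdim.
Variables (K : fieldType) (m : nat) (A : falgType K).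
Local Notation N := m.+2.
Local Notation V := 'I_m.+2.
Variables (el : vertex (cyc m) -> seq (arrow (cyc m)) -> A)
  (cf : vertex (cyc m) -> seq (arrow (cyc m)) -> A -> K).
Hypothesis H : presented el cf.
Hypothesis nzE : forall v s, el v s != 0 <->
  exists w : is_walk v s, mkpath w \in cyc_paths m.
Local Notation sh l v := (iter l (@ordS N) v).
Local Notation idm := (@vertex_idem K A (cyc m) el).
Local Notation arr := (@arrow_el K A (cyc m) el).
Local Notation nz := (@nonzero K A (cyc m) el).
Local Notation E := (@cyc_path K m A el).
Local Notation o := (ord0 : V).

Lemma size_cwalk (v : V) l : size (cwalk v l) = l. Proof. exact: size_traject. Qed.

Lemma okpath_o l : okpath o l = (l < N)%N.
Proof. by rewrite /okpath eqxx andbF orbF. Qed.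

(** The path with [N] arrows from [v] to [v] has every path ending at [v] as a
    tail and every path starting at [v] as an initial segment. *)
Lemma cycle_good (v : V) : v != o -> good_vertex el v.
Proof.
move=> v0; exists v, (cwalk v N); split.
- by rewrite (nz_cwalk nzE) /okpath eqxx v0 orbT.
- by rewrite endp_cwalk iterN.
- move=> u s ns us; have [sE /okpath_le sN] := nzP nzE ns.
  rewrite sE endp_cwalk in us; exists (cwalk v (N - size s)).
  rewrite -{1}(subnK sN) cwalk_cat [X in _ = _ ++ X]sE; congr (_ ++ cwalk _ _).
  by apply: (@shift_inj m (size s)); rewrite -iterD addnC subnK // iterN.
- move=> s ns; have [sE /okpath_le sN] := nzP nzE ns.
  exists (cwalk (sh (size s) v) (N - size s)).
  by rewrite {1}sE -cwalk_cat subnKC.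
Qed.

Lemma sh_ordmax : ordS (ord_max : V) = o.
Proof. by apply: val_inj; rewrite /= modnn. Qed.

(** Left multiplication by the arrow into [0] embeds the projective module at
    [0] properly into another one. *)
Lemma cycle_not_selfinjective : ~ selfinjective A.
Proof.
move=> /fg_injective_baer bA; pose c : V := ord_max.
have cS a : arr c * a = 0 -> rm (idm o : (A^c)^o) a = 0.
  move=> ca; rewrite rm_reg; apply: (cf_eq0 H) => u s ns; apply/eqP/negPn/negP => h.
  have [ou _] := cf_mull_neq0 H ns h; subst u; have [sE ok] := nzP nzE ns.
  have n1 : nz c ([:: c : arrow (cyc m)] ++ s).
    have -> : [:: c : arrow (cyc m)] ++ s = cwalk c (size s).+1.
      by rewrite {1}sE -sh_ordmax -(cwalk_cat c 1).
    rewrite (nz_cwalk nzE); move: ok; rewrite /okpath eqxx andbF orbF => sN.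
    by rewrite (_ : c != o) // andbT orbC -leq_eqVlt.
  have := cf_mull H a n1; rewrite -/(arr c) ca (cf0 H) /endp /= sh_ordmax => e.
  by move: h; rewrite (idm_cf H) // -e eqxx.
have [z zE] := baer_cyclic bA cS; rewrite rm_reg in zE.
have : cf o [::] ((z : A) * arr c) != 0.
  by rewrite zE (cf_el1 H) ?oner_eq0 //; exact: (nz_nil H).
by case/(cf_mulr_neq0 H (nz_nil H o)) => -[].
Qed.

(** The minimal projective resolution of the simple module at [0]: the terms are
    at the vertices [0, 1, 0, 2, 0, 3, ...] and the differentials are the paths
    between them, of length [k.+1] from [0] to [k.+1] and [N - k.+1] back. *)
Definition cyc_e (k : nat) : A := idm (if odd k then sh k.+1./2 o else o).
Definition cyc_x (k : nat) : A :=
  if k is k'.+1 then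
    if odd k' then E (sh k'.+1./2 o) (N - k'.+1./2) else E o k'./2.+1
  else 0.

Lemma cyc_xo k : cyc_x (k.*2).+1 = E o k.+1.
Proof. by rewrite /cyc_x odd_double doubleK. Qed.
Lemma cyc_xe k : cyc_x (k.*2).+2 = E (sh k.+1 o) (N - k.+1).
Proof. by rewrite /cyc_x /= odd_double /= doubleK. Qed.
Lemma cyc_eo k : cyc_e (k.*2).+1 = idm (sh k.+1 o).
Proof. by rewrite /cyc_e /= odd_double /= doubleK. Qed.
Lemma cyc_ee k : cyc_e k.*2 = idm o.
Proof. by rewrite /cyc_e odd_double. Qed.

Lemma parity k : exists j, k = j.*2 \/ k = (j.*2).+1.
Proof.
by exists k./2; rewrite -{1 3}(odd_double_half k); case: (odd k); [right|left].
Qed.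

Lemma sh_back k : (k <= N)%N -> sh (N - k) (sh k o) = o.
Proof. by move=> kN; rewrite -iterD subnK // iterN. Qed.

Lemma sh_neq0 k : (0 < k)%N -> (k < N)%N -> sh k o != o.
Proof.
move=> k0 kN; apply/eqP => /(congr1 val); rewrite [LHS]iter0_small //= => e.
by rewrite e in k0.
Qed.

Lemma E_idm_r (v : V) l : E v l * idm (sh l v) = E v l.
Proof. by rewrite /cyc_path -[sh l v](endp_cwalk v l) (el_idm1 H). Qed.

(** A path of length less than [l] in the support of [a] would survive the
    multiplication by [E v k]. *)
Lemma ann_long (v : V) k l (a : A) : idm (sh k v) * a = a -> E v k * a = 0 ->
  (forall j, (j < l)%N -> okpath v (k + j)) ->
  exists b, a = E (sh k v) l * b.
Proof.
move=> ia ea short; apply: (left_multiple H ia) => s ns c; have [sE ok] := nzP nzE ns.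
have [ls|sl] := leqP l (size s).
  exists (cwalk (sh l (sh k v)) (size s - l)).
  by rewrite -cwalk_cat subnKC.
have n1 : nz v (cwalk v k ++ s) by rewrite sE -cwalk_cat (nz_cwalk nzE); exact: short.
have := cf_mull H a n1; rewrite -/(E v k) ea (cf0 H) endp_cwalk => e.
by rewrite -e eqxx in c.
Qed.

Lemma ann_long_left (v : V) k l (a : A) : a * idm (sh l v) = a -> a * E (sh l v) k = 0 ->
  (forall u j, (j < l)%N -> sh j u = sh l v -> okpath u (j + k)) ->
  exists b, a = b * E v l.
Proof.
move=> ia ea short; apply: (right_multiple H) => u s ns c; have [sE ok] := nzP nzE ns.
have us : sh (size s) u = sh l v.
  move: c; rewrite -{1}ia => /(cf_mulr_neq0 H ns)[t].
  by rewrite cats0 => <-; rewrite sE endp_cwalk size_cwalk.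
have [ls|sl] := leqP l (size s).
  have e : sh (size s - l) u = v by apply: (@shift_inj m l); rewrite -iterD addnC subnK.
  by exists (cwalk u (size s - l)); rewrite ?endp_cwalk // -e -cwalk_cat subnK.
have n1 : nz u (s ++ cwalk (sh l v) k).
  by rewrite sE -us -cwalk_cat (nz_cwalk nzE); exact: short.
have := cf_mulr H a n1; rewrite {2}sE endp_cwalk us -/(E (sh l v) k) ea (cf0 H) => e.
by rewrite -e eqxx in c.
Qed.

Lemma cyc_resolving i : (i <= 2 * N - 3)%N -> resolving cyc_x cyc_e i.
Proof.
move=> iN; split=> //.
- by move=> k; exact: (idm_idm H).
- move=> k _; have [j [->|->]] := parity k.
    by rewrite cyc_ee cyc_xo (idm_el1 H).
  by rewrite cyc_eo cyc_xe (idm_el1 H).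
- move=> k ki; have [j [kE|kE]] := parity k; rewrite kE.
    by rewrite cyc_xo cyc_eo E_idm_r.
  rewrite cyc_xe -doubleS cyc_ee.
  have back : sh (N - j.+1) (sh j.+1 o) = o by apply: sh_back; lia.
  by rewrite -{2}back E_idm_r.
- move=> k ki; have [[|j] [kE|kE]] := parity k; rewrite kE.
  + by rewrite mul0r.
  + rewrite (cyc_xo 0) (cyc_xe 0) (E_cat H) (E0 nzE) // okpath_o; lia.
  + rewrite doubleS cyc_xe -doubleS cyc_xo.
    rewrite -[X in _ * E X _](sh_back (k := j.+1)); last by lia.
    by rewrite (E_cat H) (E0 nzE) // /okpath; lia.
  + rewrite cyc_xo cyc_xe (E_cat H) (E0 nzE) // subnKC; last by lia.
    by rewrite okpath_o ltnn.
- move=> k a k0 ki xa; have [[|j] [kE|kE]] := parity k; rewrite kE in k0 ki xa *.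
  + by [].
  + rewrite (cyc_xo 0) in xa; rewrite (cyc_eo 0) (cyc_xe 0).
    apply: ann_long; first by rewrite mulrA (idm_idm H).
      by rewrite mulrA E_idm_r.
    by move=> l lN; rewrite /okpath; lia.
  + rewrite doubleS cyc_xe in xa; rewrite cyc_ee cyc_xo.
    have back : sh (N - j.+1) (sh j.+1 o) = o by apply: sh_back; lia.
    rewrite -[X in exists b, _ = E X _ * b]back.
    apply: ann_long; first by rewrite back mulrA (idm_idm H).
      by rewrite mulrA -{2}back E_idm_r.
    have := @sh_neq0 j.+1 isT _; rewrite /okpath => h l lN; rewrite h; lia.
  + rewrite cyc_xo in xa; rewrite cyc_eo cyc_xe.
    apply: ann_long; first by rewrite mulrA (idm_idm H).
      by rewrite mulrA E_idm_r.
    by move=> l lN; rewrite /okpath; lia.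
Qed.

(** The extension groups of the simple module at [0] with coefficients in [A]
    vanish in degrees at most [2N - 3]. *)
Lemma cyc_ext0 i (y : A) : (0 < i)%N -> (i <= 2 * N - 3)%N ->
  y * cyc_e i = y -> (forall a, cyc_x i * a = 0 -> y * a = 0) ->
  exists u, y = u * cyc_x i.
Proof.
move=> i0 iN ye yk; have [[|j] [iE|iE]] := parity i; rewrite {}iE in i0 iN ye yk *.
- by [].
- rewrite (cyc_xo 0) in yk *; rewrite (cyc_eo 0) in ye.
  apply: (ann_long_left (k := N - 1)) => //.
    by apply: yk; rewrite (E_cat H) (E0 nzE) // okpath_o; lia.
  by move=> u [|l] // _ _; rewrite /okpath; lia.
- rewrite doubleS cyc_xe in yk *; rewrite cyc_ee in ye.
  have back : sh (N - j.+1) (sh j.+1 o) = o by apply: sh_back; lia.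
  apply: (ann_long_left (k := j.+2)); rewrite ?back //.
    by apply: yk; rewrite -[X in _ * E X _]back (E_cat H) (E0 nzE) // /okpath; lia.
  move=> u l lN ul; rewrite /okpath; have [//|ge] := ltnP (l + j.+2) N.
  have -> : (l + j.+2 == N)%N by lia.
  have -> : u = sh j.+2 o; last by rewrite sh_neq0 //; lia.
  apply: (@shift_inj m l); rewrite ul -iterD (_ : (l + j.+2)%N = N) ?iterN //; lia.
- rewrite cyc_xo in yk *; rewrite cyc_eo in ye.
  apply: (ann_long_left (k := N - j.+2)) => //.
    apply: yk; rewrite (E_cat H) (E0 nzE) // subnKC; last by lia.
    by rewrite okpath_o ltnn.
  by move=> u l lj _; rewrite /okpath; lia.
Qed.

Lemma cycle_socle0 (M : lmodType A^c) (z : M) : socle_at el o z <->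
  rm z (cyc_e 0) = z /\ rm z (cyc_x 1) = 0.
Proof.
rewrite (cyc_ee 0) (cyc_xo 0); split=> [[zo za]|[zo za]]; first by split=> //; exact: (za o).
split=> // a; rewrite -zo rmA /vertex_idem (el_mul H); case: eqP => [e|_]; last exact: rm0r.
by rewrite /= in e; subst a.
Qed.

(** A socle element at [0] would give a class that [cyc_ext0] excludes, so
    only good vertices occur in the socle. *)
Lemma cycle_coresolution (I : nat -> lmodType A^c) (eps : {linear (A^c)^o -> I 0%N})
    (d : forall i, {linear I i -> I i.+1}) i :
  minimal_injective_coresolution eps d -> (i < 2 * N - 2)%N -> projective_module (I i).
Proof.
move=> min iN; apply: (good_socle_projective H (min_fg min i) (min_baer min (i := i))).
move=> v z hz z0; have [v0|] := eqVneq v o; last exact: cycle_good.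
subst v; case/eqP: z0; apply: contrapT => /eqP z0.
have [ze zx] := (cycle_socle0 z).1 hz.
case: i iN z hz z0 ze zx => [|i] iN z hz z0 ze zx.
  have [y yE] := (min_exact0 min z).1 (min_socle H min hz).
  case/eqP: z0; rewrite -yE; suff -> : y = 0 by rewrite linear0.
  apply: (cf_eq0 H) => u s ns; apply/eqP/negPn/negP => c.
  have [_ inj _ _ _] := min.
  have yo : y * idm o = y by apply: inj; rewrite -rm_reg rm_lin yE (proj1 hz).
  have ya : y * arr o = 0 by apply: inj; rewrite -rm_reg rm_lin yE (proj2 hz) linear0.
  have [sE ok] := nzP nzE ns.
  have us : sh (size s) u = o.
    move: c; rewrite -{1}yo => /(cf_mulr_neq0 H ns)[t].
    by rewrite cats0 => <-; rewrite sE endp_cwalk size_cwalk.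
  have n1 : nz u (s ++ [:: o : arrow (cyc m)]).
    have -> : s ++ [:: o : arrow (cyc m)] = cwalk u (size s + 1).
      by rewrite cwalk_cat us -sE.
    rewrite (nz_cwalk nzE) /okpath; have [//|ge] := ltnP (size s + 1) N.
    have sN : (size s < N)%N.
      move: ok; rewrite /okpath; case: ltngtP => // sN /= uo.
      by move: us; rewrite sN iterN => /eqP; rewrite (negPf uo).
    have -> : (size s + 1 == N)%N by lia.
    have us0 : sh (size s) o != o by apply: sh_neq0; lia.
    by apply: contra us0 => /eqP uo; rewrite -{1}uo us.
  have := cf_mulr H y n1; rewrite {2}sE endp_cwalk us -/(arr o) ya (cf0 H) => e.
  by rewrite -e eqxx in c.
have iN' : (i.+1 <= 2 * N - 3)%N by lia.
have hmin j (z' : I j) : rm z' (cyc_e 0) = z' -> rm z' (cyc_x 1) = 0 -> d j z' = 0.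
  by move=> h1 h2; apply: (min_socle H min (v := o)); apply/cycle_socle0.
have [y [ye yk ynt]] := socle_ext min (cyc_resolving iN') isT hmin z0 ze zx.
by apply: ynt; exact: cyc_ext0 yk.
Qed.

Lemma cycle_domdim : domdim A = Some (2 * N - 2)%N.
Proof.
apply: domdim_eq => I eps d min; split; first by move=> i iN; exact: (cycle_coresolution min iN).
apply: (coresolution_bound H min) => //; last exact: cycle_not_selfinjective.
by rewrite card_ord.
Qed.

End CycleDomdim.

Theorem mainTheorem2 (K : fieldType) (n : nat) (n_ge2 : (2 <= n)%N) :
  (forall A : falgType K,
     monomial_algebra A -> has_n_simples A n -> ~ selfinjective A ->
     exists2 d : nat, domdim A = Some d & (d <= 2 * n - 2)%N) /\
  (exists A : falgType K,
     [/\ nakayama_algebra A, monomial_algebra A, has_n_simples A n,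
         ~ selfinjective A & domdim A = Some (2 * n - 2)%N]).
Proof.
split=> [A monA nA nselfA|].
  have [Q [el [cf H]]] := monomial_presented monA.
  have nE := has_n_simples_uniq (presented_simples H) nA.
  by apply: domdim_le => I eps d min; exact: (coresolution_bound H min).
case: n n_ge2 => [|[|m]] // _.
have [el [cf [H nzE]]] := pq_presented K (cyc_pathset m).
exists (path_quotient K (cyc_pathset m)).
have conn := cycle_connected H nzE.
have [mon qui] := pq_monomial conn.
split=> //.
- split=> //; [exact: (cycle_uniserial_right H nzE)|exact: (cycle_uniserial_left H nzE)].
- by have := presented_simples H; rewrite card_ord.
- exact: (cycle_not_selfinjective H nzE).
- exact: (cycle_domdim H nzE).
Qed.
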